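(* Let $d,n\ge1$ and let $F$ be a $\mathbb{C}^{n\times n}$-valued function of $d$ complex variables (on $\mathbb{D}^d$). The following statements are equivalent: (1) $F\in\mathcal{CIHA}^{\rm rat}(\mathbb{D}^d,\mathbb{C}^n)$. (2$'$) There exist rational $\mathbb{C}^{N_k\times n}$-valued functions $\xi_k$, with some $N_k\in\mathbb{N}$, $k=1,\dots,d$, which have no singularities on $\mathbb{D}^d$ and satisfy $$F(\omega)^*+F(\zeta)=\sum_{k=1}^d(1-\overline{\omega}_k\zeta_k)\xi_k(\omega)^*\xi_k(\zeta),\qquad\omega,\zeta\in\mathbb{D}^d.$$ (3) There exist $m,m_1,\dots,m_d\in\mathbb{Z}_+$, with $m=m_1+\cdots+m_d$, a unitary matrix $W\in\mathbb{C}^{m\times m}$, a matrix $\beta\in\mathbb{C}^{n\times n}$, and a matrix $V\in\mathbb{C}^{m\times n}$ such that $$F(\zeta)=\beta+V^*(W-P(\zeta))^{-1}(W+P(\zeta))V,\qquad\zeta\in\mathbb{D}^d,$$ where $\beta+\beta^*=0$ and $P(\zeta)=\operatorname{Diag}[\zeta_1I_{m_1},\dots,\zeta_dI_{m_d}]$.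
   Context: $\mathbb{D}^d=\{\zeta\in\mathbb{C}^d:|\zeta_k|<1,\ k=1,\dots,d\}$, $\mathbb{T}^d=\{\zeta\in\mathbb{C}^d:|\zeta_k|=1,\ k=1,\dots,d\}$. A matrix-valued function is rational if all its entries are quotients of polynomials (rational functions agreeing on a nonempty open set are identified; a function on $\mathbb{D}^d$ is called rational if it is the restriction of a rational function without singularities on $\mathbb{D}^d$). The Herglotz--Agler class $\mathcal{HA}(\mathbb{D}^d,\mathbb{C}^n)$ consists of the holomorphic functions $F(\zeta)=\sum_{t\in\mathbb{Z}_+^d}\widehat F_t\zeta^t$ from $\mathbb{D}^d$ to $\mathbb{C}^{n\times n}$ such that $F(T)+F(T)^*\ge0$ for every $d$-tuple $T=(T_1,\dots,T_d)$ of commuting strict contractions ($\|T_k\|<1$) on a Hilbert space, where $F(T)=\sum_t\widehat F_t\otimes T^t$, $T^t=T_1^{t_1}\cdots T_d^{t_d}$. A function $F$ on $\mathbb{D}^d$ is Cayley inner if it is holomorphic with $F(\zeta)+F(\zeta)^*\ge0$ on $\mathbb{D}^d$ and its nontangential boundary values satisfy $F(t)+F(t)^*=0$ for almost every $t\in\mathbb{T}^d$. $\mathcal{CIHA}^{\rm rat}(\mathbb{D}^d,\mathbb{C}^n)$ is the class of rational Cayley inner functions in $\mathcal{HA}(\mathbb{D}^d,\mathbb{C}^n)$. *)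

(* Defs.v *)
From HB Require Import structures.
From mathcomp Require Import all_boot all_order all_algebra finmap.
From mathcomp Require Import sesquilinear spectral complex.
From mathcomp Require Import all_classical all_reals all_analysis.
From mathcomp.analysis.showcase Require summability.
From mathcomp.multinomials Require mpoly.

Set Implicit Arguments.
Unset Strict Implicit.
Unset Printing Implicit Defensive.

Import Order.TTheory GRing.Theory Num.Theory.
Import numFieldNormedType.Exports.

Local Open Scope classical_set_scope.
Local Open Scope ring_scope.
Local Open Scope sesquilinear_scope.

(* The topology of [R[i]] is the one every [numFieldType] carries; this makes it
   available to inference on the concrete type [R[i]] and on matrices over it. *)
HB.instance Definition _ (R : realType) :=
  PseudoPointedMetric.copy R[i] (R[i])^o.

Section Defs.
Variable R : realType.
Local Notation C := R[i].

Definition polydisc (d : nat) : set 'rV[C]_d :=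
  [set z | forall k, `|z 0 k| < 1].

Definition psdmx (n : nat) (A : 'M[C]_n) : Prop :=
  forall v : 'cV[C]_n, 0 <= (v^t* *m A *m v) 0 0.

(* Written in lowest terms, a rational function is singular exactly on the zero
   set of its denominator, so "no singularities on the polydisc" is the existence
   of a representation whose denominator has no zero there. *)
Definition rational_on_polydisc (d m n : nat)
    (F : 'rV[C]_d -> 'M[C]_(m, n)) : Prop :=
  forall i j, exists p q : mpoly.mpoly d C, forall z, polydisc z ->
    mpoly.meval (z 0) q != 0 /\
    F z i j = mpoly.meval (z 0) p / mpoly.meval (z 0) q.

(* The scalar field of the Frechet derivative is [C]. *)
Definition holomorphic_on_polydisc (d m n : nat)
    (F : 'rV[C]_d -> 'M[C]_(m, n)) : Prop :=
  forall z, polydisc z -> differentiable F z.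

(* Sums over multi-indices are unordered: limits along the finite sets of
   multi-indices directed by inclusion. *)
Definition taylor_coefficients (d m n : nat) (F : 'rV[C]_d -> 'M[C]_(m, n))
    (c : {ffun 'I_d -> nat} -> 'M[C]_(m, n)) : Prop :=
  forall z, polydisc z ->
    summability.partial_sum
      (fun t : {ffun 'I_d -> nat} => (\prod_k z 0 k ^+ t k) *: c t)
      @ summability.totally --> F z.

(* A Hilbert space is a complete normed space over [C] whose norm comes from an
   inner product, linear in its first argument. *)
Definition hilbert_product (H : completeNormedModType C)
    (ip : {dot H for Num.conj}) : Prop :=
  forall x, `|x| ^+ 2 = ip x x.

Definition strict_contraction (H : completeNormedModType C) (T : H -> H) :
    Prop :=
  exists2 r : R, r < 1 & forall x, `|T x| <= r%:C%C * `|x|.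

Definition commuting_tuple (d : nat) (H : Type) (T : 'I_d -> H -> H) : Prop :=
  forall j k x, T j (T k x) = T k (T j x).

Definition op_power (d : nat) (H : Type) (T : 'I_d -> H -> H)
    (t : {ffun 'I_d -> nat}) (x : H) : H :=
  foldr (fun k => iter (t k) (T k)) x (enum 'I_d).

(* [F(T) = \sum_t c_t (x) T^t] acts on [C^n (x) H], that is on [H^n]; the series
   converges in operator norm, hence pointwise, for strict contractions. *)
Definition op_eval (d n : nat) (c : {ffun 'I_d -> nat} -> 'M[C]_n)
    (H : completeNormedModType C) (T : 'I_d -> H -> H) (h : 'I_n -> H)
    (i : 'I_n) : H :=
  summability.sum
    (fun t : {ffun 'I_d -> nat} => \sum_j c t i j *: op_power T t (h j)).

(* [A + A^* >= 0] on [H^n]; by definition of the adjoint,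
   [<A^* h, h> = <h, A h>]. *)
Definition op_accretive (n : nat) (H : completeNormedModType C)
    (ip : {dot H for Num.conj}) (A : ('I_n -> H) -> ('I_n -> H)) : Prop :=
  forall h, 0 <= \sum_i ip (A h i) (h i) + \sum_i ip (h i) (A h i).

Definition herglotz_agler (d n : nat) (F : 'rV[C]_d -> 'M[C]_n) : Prop :=
  holomorphic_on_polydisc F /\
  exists2 c, taylor_coefficients F c &
    forall (H : completeNormedModType C) (ip : {dot H for Num.conj})
        (T : 'I_d -> {linear H -> H}),
      hilbert_product ip -> commuting_tuple T ->
      (forall k, strict_contraction (T k)) ->
      op_accretive ip (op_eval c T).

Definition nontangential_region (d : nat) (t : 'rV[C]_d) (a : R) :
    set 'rV[C]_d :=
  [set z | polydisc z /\
           forall k, `|t 0 k - z 0 k| < a%:C%C * (1 - `|z 0 k|)].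

Definition nontangential_limit (d m n : nat) (F : 'rV[C]_d -> 'M[C]_(m, n))
    (t : 'rV[C]_d) (L : 'M[C]_(m, n)) : Prop :=
  forall a : R, 1 < a -> F @ within (nontangential_region t a) (nbhs t) --> L.

Definition lebesgue_null (d : nat) (A : set 'rV[R]_d) : Prop :=
  forall e : R, 0 < e -> exists a b : nat -> 'rV[R]_d,
    [/\ forall l k, a l 0 k <= b l 0 k,
        A `<=` \bigcup_l [set x | forall k, a l 0 k <= x 0 k <= b l 0 k] &
        (\sum_(0 <= l <oo) (\prod_k (b l 0 k - a l 0 k))%:E <= e%:E)%E].

Definition torus_point (d : nat) (x : 'rV[R]_d) : 'rV[C]_d :=
  \row_k (cos (x 0 k) +i* sin (x 0 k))%C.

(* Arc length measure on the torus, in the coordinates [0 <= x_k < 2 pi]. *)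
Definition ae_torus (d : nat) (P : 'rV[C]_d -> Prop) : Prop :=
  lebesgue_null [set x : 'rV[R]_d |
    (forall k, 0 <= x 0 k < 2 * pi) /\ ~ P (torus_point x)].

Definition cayley_inner (d n : nat) (F : 'rV[C]_d -> 'M[C]_n) : Prop :=
  [/\ holomorphic_on_polydisc F,
      forall z, polydisc z -> psdmx (F z + (F z)^t*) &
      ae_torus (fun t : 'rV[C]_d =>
        exists2 L, nontangential_limit F t L & L + L^t* = 0)].

Definition CIHA_rat (d n : nat) (F : 'rV[C]_d -> 'M[C]_n) : Prop :=
  [/\ rational_on_polydisc F, cayley_inner F & herglotz_agler F].

(* [Diag[z_1 I_{m_1}, ..., z_d I_{m_d}]] *)
Definition diag_blocks (d : nat) (m : 'I_d -> nat) (z : 'rV[C]_d) :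
    'M[C]_(\sum_k m k) :=
  \mxdiag_k ((z 0 k)%:M : 'M[C]_(m k)).

End Defs.

(* Main.v *)
(** [(1) => (2')].  Truncate the Taylor coefficients of [F] to a box of
    multi-indices, and let [S_k] be the shifts of the truncated monomials.  A
    Hermitian block [K] that is not a sum over [k] of [A_k - S_k A_k S_k^t*] with
    [A_k >= 0] is separated from such sums by some [E] with
    [E - S_k^t* E S_k >= 0] and [\tr (E K) < 0]; the shifts are commuting
    contractions for the inner product of [E], and the Herglotz-Agler condition on
    them says [\tr (E K) >= 0] when [K] is the block of [F(w)^t* + F(z)].
    Multiplying by a common denominator [q] makes this block identity polynomial:
    since [F + F^t* = 0] on the torus, the diagonal of [q^* P + P^t* q], where
    [P = q F], sums to zero, so the parts of the [A_k] of degree beyond the degree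
    of [q] and [P] vanish and nothing is lost by truncation.

    [(2') => (3)].  The kernel identity says that two families of vectors have the
    same Gram matrix (the lurking isometry argument); [W] comes from a unitary
    extension of the isometry between them.

    [(3) => (1)].  The coefficients of [(1 - W^t* P(z))^-1 V] are bounded because
    their total square norm in each degree is constant, so the series may be
    evaluated at commuting strict contractions [T]; positivity is then
    [|g|^2 - |P(T) g|^2 >= 0].  On the torus [F] is regular where [\det (W - P)]
    does not vanish.  This polynomial is nonzero at the origin, so for each [t] it
    is small at few of the points [l t], [l] a root of unity of large order; hence
    the cells of a fine grid that meet its zero set have small total volume. *)

Require Import Defs.
From HB Require Import structures.
From mathcomp Require Import all_boot all_order all_algebra finmap.
From mathcomp Require Import sesquilinear spectral complex.
From mathcomp Require Import all_classical all_reals all_analysis.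
From mathcomp Require Import measurable_realfun.
From mathcomp Require Import ring lra zify.
From mathcomp.multinomials Require mpoly.
Import -(notations) mpoly.

Set Implicit Arguments.
Unset Strict Implicit.
Unset Printing Implicit Defensive.

Import Order.TTheory GRing.Theory Num.Theory.
Import numFieldNormedType.Exports.

Local Open Scope ring_scope.
Local Open Scope sesquilinear_scope.

Local Notation Re := complex.Re.
Local Notation Im := complex.Im.

#[local] Existing Instance summability.totally_filter.

(** * Finite-dimensional Hilbert spaces *)

(** Before anything can be separated from the cone of Agler sums, that cone must be closed. The
    proof therefore minimises the squared Frobenius distance from [K] to the sums, over
    unconstrained factors [Y k] of the positive terms, and takes for [E] the residual at a
    minimiser. Compactness comes from the grading of the shifts: comparing diagonals degree by
    degree bounds all the terms by the sum of their defects.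

    The form given by [E] may be degenerate, and the shifts are contractions for it without being
    strict ones. Replacing [E] by [E + (1 - r)] and the shifts by [r] times themselves cures both,
    and [r] then tends to 1.

    A truncated shift is multiplication by a variable only away from the edge of the box. This is
    why the box has one exponent more than the degree bound, and why the factors must be shown to
    vanish in high degree before matrices can be read as kernels of functions.

    Fourier coefficients on the torus are never integrals but finite averages over grids of roots of
    unity, fine enough to avoid aliasing; a relation known almost everywhere reaches the grid points
    by continuity. *)

Definition ell2 (R : realType) (N : nat) : Type := 'rV[R[i]]_N.

Section Ell2.
Local Open Scope classical_set_scope.
Local Open Scope ring_scope.
Context {R : realType} {N : nat}.
Local Notation C := R[i].

(** Only the module structure is copied from matrices: their own norm is the sup norm, which does
    not come from an inner product. *)
HB.instance Definition _ := GRing.Lmodule.copy (ell2 R N) 'rV[C]_N.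

Definition ell2_norm (x : ell2 R N) : C := sqrtC (dotmx x x).

Lemma ell2_normD (x y : ell2 R N) :
  ell2_norm (x + y) <= ell2_norm x + ell2_norm y.
Proof. by have [] := triangle_lerif (@dotmx C N) x y. Qed.

Lemma ell2_normZ (l : C) (x : ell2 R N) :
  ell2_norm (l *: x) = `|l| * ell2_norm x.
Proof.
rewrite /ell2_norm dnormZ sqrtCM ?nnegrE ?exprn_ge0 ?dnorm_ge0//.
by rewrite sqrCK.
Qed.

Lemma ell2_norm_eq0 (x : ell2 R N) : ell2_norm x = 0 -> x = 0.
Proof. by move=> /eqP; rewrite sqrt_dnorm_eq0 => /eqP. Qed.

HB.instance Definition _ := @Lmodule_isNormed.Build C (ell2 R N) ell2_norm
  ell2_normD ell2_normZ ell2_norm_eq0.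

Lemma ell2_normE (x : ell2 R N) : `|x| ^+ 2 = \sum_i `|(x : 'rV[C]_N) 0 i| ^+ 2.
Proof.
rewrite /Num.norm/= /ell2_norm sqrtCK dotmxE mxE.
by apply: eq_bigr => i _; rewrite !mxE normCK.
Qed.

Lemma ell2_coord_le (x : ell2 R N) i : `|(x : 'rV[C]_N) 0 i| <= `|x|.
Proof.
by rewrite -ler_sqr ?nnegrE// ell2_normE (bigD1 i)//= lerDl sumr_ge0.
Qed.

Lemma ell2_norm_le (x : ell2 R N) : `|x| <= \sum_i `|(x : 'rV[C]_N) 0 i|.
Proof.
have s0 : 0 <= \sum_i `|(x : 'rV[C]_N) 0 i| by exact: sumr_ge0.
rewrite -ler_sqr ?nnegrE// ell2_normE expr2 mulr_suml ler_sum// => i _.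
by rewrite expr2 ler_wpM2l// (bigD1 i)//= lerDl sumr_ge0.
Qed.

Lemma normc_leD (z : C) : `|z| <= (`|Re z| + `|Im z|)%:C%C.
Proof.
rewrite [z in X in X <= _]complexE (le_trans (ler_normD _ _))//.
rewrite normrM rmorphD/= lerD//.
  by rewrite normc_def/= expr0n addr0 sqrtr_sqr.
by rewrite !normc_def/= !expr0n/= expr1n add0r addr0 sqrtr_sqr sqrtr1 mul1r.
Qed.

Lemma normc_ge_Im (z : C) : `|Im z|%:C%C <= `|z|.
Proof.
by rewrite normc_def lecR -sqrtr_sqr ler_wsqrtr// lerDr sqr_ge0.
Qed.

(** Real and imaginary parts of coordinates are 1-Lipschitz for the norm, so a Cauchy filter has a
    limit in each of them by completeness of [R]. *)
Lemma ell2_complete (F : set_system (ell2 R N)) :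
  ProperFilter F -> cauchy F -> cvg F.
Proof.
move=> FF /cauchy_ballP Fc.
have coord (f : {additive C -> R}) i : (forall z, `|f z|%:C%C <= `|z|) ->
    cvg ((fun x : ell2 R N => f ((x : 'rV[C]_N) 0 i)) @ F).
  move=> fle; apply: R_complete; apply/cauchy_ballP => e e0.
  rewrite near_map2.
  have e0' : 0 < e%:C%C :> C by rewrite ltcR.
  apply: filterS (Fc _ e0') => -[x y] /= xy.
  rewrite /ball/= -raddfB -ltcR (le_lt_trans (fle _))//.
  apply: le_lt_trans xy.
  by have := ell2_coord_le (x - y) i; rewrite !mxE.
have cRe i := coord (@Re R) i (@normc_ge_Re R).
have cIm i := coord (@Im R) i normc_ge_Im.
pose l : ell2 R N := \row_i
  (lim ((fun x : ell2 R N => Re ((x : 'rV[C]_N) 0 i)) @ F) +i*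
   lim ((fun x : ell2 R N => Im ((x : 'rV[C]_N) 0 i)) @ F))%C.
apply/cvg_ex; exists l; apply/cvgrPdist_lt => e e0.
have [r r0 ->] : exists2 r : R, 0 < r & e = r%:C%C.
  by exists (Re e); [move: e0; rewrite ltcE => /andP[]|rewrite RRe_real ?gtr0_real].
(* Each coordinate will contribute at most [2 d]; dividing by [N.+1] keeps the sum of [N]
   contributions strictly below [r], also for [N = 0]. *)
pose d := r / (N.+1%:R * 2).
have d0 : 0 < d by rewrite divr_gt0// mulr_gt0 ?ltr0n.
have near1 i : \forall x \near F,
    `|(l : 'rV[C]_N) 0 i - (x : 'rV[C]_N) 0 i| <= (d *+ 2)%:C%C.
  have /cvgrPdist_lt/(_ _ d0) h1 := cRe i.
  have /cvgrPdist_lt/(_ _ d0) h2 := cIm i.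
  near=> x.
  rewrite (le_trans (normc_leD _))// lecR mulr2n lerD//.
    by rewrite mxE raddfB/= ltW//; near: x.
  by rewrite mxE raddfB/= ltW//; near: x.
have nearA : \forall x \near F, forall i,
    `|(l : 'rV[C]_N) 0 i - (x : 'rV[C]_N) 0 i| <= (d *+ 2)%:C%C.
  by apply: filter_forall near1.
near=> x.
rewrite (le_lt_trans (ell2_norm_le _))//.
apply: (@le_lt_trans _ _ (\sum_(i < N) (d *+ 2)%:C%C)).
  have hx : forall i, `|(l : 'rV[C]_N) 0 i - (x : 'rV[C]_N) 0 i| <=
      (d *+ 2)%:C%C by near: x; exact: nearA.
  by apply: ler_sum => i _; have := hx i; rewrite !mxE.
rewrite sumr_const card_ord -rmorphMn ltcR -mulrnA /d.
rewrite -[ltLHS]mulr_natl mulrCA gtr_pMr// natrM mulrC.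
by rewrite mulrC ltr_pdivrMr ?mulr_gt0// mul1r mulrC ltr_pM2r// ltr_nat.
Unshelve. all: by end_near. Qed.

HB.instance Definition _ :=
  Uniform_isComplete.Build (ell2 R N) ell2_complete.

Definition ell2_dot : {dot (ell2 R N) for Num.conj} := @dotmx C N.

Lemma ell2_hilbert : hilbert_product ell2_dot.
Proof. by move=> x; rewrite /Num.norm/= /ell2_norm sqrtCK. Qed.

End Ell2.

(** * Unitary matrices and Gram matrices *)

Section LinearAlgebra.
Context {C : numClosedFieldType}.

Lemma trmxC_mul m n p (A : 'M[C]_(m, n)) (B : 'M[C]_(n, p)) :
  (A *m B)^t* = B^t* *m A^t*.
Proof. by rewrite trmx_mul map_mxM. Qed.

Lemma trmxCD m n (A B : 'M[C]_(m, n)) : (A + B)^t* = A^t* + B^t*.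
Proof. by rewrite linearD/= map_mxD. Qed.

Lemma trmxCB m n (A B : 'M[C]_(m, n)) : (A - B)^t* = A^t* - B^t*.
Proof. by rewrite linearB/= map_mxB. Qed.

Lemma trmxCZ m n a (A : 'M[C]_(m, n)) : (a *: A)^t* = a^* *: A^t*.
Proof. by rewrite linearZ/= map_mxZ. Qed.

Lemma trmxC1 n : (1%:M : 'M[C]_n)^t* = 1%:M.
Proof. by rewrite trmx1 map_mx1. Qed.

Lemma trmxC0 m n : (0 : 'M[C]_(m, n))^t* = 0.
Proof. by rewrite trmx0 map_mx0. Qed.

Lemma trmxC_sum m n (I : finType) (P : pred I) (A : I -> 'M[C]_(m, n)) :
  (\sum_(i | P i) A i)^t* = \sum_(i | P i) (A i)^t*.
Proof. by rewrite linear_sum/= map_mx_sum. Qed.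

Lemma trmxCE m n (A : 'M[C]_(m, n)) i j : A^t* i j = (A j i)^*.
Proof. by rewrite !mxE. Qed.

Lemma row_norm_eq0 n (x : 'rV[C]_n) : x *m x^t* = 0 -> x = 0.
Proof.
move=> /matrixP/(_ 0 0); rewrite [RHS]mxE => x0.
by have := dnorm_eq0 (@dotmx C n) x; rewrite /= dotmxE x0 eqxx => /esym/eqP.
Qed.

(** Gram-Schmidt on a basis of the orthogonal complement. The rows of [Q] and [N] span everything,
    so [1%:M = u Q + v N], and the first two identities determine [u] and [v]. *)
Lemma orthonormal_complement r m (Q : 'M[C]_(r, m)) : Q *m Q^t* = 1%:M ->
  exists N : 'M[C]_(m - r, m),
    [/\ N *m N^t* = 1%:M, Q *m N^t* = 0 & Q^t* *m Q + N^t* *m N = 1%:M].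
Proof.
move=> QQ.
have Qu : Q \is unitarymx by apply/unitarymxP.
pose O := orthomx Num.conj (mx_of_hermitian (hermitian1mx _)) Q.
have rO : \rank O = (m - r)%N by rewrite rank_ortho mxrank_unitary.
have [N [NN NO]] : exists N : 'M[C]_(\rank O, m),
    N *m N^t* = 1%:M /\ (N :=: O)%MS.
  exists (schmidt (row_base O)); split.
    by apply/unitarymxP; rewrite schmidt_unitarymx// rank_leq_col.
  by apply: eqmx_trans (eq_row_base _); exact/eqmx_schmidt_free/row_base_free.
move: N NN NO; rewrite rO => N NN NO.
have QN : N *m Q^t* = 0 by apply/eqP; rewrite -orthomx1E NO.
have NQ : Q *m N^t* = 0.
  by rewrite -[Q *m _]trmxCK trmxC_mul trmxCK QN trmxC0.
exists N; split=> //.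
have /sub_addsmxP[[u v] /= uv] : ((1%:M : 'M[C]_m) <= Q + N)%MS.
  by rewrite (adds_eqmx (eqmx_refl Q) NO) addsmx_ortho.
rewrite -[LHS]mul1mx uv mulmxDl !mulmxDr -!mulmxA (mulmxA Q) QQ mul1mx.
by rewrite (mulmxA Q (N^t*)) NQ mul0mx mulmx0 addr0 (mulmxA N (Q^t*)) QN mul0mx
  mulmx0 add0r (mulmxA N (N^t*)) NN mul1mx.
Qed.

(** The matrix [L] that orthonormalises the rows of [A] also orthonormalises those of [B], because
    it only depends on the common Gram matrix. [U] sends one orthonormal family to the other, and
    likewise for bases of the complements. *)
Lemma unitary_extension r m (A B : 'M[C]_(r, m)) :
    row_free A -> A *m A^t* = B *m B^t* ->
  exists2 U : 'M[C]_m, U \is unitarymx & A *m U = B.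
Proof.
move=> Afree AB.
have rm : (r <= m)%N by rewrite -(eqP Afree) rank_leq_col.
have /submxP[L LA] : (schmidt A <= A)%MS by rewrite eqmx_schmidt_free.
have /submxP[L' LA'] := schmidt_sub A.
have QA : (L *m A) *m (L *m A)^t* = 1%:M.
  by rewrite -LA; apply/unitarymxP; rewrite schmidt_unitarymx.
have QB : (L *m B) *m (L *m B)^t* = 1%:M.
  by rewrite -QA !trmxC_mul -!mulmxA; congr (_ *m _); rewrite !mulmxA AB.
have L'L : L' *m L = 1%:M.
  apply: (row_free_inj Afree); rewrite /= mul1mx -mulmxA -LA; exact/esym.
have [NA [NA1 NA2 NA3]] := orthonormal_complement QA.
have [NB [NB1 NB2 NB3]] := orthonormal_complement QB.
exists ((L *m A)^t* *m (L *m B) + NA^t* *m NB).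
  apply/unitarymxP; rewrite trmxCD !trmxC_mul !trmxCK -!trmxC_mul.
  rewrite mulmxDl !mulmxDr !mulmxA -![_ *m L *m A]mulmxA -![_ *m L *m B]mulmxA.
  set X := L *m A in QA NA2 NA3 *; set Y := L *m B in QB NB2 NB3 *.
  have NY : NB *m Y^t* = 0 by rewrite -[LHS]trmxCK trmxC_mul trmxCK NB2 trmxC0.
  rewrite -!(mulmxA _ Y) -!(mulmxA _ NB) QB NB2 NY NB1 !mulmx0 !mul0mx !mulmx1.
  by rewrite addr0 add0r.
have NA2' : A *m NA^t* = 0.
  by rewrite -[A]mul1mx -L'L -!mulmxA (mulmxA L) NA2 mulmx0.
rewrite mulmxDr !mulmxA NA2' mul0mx addr0.
rewrite -[A in A *m _]mul1mx -L'L -!mulmxA (mulmxA L A) (mulmxA (L *m A)) QA.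
by rewrite mul1mx mulmxA L'L mul1mx.
Qed.

(* Finitely many [a t] already span all of them, and the Gram matrix then
   transports every linear relation among the [a t] to the [b t]. *)
Lemma unitary_of_gram m (T : Type) (a b : T -> 'rV[C]_m) :
    (forall s t, a s *m (a t)^t* = b s *m (b t)^t*) ->
  exists2 U : 'M[C]_m, U \is unitarymx & forall t, a t *m U = b t.
Proof.
move=> gram.
pose P r := `[< exists f : 'I_r -> T, row_free (\matrix_i a (f i)) >].
have exP : exists r, P r.
  exists 0; apply/asboolP; have f : 'I_0 -> T by case.
  by exists f; rewrite /row_free flatmx0 mxrank0.
have ubP r : P r -> (r <= m)%N.
  by move=> /asboolP[f /eqP <-]; exact: rank_leq_col.
have [r /asboolP[f ffree] rmax] := ex_maxnP exP ubP.
set A := \matrix_i a (f i) in ffree; pose B := \matrix_i b (f i).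
have aA t : (a t <= A)%MS.
  apply: contrapT => /negP taA.
  suff /rmax : P (1 + r)%N by rewrite ltnn.
  apply/asboolP; exists (fun i : 'I_(1 + r) =>
    if fintype.split i is inr j then f j else t).
  set M := \matrix_i _.
  have -> : M = col_mx (a t) A.
    apply/row_matrixP => i; rewrite rowK; case: fintype.splitP => j ij.
      have -> : i = lshift r j by exact: val_inj.
      by rewrite rowKu ord1 row_id.
    have -> : i = rshift 1 j by exact: val_inj.
    by rewrite rowKd rowK.
  apply: inj_row_free => y; rewrite -[y]hsubmxK mul_row_col.
  set c := lsubmx y; set z := rsubmx y => /eqP.
  rewrite [c]mx11_scalar mul_scalar_mx; have [->|c0] := eqVneq (c 0 0) 0.
    rewrite scale0r add0r => /eqP zA; have -> : z = 0.
      by apply: (row_free_inj ffree); rewrite /= mul0mx.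
    by rewrite raddf0 row_mx0.
  rewrite addr_eq0 => /eqP /(congr1 (fun v => (c 0 0)^-1 *: v)).
  rewrite scalerA mulVf// scale1r => at_.
  by case: taA; rewrite at_ scalemx_sub// -mulNmx submxMl.
have AB : A *m A^t* = B *m B^t*.
  apply/matrixP => i j; have /matrixP/(_ 0 0) := gram (f i) (f j).
  rewrite !mxE => h; under eq_bigr do rewrite !mxE.
  rewrite [RHS](eq_bigr (fun k => b (f i) 0 k * (b (f j))^t* k 0)).
    by rewrite -h; apply: eq_bigr => k _; rewrite !mxE.
  by move=> k _; rewrite !mxE.
have [U Uu AU] := unitary_extension ffree AB.
exists U => // t.
have /submxP[x ax] := aA t.
suff -> : b t = x *m B by rewrite ax -mulmxA AU.
apply/eqP; rewrite -subr_eq0; apply/eqP/row_norm_eq0.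
have bB : b t *m B^t* = a t *m A^t*.
  apply/matrixP => i j; rewrite !ord1 {i}; have /matrixP/(_ 0 0) := gram t (f j).
  rewrite !mxE => h.
  rewrite [LHS](eq_bigr (fun k => b t 0 k * (b (f j))^t* k 0)).
    by rewrite -h; apply: eq_bigr => k _; rewrite !mxE.
  by move=> k _; rewrite !mxE.
have Bb : B *m (b t)^t* = A *m (a t)^t*.
  by rewrite -{1}(trmxCK B) -trmxC_mul bB trmxC_mul trmxCK.
rewrite trmxCB trmxC_mul mulmxBl !mulmxBr -!mulmxA Bb (mulmxA (b t)) bB.
rewrite (mulmxA B) -AB -gram ax trmxC_mul -!mulmxA.
by rewrite subrr.
Qed.

End LinearAlgebra.

Section PsdFactor.
Context {R : realType}.
Local Notation C := R[i].

Lemma psd_factor n (A : 'M[C]_n) : A^t* = A -> psdmx A ->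
  exists Y : 'M[C]_n, A = Y^t* *m Y.
Proof.
move=> Ah Apsd.
have An : A \is normalmx by apply/normalmxP; rewrite Ah.
have := orthomx_spectralP An.
set P := spectralmx A; set D := spectral_diag A => AE.
have Pu : P \is unitarymx by exact: spectral_unitarymx.
have PP : P *m P^t* = 1%:M by apply/unitarymxP.
rewrite invmx_unitary// in AE; clearbody P D.
have D0 i : 0 <= D 0 i.
  have := Apsd (P^t* *m delta_mx i 0); rewrite {1}AE trmxC_mul trmxCK.
  rewrite !mulmxA -(mulmxA _ P (P^t*)) PP mulmx1 -(mulmxA _ P (P^t*)) PP mulmx1.
  rewrite -mulmxA -colE mxE (bigD1 i)//= big1 ?addr0.
    by rewrite !mxE !eqxx/= conjC1 mul1r mulr1n.
  by move=> j ji; rewrite !mxE (negbTE ji) conjC0 mul0r.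
exists (diag_mx (map_mx sqrtC D) *m P).
rewrite trmxC_mul -!mulmxA (mulmxA (_ ^t*)) [LHS]AE -!mulmxA; congr (_ *m _).
rewrite mulmxA; congr (_ *m _).
apply/matrixP => i j; rewrite tr_diag_mx mul_mx_diag !mxE.
case: eqP => [->|_]; last by rewrite !mulr0n conjC0 mul0r.
by rewrite !mulr1n conj_Creal ?qualifE/= ?sqrtC_ge0 ?D0// -expr2 sqrtCK.
Qed.

End PsdFactor.

(** * Unitary realization of a kernel decomposition *)

Section Blocks.
Context {R : realType} {d : nat}.
Local Notation C := R[i].
Implicit Types (m : 'I_d -> nat) (z w : 'rV[C]_d).

(** Removes the casts of the block-diagonal definition once and for all: [tagnat.sig1 i] is the
    block to which the index [i] belongs. *)
Lemma diag_blocksE m z : diag_blocks m z = diag_mx (\row_i z 0 (tagnat.sig1 i)).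
Proof.
apply/matrixP => i j; rewrite !mxE.
have [<-|ij] := eqVneq i j; first by rewrite eqxx conform_mx_id !mxE eqxx.
case: eqP => [e|_]; last by rewrite mxE.
have nij : (tagnat.sig i) != (tagnat.sig j).
  by apply: contra ij => /eqP/tagnat.sig_inj ->.
move: nij e; rewrite /tagnat.sig1 /tagnat.sig2.
move: (tagnat.sig i) (tagnat.sig j) => -[/= a x] [/= b y] xy ab.
move: xy; case: b / ab y => y xy; rewrite conform_mx_id mxE.
by case: eqP => // e; rewrite e eqxx in xy.
Qed.

Lemma mul_row_trmxCE n (x y : 'rV[C]_n) :
  (x *m y^t*) 0 0 = \sum_i x 0 i * (y 0 i)^*.
Proof. by rewrite mxE; apply: eq_bigr => i _; rewrite !mxE. Qed.

(** If [v W = v P(z)], then [v] and [v P(z)] have the same norm, whereas [P(z)] strictly shrinks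
    every nonzero coordinate. *)
Lemma unitary_sub_diag_unit m (W : 'M[C]_(\sum_k m k)) z :
  W \is unitarymx -> polydisc z -> W - diag_blocks m z \in unitmx.
Proof.
move=> /unitarymxP WW zD; rewrite -row_free_unit; apply: inj_row_free => v.
rewrite mulmxBr => /eqP; rewrite subr_eq0 => /eqP vW.
have: v *m v^t* = (v *m diag_blocks m z) *m (v *m diag_blocks m z)^t*.
  by rewrite -vW trmxC_mul -mulmxA (mulmxA W) WW mul1mx.
move=> /matrixP/(_ 0 0)/eqP; rewrite !mul_row_trmxCE diag_blocksE mul_mx_diag.
rewrite -subr_eq0 -sumrB.
have tE i : v 0 i * (v 0 i)^* -
    (\matrix_(k, j) (v k j * (\row_l z 0 (tagnat.sig1 l)) 0 j)) 0 i *
    ((\matrix_(k, j) (v k j * (\row_l z 0 (tagnat.sig1 l)) 0 j)) 0 i)^* =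
    `|v 0 i| ^+ 2 * (1 - `|z 0 (tagnat.sig1 i)| ^+ 2).
  by rewrite !mxE -!normCK normrM exprMn mulrBr mulr1.
have pos i : 0 < 1 - `|z 0 (@tagnat.sig1 _ m i)| ^+ 2.
  by rewrite subr_gt0 exprn_ilt1// zD.
rewrite (eq_bigr _ (fun i _ => tE i)).
rewrite psumr_eq0; last by move=> i _; rewrite mulr_ge0 ?exprn_ge0// ltW.
move=> /allP h.
apply/rowP => i; rewrite mxE; have /= := h i (mem_index_enum _).
by rewrite mulf_eq0 (gt_eqF (pos i)) orbF expf_eq0/= normr_eq0 => /eqP.
Qed.

Lemma trmxC_mxcol m n (xi : forall k, 'M[C]_(m k, n)) :
  (\mxcol_k xi k)^t* = \mxrow_k (xi k)^t*.
Proof. by apply/matrixP => i j; rewrite !mxE. Qed.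

Lemma sum_blocks m n z w (xi eta : forall k, 'M[C]_(m k, n)) :
  (diag_blocks m w *m \mxcol_k xi k)^t* *m (diag_blocks m z *m \mxcol_k eta k) =
  \sum_k ((w 0 k)^* * z 0 k) *: ((xi k)^t* *m eta k).
Proof.
have E (y : 'rV[C]_d) (x : forall k, 'M[C]_(m k, n)) :
    diag_blocks m y *m \mxcol_k x k = \mxcol_k (y 0 k *: x k).
  by rewrite diag_blocksE mul_diag_mx; apply/matrixP => i j; rewrite !mxE.
rewrite !E trmxC_mxcol mul_mxrow_mxcol; apply: eq_bigr => k _.
by rewrite trmxCZ -scalemxAl -scalemxAr scalerA.
Qed.

Lemma polydisc0 : polydisc (0 : 'rV[C]_d).
Proof. by move=> k; rewrite mxE normr0 ltr01. Qed.

Lemma realization_of_kernel n (F : 'rV[C]_d -> 'M[C]_n) (m : 'I_d -> nat)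
    (xi : forall k, 'rV[C]_d -> 'M[C]_(m k, n)) :
    (forall w z, polydisc w -> polydisc z -> (F w)^t* + F z =
       \sum_k (1 - (w 0 k)^* * z 0 k) *: ((xi k w)^t* *m xi k z)) ->
  exists (W : 'M[C]_(\sum_k m k)) (beta : 'M[C]_n) (V : 'M[C]_(\sum_k m k, n)),
    [/\ W \is unitarymx, beta + beta^t* = 0 &
      forall z, polydisc z -> F z = beta +
        V^t* *m invmx (W - diag_blocks m z) *m (W + diag_blocks m z) *m V].
Proof.
move=> FE; pose X z := \mxcol_k xi k z; pose P := @diag_blocks R d m.
have XX z w : polydisc z -> polydisc w -> (F w)^t* + F z =
    (X w)^t* *m X z - (P w *m X w)^t* *m (P z *m X z).
  move=> zD wD; rewrite FE// /P sum_blocks trmxC_mxcol mul_mxrow_mxcol.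
  by rewrite -sumrB; apply: eq_bigr => k _; rewrite scalerBl scale1r.
have P0 : P 0 = 0.
  by rewrite /P diag_blocksE; apply/matrixP => i j; rewrite !mxE mul0rn.
have X0 z : polydisc z -> (F 0)^t* + F z = (X 0)^t* *m X z.
  by move=> zD; rewrite XX//; [rewrite P0 mul0mx trmxC0 mul0mx subr0|exact: polydisc0].
have X0' w : polydisc w -> (F w)^t* + F 0 = (X w)^t* *m X 0.
  by move=> wD; rewrite XX//; [rewrite P0 mul0mx mulmx0 subr0|exact: polydisc0].
(* Since [P 0 = 0], the kernel identities at the pairs with a point at the origin express the Gram
   products of [X z - X 0] through [F]; all values of [F] then cancel. *)
have gram z w : polydisc z -> polydisc w ->
    (P w *m X w)^t* *m (P z *m X z) = (X w - X 0)^t* *m (X z - X 0).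
  move=> zD wD; rewrite trmxCB mulmxBl !mulmxBr -X0// -X0'// -X0; last exact: polydisc0.
  have /eqP := XX _ _ zD wD; rewrite eq_sym subr_eq => /eqP ->.
  move: (_ *m _) ((F w)^t*) (F z) ((F 0)^t*) (F 0) => a b c e f.
  by apply/matrixP => i j; rewrite !mxE; ring.
pose T := {t : 'rV[C]_d * 'I_n | polydisc t.1}.
pose a (t : T) := (col (sval t).2 (P (sval t).1 *m X (sval t).1))^t*.
pose b (t : T) := (col (sval t).2 (X (sval t).1 - X 0))^t*.
have [U Uu aUb] : exists2 U : 'M[C]_(\sum_k m k), U \is unitarymx &
    forall t, a t *m U = b t.
  apply: unitary_of_gram => -[[w i] /= wD] [[z j] /= zD].
  rewrite /a /b !trmxCK /=.
  apply/matrixP => x y; rewrite !ord1 {x y}.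
  have /matrixP/(_ i j) := gram _ _ zD wD; rewrite !mxE => h.
  rewrite (eq_bigr (fun k => (P w *m X w)^t* i k * (P z *m X z) k j)).
    rewrite h; apply: eq_bigr => k _; rewrite !mxE; congr (_ * _).
  by move=> k _; rewrite !mxE.
have UU : U *m U^t* = 1%:M by apply/unitarymxP.
have UX z : polydisc z -> U^t* *m (P z *m X z) = X z - X 0.
  move=> zD; apply/matrixP => i j.
  have /matrixP/(_ 0 i) := aUb (exist _ (z, j) zD : T).
  move=> /(congr1 Num.conj); rewrite [in RHS]mxE => h.
  transitivity ((a (exist _ (z, j) zD : T) *m U) 0 i)^*.
    rewrite !mxE rmorph_sum; apply: eq_bigr => k _; rewrite !mxE rmorphM/= conjCK.
    by rewrite mulrC.
  by rewrite h !mxE conjCK.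
have XE z : polydisc z -> X z = invmx (U - P z) *m (U *m X 0).
  move=> zD; rewrite -[LHS](mulKmx (unitary_sub_diag_unit Uu zD)).
  congr (_ *m _); rewrite mulmxBl.
  have -> : P z *m X z = U *m (X z - X 0) by rewrite -UX// mulmxA UU mul1mx.
  by rewrite mulmxBr subKr.
(* As [U + P = 2 U - (U - P)], the resolvent expression applied to [X 0] is [2 X z - X 0]. The
   factor 2 is absorbed by splitting one half between the two occurrences of [V], and the leftover
   half of [X(0)^* X(0)] goes into the constant term. *)
pose s : C := sqrtC 2^-1.
have ss : s^* * s = 2^-1.
  by rewrite conj_Creal ?ger0_real ?sqrtC_ge0 ?invr_ge0 ?ler0n// -expr2 sqrtCK.
exists U, (2^-1 *: ((X 0)^t* *m X 0) - (F 0)^t*), (s *: X 0); split=> //.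
  have := X0 _ polydisc0 => h.
  rewrite trmxCB trmxCZ trmxC_mul !trmxCK -h fmorphV rmorph_nat.
  by apply/matrixP => i j; rewrite !mxE; field.
move=> z zD.
have Uz := unitary_sub_diag_unit Uu zD.
have -> : U + P z = U *+ 2 - (U - P z).
  by rewrite mulr2n opprB addrACA subrr addr0.
rewrite trmxCZ -!scalemxAl -scalemxAr scalerA ss -mulmxA -mulmxA.
rewrite mulmxBr mulVmx// mulmxBl mul1mx -mulmxA.
rewrite mulr2n mulmxDl mulmxDr -XE// -(addKr ((F 0)^t*) (F z)) X0//.
rewrite mulmxBr mulmxDr.
move: (_ *m X z) (_ *m X 0) (F z) => a1 a2 a3.
by apply/matrixP => i j; rewrite !mxE; field.
Qed.

End Blocks.

(** * A separation argument for sums of defects *)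

Section GenericMatrices.
Context {C : numClosedFieldType}.

Lemma mxtraceB N (A B : 'M[C]_N) : \tr (A - B) = \tr A - \tr B.
Proof. exact: raddfB. Qed.

(** The trace pairing exchanges [B - S B S^*] and [E - S^* E S]; hence nonnegativity of [E] against
    all defects becomes positivity of the latter. *)
Lemma trace_defect N (E S B : 'M[C]_N) :
  \tr ((E - S^t* *m E *m S) *m B) = \tr (E *m (B - S *m B *m S^t*)).
Proof.
rewrite mulmxBl mulmxBr !mxtraceB; congr (_ - _).
by rewrite -!mulmxA mxtrace_mulC !mulmxA.
Qed.

Lemma quad_trace N (M : 'M[C]_N) (v : 'cV[C]_N) :
  (v^t* *m M *m v) 0 0 = \tr (M *m (v *m v^t*)).
Proof. by rewrite -trace_mx11 -mulmxA mxtrace_mulC -(mulmxA _ v). Qed.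

Lemma gram_ge0 m (w : 'cV[C]_m) : 0 <= (w^t* *m w) 0 0.
Proof.
by rewrite mxE sumr_ge0// => i _; rewrite trmxCE mulrC mul_conjC_ge0.
Qed.

Lemma quad_gram_ge0 m N (Y : 'M[C]_(m, N)) (u : 'cV[C]_N) :
  0 <= (u^t* *m (Y^t* *m Y) *m u) 0 0.
Proof. by rewrite mulmxA -mulmxA -trmxC_mul gram_ge0. Qed.

(** The squared Frobenius norm. *)
Definition mxnrm2 m n (A : 'M[C]_(m, n)) : C := \tr (A^t* *m A).

Lemma mxnrm2E m n (A : 'M[C]_(m, n)) :
  mxnrm2 A = \sum_i \sum_j `|A i j| ^+ 2.
Proof.
rewrite exchange_big; apply: eq_bigr => j _; rewrite mxE.
by apply: eq_bigr => i _; rewrite trmxCE normCKC.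
Qed.

Lemma mxnrm2_ge0 m n (A : 'M[C]_(m, n)) : 0 <= mxnrm2 A.
Proof. by rewrite mxnrm2E; do 2!apply: sumr_ge0 => ? _; exact: exprn_ge0. Qed.

Lemma mxnrm2_eq0 m n (A : 'M[C]_(m, n)) : mxnrm2 A = 0 -> A = 0.
Proof.
rewrite mxnrm2E => /eqP; rewrite psumr_eq0 => [/allP A0|i _]; last first.
  by apply: sumr_ge0 => j _; exact: exprn_ge0.
apply/matrixP => i j; rewrite mxE.
have /= := A0 i (mem_index_enum _); rewrite psumr_eq0 => [/allP Ai|? _].
  have /= := Ai j (mem_index_enum _).
  by rewrite expf_eq0/= normr_eq0 => /eqP.
exact: exprn_ge0.
Qed.

(** The linear term in [t] is what the first-order condition at a minimiser reads off. *)
Lemma mxnrm2_variation N (A B : 'M[C]_N) (t : C) :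
    A^t* = A -> B^t* = B -> t^* = t ->
  mxnrm2 (A + t *: B) - mxnrm2 A = t * (2 * \tr (A *m B)) + t ^+ 2 * mxnrm2 B.
Proof.
move=> Ah Bh th; rewrite /mxnrm2 trmxCD trmxCZ Ah Bh th mulmxDl !mulmxDr.
rewrite -!scalemxAr -!scalemxAl !mxtraceD !mxtraceZ (mxtrace_mulC B A).
by ring.
Qed.

Definition defect N (S A : 'M[C]_N) : 'M[C]_N := A - S *m A *m S^t*.

Lemma defect_herm N (S A : 'M[C]_N) : A^t* = A -> (defect S A)^t* = defect S A.
Proof. by move=> Ah; rewrite trmxCB !trmxC_mul !trmxCK Ah mulmxA. Qed.

Lemma defectD N (S A B : 'M[C]_N) : defect S (A + B) = defect S A + defect S B.
Proof. by rewrite /defect mulmxDr mulmxDl opprD addrACA. Qed.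

Lemma defectZ N (S A : 'M[C]_N) (c : C) : defect S (c *: A) = c *: defect S A.
Proof. by rewrite /defect -scalemxAr -scalemxAl scalerBr. Qed.

(** Positive matrices are parametrised by factors [Y k], so that minimisation runs over a whole
    vector space without constraint. *)
Definition agler_map N d (S Y : 'I_d -> 'M[C]_N) : 'M[C]_N :=
  \sum_k defect (S k) ((Y k)^t* *m Y k).

Lemma agler_map_update N d (S Y : 'I_d -> 'M[C]_N) k (Z B : 'M[C]_N) (t : C) :
    (Y k)^t* *m Y k + t *: B = Z^t* *m Z ->
  agler_map S (fun j => if j == k then Z else Y j) =
  agler_map S Y + t *: defect (S k) B.
Proof.
move=> ZE; rewrite /agler_map (bigD1 k)//= eqxx -ZE defectD defectZ.
rewrite [in RHS](bigD1 k)//= [RHS]addrAC; congr (_ + _).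
by apply: eq_bigr => j /negbTE ->.
Qed.

Lemma agler_map_scale N d (S Y : 'I_d -> 'M[C]_N) (s : C) :
  agler_map S (fun k => s *: Y k) = (s^* * s) *: agler_map S Y.
Proof.
rewrite /agler_map scaler_sumr; apply: eq_bigr => k _.
by rewrite trmxCZ -scalemxAl -scalemxAr scalerA defectZ.
Qed.

Lemma agler_map_herm N d (S Y : 'I_d -> 'M[C]_N) :
  (agler_map S Y)^t* = agler_map S Y.
Proof.
rewrite trmxC_sum; apply: eq_bigr => k _.
by rewrite defect_herm// trmxC_mul trmxCK.
Qed.

End GenericMatrices.

(** * Duality by least squares *)

Section Duality.
Local Open Scope classical_set_scope.
Local Open Scope ring_scope.
Context {R : realType}.
Local Notation C := R[i].

Section ReImContinuous.
Context {T : topologicalType}.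
Implicit Types f g : T -> C.

(** Split into two real-valued functions because the extreme value theorem and the sign and density
    arguments that follow concern real functions. *)
Definition cpart_continuous f :=
  continuous (fun x => Re (f x)) /\ continuous (fun x => Im (f x)).

Lemma cpart_cst c : cpart_continuous (fun=> c).
Proof. by split; exact: cst_continuous. Qed.

Lemma cpartD f g : cpart_continuous f -> cpart_continuous g ->
  cpart_continuous (fun x => f x + g x).
Proof.
move=> [f1 f2] [g1 g2]; split=> x.
  rewrite (_ : (fun _ => _) = (fun x => Re (f x) + Re (g x))).
    exact: (continuousD (f1 x) (g1 x)).
  by apply/funext => y; rewrite raddfD.
rewrite (_ : (fun _ => _) = (fun x => Im (f x) + Im (g x))).
  exact: (continuousD (f2 x) (g2 x)).
by apply/funext => y; rewrite raddfD.
Qed.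

Lemma cpartN f : cpart_continuous f -> cpart_continuous (fun x => - f x).
Proof.
move=> [f1 f2]; split=> x.
  rewrite (_ : (fun _ => _) = (fun x => - Re (f x))).
    exact: (continuousN (f1 x)).
  by apply/funext => y; rewrite raddfN.
rewrite (_ : (fun _ => _) = (fun x => - Im (f x))).
  exact: (continuousN (f2 x)).
by apply/funext => y; rewrite raddfN.
Qed.

Lemma ReM (a b : C) : Re (a * b) = Re a * Re b - Im a * Im b.
Proof. by case: a b => [a1 a2] [b1 b2]. Qed.

Lemma ImM (a b : C) : Im (a * b) = Re a * Im b + Im a * Re b.
Proof. by case: a b => [a1 a2] [b1 b2]. Qed.

Lemma cpartM f g : cpart_continuous f -> cpart_continuous g ->
  cpart_continuous (fun x => f x * g x).
Proof.
move=> [f1 f2] [g1 g2]; split=> x.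
  rewrite (_ : (fun _ => _) =
      (fun x => Re (f x) * Re (g x) - Im (f x) * Im (g x))).
    exact: (continuousB (continuousM (f1 x) (g1 x)) (continuousM (f2 x) (g2 x))).
  by apply/funext => y; rewrite ReM.
rewrite (_ : (fun _ => _) =
    (fun x => Re (f x) * Im (g x) + Im (f x) * Re (g x))).
  exact: (continuousD (continuousM (f1 x) (g2 x)) (continuousM (f2 x) (g1 x))).
by apply/funext => y; rewrite ImM.
Qed.

Lemma cpart_conj f : cpart_continuous f -> cpart_continuous (fun x => (f x)^*).
Proof.
move=> [f1 f2]; split=> x.
  rewrite (_ : (fun _ => _) = (fun x => Re (f x))); first exact: f1.
  by apply/funext => y; case: (f y).
rewrite (_ : (fun _ => _) = (fun x => - Im (f x))).
  exact: (continuousN (f2 x)).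
by apply/funext => y; case: (f y).
Qed.

Lemma cpart_sum (I : finType) (P : pred I) (F : I -> T -> C) :
    (forall i, cpart_continuous (F i)) ->
  cpart_continuous (fun x => \sum_(i | P i) F i x).
Proof.
move=> Fc; rewrite (_ : (fun _ => _) = \sum_(i | P i) F i); last first.
  by apply/funext => x; rewrite fct_sumE.
apply: (big_ind cpart_continuous); first exact: cpart_cst.
  by move=> f g fc gc; exact: cpartD.
by move=> i _; exact: Fc.
Qed.

Lemma cpart_mulmx m n p (f : T -> 'M[C]_(m, n))
    (g : T -> 'M[C]_(n, p)) :
    (forall i j, cpart_continuous (fun x => f x i j)) ->
    (forall i j, cpart_continuous (fun x => g x i j)) ->
  forall i j, cpart_continuous (fun x => (f x *m g x) i j).
Proof.
move=> fc gc i j.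
rewrite (_ : (fun _ => _) = (fun x => \sum_k f x i k * g x k j)).
  by apply: cpart_sum => k; exact: cpartM.
by apply/funext => x; rewrite mxE.
Qed.

Lemma cpart_trmxC m n (f : T -> 'M[C]_(m, n)) :
    (forall i j, cpart_continuous (fun x => f x i j)) ->
  forall i j, cpart_continuous (fun x => (f x)^t* i j).
Proof.
move=> fc i j; rewrite (_ : (fun _ => _) = (fun x => (f x j i)^*)).
  exact: cpart_conj.
by apply/funext => x; rewrite trmxCE.
Qed.

End ReImContinuous.

Context (N d : nat) (S : 'I_d -> 'M[C]_N) (K : 'M[C]_N).

Local Notation agler_map := (agler_map S).

Local Notation coord_type := ('I_d * 'I_N * 'I_N * bool)%type.
Local Notation D := #|{: coord_type}|.

Definition mx_of_coords (x : 'rV[R]_D) (k : 'I_d) : 'M[C]_N :=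
  \matrix_(a, b) (x 0 (enum_rank (k, a, b, false)) +i*
                  x 0 (enum_rank (k, a, b, true)))%C.

Definition residual_energy (Y : 'I_d -> 'M[C]_N) : R :=
  Re (mxnrm2 (agler_map Y - K)).

Lemma residual_energyE Y :
  (residual_energy Y)%:C%C = mxnrm2 (agler_map Y - K).
Proof. by rewrite RRe_real// ger0_real// mxnrm2_ge0. Qed.

Lemma mx_of_coords_surj Y : exists x, mx_of_coords x =1 Y.
Proof.
exists (\row_i let: (k, a, b, s) := enum_val i in
  if s then Im (Y k a b) else Re (Y k a b)) => k.
by apply/matrixP => a b; rewrite !mxE !enum_rankK; case: (Y k a b).
Qed.

Lemma residual_energy_continuous :
  continuous (fun x => residual_energy (mx_of_coords x)).
Proof.
have Yc k a b : cpart_continuous (fun x => mx_of_coords x k a b).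
  split=> x.
    rewrite (_ : (fun _ => _) = (fun x : 'rV[R]_D =>
        x 0 (enum_rank (k, a, b, false)))); first exact: coord_continuous.
    by apply/funext => y; rewrite mxE.
  rewrite (_ : (fun _ => _) = (fun x : 'rV[R]_D =>
      x 0 (enum_rank (k, a, b, true)))); first exact: coord_continuous.
  by apply/funext => y; rewrite mxE.
suff [] : cpart_continuous (fun x => mxnrm2 (agler_map (mx_of_coords x) - K)).
  by [].
have Lc a b : cpart_continuous (fun x => (agler_map (mx_of_coords x) - K) a b).
  rewrite (_ : (fun _ => _) = (fun x => \sum_k
     (((mx_of_coords x k)^t* *m mx_of_coords x k) a b
     - (S k *m ((mx_of_coords x k)^t* *m mx_of_coords x k) *m (S k)^t*) a b)
     - K a b)); last first.
    apply/funext => x; rewrite /agler_map !mxE summxE; congr (_ - _).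
    by apply: eq_bigr => k _; rewrite !mxE.
  have YY k : forall i j, cpart_continuous (fun x =>
      ((mx_of_coords x k)^t* *m mx_of_coords x k) i j).
    by apply: cpart_mulmx => //; exact: cpart_trmxC.
  apply: cpartD; last by apply: cpart_cst.
  apply: cpart_sum => k; apply: cpartD => //; apply: cpartN.
  apply: cpart_mulmx => [i j|i j]; last exact: cpart_cst.
  by apply: (cpart_mulmx (f := fun=> S k)) => // ? ?; exact: cpart_cst.
rewrite (_ : (fun _ => _) = (fun x => \sum_i
  ((agler_map (mx_of_coords x) - K)^t* *m (agler_map (mx_of_coords x) - K)) i i))//.
apply: cpart_sum => i; apply: cpart_mulmx => //; exact: cpart_trmxC.
Qed.

Hypothesis coercive : exists2 c : R, 0 <= c & forall Y,
  \sum_k mxnrm2 (Y k) <= c%:C%C * \sum_i \sum_j `|agler_map Y i j|.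

Lemma le_of_Re (a b : C) : 0 <= a -> 0 <= b -> Re a <= Re b -> a <= b.
Proof. by move=> /ger0_Im a0 /ger0_Im b0 ab; rewrite lecE a0 b0 eqxx. Qed.

(** Coercivity bounds [Y] on the sublevel set of the value at [Y = 0], so it suffices to minimise
    over a compact box of real coordinates. *)
Lemma residual_minimizer :
  exists Y, forall Y', mxnrm2 (agler_map Y - K) <= mxnrm2 (agler_map Y' - K).
Proof.
suff [Y Ymin] : exists Y, forall Y', residual_energy Y <= residual_energy Y'.
  exists Y => Y'; exact: le_of_Re (mxnrm2_ge0 _) (mxnrm2_ge0 _) (Ymin Y').
have [c c0 cP] := coercive.
pose e0 := residual_energy (mx_of_coords 0).
(* From [|w| <= 1 + |w|^2] for each entry [w] of [agler_map Y - K], summed over the entries; [N * N]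
   counts the ones, and [e0] bounds the sum of squares. *)
pose Q := c * Re (\sum_i \sum_j `|K i j| + (N * N)%:R) + c * e0.
have bound x : residual_energy (mx_of_coords x) <= e0 ->
    forall i, `|x 0 i| <= 1 + Q.
  move=> xe i; pose Y := mx_of_coords x.
  case iE : (enum_val i) => [[[k a] b] s].
  suff : `|x 0 i| ^+ 2 <= Q.
    move=> xQ; have [x1|/ltW x1] := leP `|x 0 i| 1.
      by rewrite (le_trans x1)// lerDl (le_trans _ xQ)// exprn_ge0.
    by rewrite ler_wpDl// (le_trans _ xQ)// expr2 ler_peMl.
  rewrite -lecR rmorphXn/=.
  have -> : Q%:C%C = c%:C%C * (\sum_i \sum_j `|K i j| + (N * N)%:R + e0%:C%C).
    rewrite /Q -mulrDr rmorphM rmorphD/= RRe_real// ger0_real// addr_ge0//.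
    by do 2!apply: sumr_ge0 => ? _.
  have le1 : (`|x 0 i|%:C%C) ^+ 2 <= \sum_k mxnrm2 (Y k).
    apply: (@le_trans _ _ (`|Y k a b| ^+ 2)).
      rewrite -add_Re2_Im2 -rmorphXn/= lecR real_normK ?num_real//.
      rewrite -(enum_valK i) iE !mxE/=.
      by case: s {iE}; rewrite ?lerDl ?lerDr sqr_ge0.
    rewrite (bigD1 k)//= ler_wpDr//; first by apply: sumr_ge0 => ? _; exact: mxnrm2_ge0.
    rewrite mxnrm2E (bigD1 a)//= ler_wpDr//.
      by do 2!apply: sumr_ge0 => ? _; exact: exprn_ge0.
    by rewrite (bigD1 b)//= lerDl; apply: sumr_ge0 => ? _; exact: exprn_ge0.
  apply: (le_trans le1); apply: (le_trans (cP _)); rewrite ler_wpM2l ?lecR//.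
  have -> : (N * N)%:R = \sum_(i < N) \sum_(j < N) (1 : C).
    by rewrite !(sumr_const, card_ord) -mulrnA.
  apply: (@le_trans _ _ (\sum_i \sum_j `|K i j| + \sum_(i < N) \sum_(j < N) 1 +
    mxnrm2 (agler_map Y - K))).
    rewrite mxnrm2E -!big_split/=; apply: ler_sum => p _.
    rewrite -!big_split/=; apply: ler_sum => q _.
    rewrite -[X in `|X| <= _](subrK (K p q)).
    apply: (le_trans (ler_normD _ _)).
    rewrite [leLHS]addrC -addrA lerD2l.
    have -> : (agler_map Y - K) p q = agler_map Y p q - K p q by rewrite !mxE.
    move: (_ - _) => w.
    have [w1|/ltW w1] := real_leP (normr_real w) (real1 C).
      by rewrite (le_trans w1)// lerDl exprn_ge0.
    by rewrite ler_wpDl// expr2 ler_peMl.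
  by rewrite lerD2l -residual_energyE lecR.
pose A := [set x : 'rV[R]_D | forall i, `[- (1 + Q), 1 + Q]%classic (x ord0 i)].
have Ac : compact A 
  by apply: (@rV_compact R D (fun=> `[- (1 + Q), 1 + Q]%classic)) => i;
    exact: segment_compact.
have AP x : residual_energy (mx_of_coords x) <= e0 -> x \in A.
  by move=> xe; rewrite inE => i /=; rewrite in_itv/= -ler_norml; exact: bound.
have A0 : A !=set0 by exists 0; have := AP 0 (lexx _); rewrite inE.
have [x xA xmin] := EVT_min_rV A0 Ac
  (continuous_subspaceT residual_energy_continuous).
exists (mx_of_coords x) => Y.
have [y yY] := mx_of_coords_surj Y; have <- : mx_of_coords y = Y by exact/funext.
have /orP[/AP ye|] := le_total (residual_energy (mx_of_coords y)) e0.
  exact: xmin.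
by apply: le_trans; apply: xmin; apply: AP; exact: lexx.
Qed.

Lemma ge0_of_quadratic (a b : C) : 0 <= b ->
  (forall t : R, 0 < t < 1 -> 0 <= t%:C%C * a + t%:C%C ^+ 2 * b) -> 0 <= a.
Proof.
case: a b => [a1 a2] [b1 b2]; rewrite lecE/= => /andP[/eqP -> b0] h.
have key (t : R) : 0 < t < 1 -> a2 = 0 /\ 0 <= a1 + t * b1.
  move=> t01; have := h t t01; have t0 : 0 < t by case/andP: t01.
  rewrite lecE !(raddfD, ReM, ImM, expr2)/= !(mulr0, mul0r, addr0, subr0, add0r).
  move=> /andP[/eqP ta tb]; split.
    by move/eqP: ta; rewrite mulf_eq0 (gt_eqF t0) => /eqP.
  by move: tb; rewrite -mulrA -mulrDr pmulr_rge0.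
have h01 : 0 < (2^-1 : R) < 1 by rewrite invr_gt0 ltr0n invf_lt1 ?ltr0n ?ltr1n.
have [a20 _] := key _ h01.
rewrite lecE/= a20 eqxx/=; rewrite leNgt; apply/negP => a10.
(* With [a1 < 0 <= b1] this lies in []0, 1[], and it makes [a1 + t b1] equal to
   [a1 / 2 + t a1 < 0]. *)
pose t := (- a1) / (2 * (b1 - a1)).
have t0 : 0 < t by rewrite /t divr_gt0//; lra.
have tE : t * (2 * (b1 - a1)) = - a1 by rewrite /t divfK// gt_eqF//; lra.
have t1 : t < 1 by rewrite ltr_pdivrMr; nra.
have [_] := key t (introT andP (conj t0 t1)).
have : t * a1 < 0 by rewrite pmulr_rlt0.
clearbody t; lra.
Qed.

Lemma residual_herm Y : K^t* = K ->
  (agler_map Y - K)^t* = agler_map Y - K.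
Proof. by move=> Kh; rewrite trmxCB Kh agler_map_herm. Qed.

Lemma conjc_real (t : R) : (t%:C%C : C)^* = t%:C%C.
Proof. by rewrite conj_Creal// complex_real. Qed.

(** [E] is the residual at a minimiser, so [\tr (E B) >= 0] in every admissible direction [B].
    Adding a small multiple of [v v^*] to one positive term gives the positivity conditions on [E];
    shrinking all terms by [1 - t] gives [\tr (E (agler_map Y)) <= 0], hence
    [\tr (E K) <= - mxnrm2 E]. *)
Theorem agler_alternative : K^t* = K ->
  (exists Y, K = agler_map Y) \/
  (exists E : 'M[C]_N, [/\ E^t* = E,
     forall k, psdmx (E - (S k)^t* *m E *m S k) & \tr (E *m K) < 0]).
Proof.
move=> Kh; have [Y Ymin] := residual_minimizer.
have [E0|E0] := eqVneq (agler_map Y - K) 0.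
  by left; exists Y; apply/esym/eqP; rewrite -subr_eq0 E0.
right; have [E EE] : exists E, E = agler_map Y - K by eexists.
have Eh := residual_herm Y Kh; rewrite -EE in Eh E0.
have var (B : 'M[C]_N) : B^t* = B ->
    (forall t : R, 0 < t < 1 -> exists Y', agler_map Y' - K = E + t%:C%C *: B) ->
    0 <= \tr (E *m B).
  move=> Bh BY; suff : 0 <= 2 * \tr (E *m B) by rewrite pmulr_rge0.
  apply: (ge0_of_quadratic (mxnrm2_ge0 B)) => t t01.
  have [Y' Y'E] := BY t t01.
  have h : mxnrm2 E <= mxnrm2 (E + t%:C%C *: B) by rewrite -Y'E EE; exact: Ymin.
  by rewrite -mxnrm2_variation ?conjc_real// subr_ge0.
exists E; split=> //.
  move=> k v; pose B := v *m v^t*.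
  have -> : (v^t* *m (E - (S k)^t* *m E *m S k) *m v) 0 0 = \tr (E *m defect (S k) B).
    by rewrite quad_trace trace_defect.
  have Bh : B^t* = B by rewrite trmxC_mul trmxCK.
  apply: var => [|t /andP[t0 _]].
    exact: defect_herm.
  have [Z ZE] : exists Z : 'M[C]_N, (Y k)^t* *m Y k + t%:C%C *: B = Z^t* *m Z.
    apply: psd_factor => [|u].
      by rewrite trmxCD trmxCZ Bh conjc_real trmxC_mul trmxCK.
    rewrite mulmxDr mulmxDl mxE addr_ge0 ?quad_gram_ge0//.
    rewrite -scalemxAr -scalemxAl mxE mulr_ge0//; first by rewrite lecR ltW.
    by rewrite /B -{1}(trmxCK v) quad_gram_ge0.
  exists (fun j => if j == k then Z else Y j).
  by rewrite (agler_map_update S ZE) addrAC -EE.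
have EL : 0 <= \tr (E *m (- agler_map Y)).
  apply: var => [|t /andP[t0 t1]].
    by rewrite -[agler_map Y](subrK K) -EE opprD trmxCB Kh -[- E]add0r trmxCB trmxC0 Eh.
  pose s := sqrtC (1 - t)%:C%C; exists (fun k => s *: Y k).
  have ss : s^* * s = (1 - t)%:C%C.
    have s0 : 0 <= (1 - t)%:C%C :> C by rewrite lecR subr_ge0 ltW.
    by rewrite conj_Creal ?ger0_real ?sqrtC_ge0// -expr2 sqrtCK.
  rewrite agler_map_scale ss rmorphB/= rmorph1 scalerBl scale1r scalerN EE.
  by rewrite addrAC.
have -> : K = agler_map Y - E by rewrite EE subKr.
rewrite mulmxBr raddfB/= -oppr_gt0 opprB ltr_wpDr//.
  by rewrite -raddfN -mulmxN.
rewrite -{1}Eh lt_def mxnrm2_ge0 andbT; apply: contra E0.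
by move=> /eqP/mxnrm2_eq0/eqP.
Qed.

End Duality.

(** * Shift matrices on truncated monomials *)

Section TruncatedShift.
Context {C : numClosedFieldType} (d M n : nat).
Local Notation X := ({ffun 'I_d -> 'I_M.+1} * 'I_n)%type.
Local Notation N := #|{: X}|.
Implicit Types (a b : 'I_N) (u t : {ffun 'I_d -> nat}) (k : 'I_d).

(** An index of ['I_N] stands for a monomial with exponents at most [M] times a basis vector of
    [C^n]: [expo] is the exponent and [comp] the vector. *)
Definition expo a : {ffun 'I_d -> nat} := [ffun k => val ((enum_val a).1 k)].
Definition comp a : 'I_n := (enum_val a).2.
Definition mi_deg u : nat := \sum_k u k.
Definition mi_inc k u : {ffun 'I_d -> nat} := [ffun i => u i + (i == k)]%N.
Definition mi0 : {ffun 'I_d -> nat} := [ffun=> 0%N].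

Lemma expo_comp_inj a b : expo a = expo b -> comp a = comp b -> a = b.
Proof.
move=> /ffunP ab cab; apply: enum_val_inj.
rewrite [LHS]surjective_pairing [RHS]surjective_pairing; congr pair => //.
by apply/ffunP => k; apply: val_inj; have := ab k; rewrite !ffunE.
Qed.

Lemma expo_le a k : (expo a k <= M)%N.
Proof. rewrite ffunE -ltnS; exact: ltn_ord. Qed.

Lemma expo_surj u j : (forall k, u k <= M)%N -> exists2 a, expo a = u & comp a = j.
Proof.
move=> uM; exists (enum_rank ([ffun k => inord (u k)], j)).
  by apply/ffunP => k; rewrite !ffunE enum_rankK/= ffunE/= inordK// ltnS.
by rewrite /comp enum_rankK.
Qed.

Lemma mi_deg_inc k u : mi_deg (mi_inc k u) = (mi_deg u).+1.
Proof.
rewrite /mi_deg (eq_bigr (fun i => u i + (i == k))%N) => [|i _].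
  rewrite big_split/= (bigD1 k (P := xpredT) (F := fun i => (i == k : nat)))//=.
  by rewrite eqxx [X in (1 + X)%N]big1 ?addn0 ?addn1// => i /negbTE ->.
by rewrite ffunE.
Qed.

Lemma mi_inc_inj k : injective (mi_inc k).
Proof.
move=> u v /ffunP uv; apply/ffunP => i; have := uv i.
by rewrite !ffunE => /addIn.
Qed.

(** Multiplication by the variable [z_k] on columns; a monomial pushed out of the box is sent to
    zero, which makes the shift nilpotent. *)
Definition shiftmx k : 'M[C]_N :=
  \matrix_(a, b) ((expo a == mi_inc k (expo b)) && (comp a == comp b))%:R.

(** The exponent is not restricted to the box: outside it the row is zero, so the shift identity
    needs no side condition. *)
Definition monomial_row u (j : 'I_n) : 'rV[C]_N :=
  \row_a ((expo a == u) && (comp a == j))%:R.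

Lemma conj_bool (x : bool) : (x%:R : C)^* = x%:R.
Proof. by rewrite conjC_nat. Qed.

Lemma monomial_row_delta a : monomial_row (expo a) (comp a) = delta_mx 0 a.
Proof.
apply/rowP => b; rewrite !mxE eqxx/=; congr (_ %:R); congr nat_of_bool.
apply/idP/eqP => [/andP[/eqP ? /eqP ?]|->]; last by rewrite !eqxx.
exact: expo_comp_inj.
Qed.

Lemma monomial_row_out u j k : (M < u k)%N -> monomial_row u j = 0.
Proof.
move=> uk; apply/rowP => a; rewrite !mxE; case: eqP => // au.
by move: uk; rewrite -au ltnNge expo_le.
Qed.

Lemma monomial_row_shift u j k :
  monomial_row u j *m (shiftmx k)^t* = monomial_row (mi_inc k u) j.
Proof.
have [uM|] := pselect (forall i, u i <= M)%N.
  have [a <- <-] := expo_surj j uM.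
  rewrite monomial_row_delta -rowE; apply/rowP => b.
  by rewrite !mxE conj_bool.
move=> /existsNP[i /negP]; rewrite -ltnNge => ui.
rewrite (monomial_row_out _ ui) mul0mx (@monomial_row_out _ _ i)//.
by rewrite ffunE (leq_trans ui)// leq_addr.
Qed.

Lemma monomial_row_shift_iter u j k m :
  iter m (fun x => x *m (shiftmx k)^t*) (monomial_row u j) =
  monomial_row (iter m (mi_inc k) u) j.
Proof. by elim: m => //= m ->; rewrite monomial_row_shift. Qed.

Lemma iter_mi_inc m k u i : iter m (mi_inc k) u i = (u i + m * (i == k))%N.
Proof.
by elim: m => [|m /= IH]; rewrite ?mul0n ?addn0// ffunE IH -addnA mulSnr.
Qed.

Lemma shiftmx_nilpotent (v : 'cV[C]_N) k :
  iter M.+1 (fun x => shiftmx k *m x) v = 0.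
Proof.
have E m (w : 'cV[C]_N) : (iter m (fun x => shiftmx k *m x) w)^t* =
    iter m (fun x => x *m (shiftmx k)^t*) (w^t*).
  by elim: m => //= m IH; rewrite trmxC_mul IH.
rewrite -[LHS]trmxCK E; suff -> : iter M.+1 (fun x => x *m (shiftmx k)^t*) (v^t*) = 0.
  by rewrite trmxC0.
rewrite [v^t*]row_sum_delta.
have L m : iter m (fun x => x *m (shiftmx k)^t*)
    (\sum_j (v^t*) 0 j *: delta_mx 0 j) = \sum_j (v^t*) 0 j *:
    iter m (fun x : 'rV[C]_N => x *m (shiftmx k)^t*) (delta_mx 0 j).
  elim: m => //= m ->; rewrite mulmx_suml; apply: eq_bigr => j _.
  by rewrite scalemxAl.
rewrite L big1// => a _; rewrite -monomial_row_delta monomial_row_shift_iter.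
rewrite (@monomial_row_out _ _ k) ?scaler0//.
by rewrite iter_mi_inc eqxx muln1 addnS ltnS leq_addl.
Qed.

(** At most one [b] contributes to the entry [a], so the square of the sum is the sum of the
    squares. *)
Lemma shiftmx_mul_entry k (v : 'cV[C]_N) a :
  `|(shiftmx k *m v) a 0| ^+ 2 =
  \sum_b ((expo a == mi_inc k (expo b)) && (comp a == comp b))%:R * `|v b 0| ^+ 2.
Proof.
rewrite mxE; under eq_bigr do rewrite mxE.
have [b ab|ab] := pickP (fun b => (expo a == mi_inc k (expo b)) && (comp a == comp b)).
  have uni b' : b' != b ->
      (expo a == mi_inc k (expo b')) && (comp a == comp b') = false.
    apply: contraNF => /andP[/eqP e /eqP c]; move: ab; rewrite e c.
    by move=> /andP[/eqP/mi_inc_inj e' /eqP c']; apply/eqP/expo_comp_inj.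
  rewrite (bigD1 b)//= ab mul1r big1 => [|b' /uni ->]; last by rewrite mul0r.
  rewrite addr0 [RHS](bigD1 b)//= ab mul1r big1 ?addr0// => b' /uni ->.
  by rewrite mul0r.
rewrite !big1 ?normr0 ?expr0n// => b _; by rewrite ab mul0r.
Qed.

Lemma shiftmx_contraction k (v : 'cV[C]_N) :
  \sum_a `|(shiftmx k *m v) a 0| ^+ 2 <= \sum_b `|v b 0| ^+ 2.
Proof.
under eq_bigr do rewrite shiftmx_mul_entry.
rewrite exchange_big/=; apply: ler_sum => b _; rewrite -mulr_suml.
rewrite -[leRHS]mul1r ler_wpM2r ?exprn_ge0//.
have [a ab|ab] := pickP (fun a => (expo a == mi_inc k (expo b)) && (comp a == comp b)).
  rewrite (bigD1 a)//= ab big1 ?addr0// => a' aa'; apply/eqP.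
  rewrite pnatr_eq0 eqb0; apply: contra aa' => /andP[/eqP e /eqP c].
  move: ab; rewrite -e -c => /andP[/eqP e' /eqP c'].
  by apply/eqP/expo_comp_inj.
by rewrite big1 ?ler01// => a _; rewrite ab.
Qed.

Lemma shiftmx_diag k (Y : 'M[C]_N) a :
  (shiftmx k *m (Y^t* *m Y) *m (shiftmx k)^t*) a a =
  \sum_b ((expo a == mi_inc k (expo b)) && (comp a == comp b))%:R *
     (Y^t* *m Y) b b.
Proof.
have -> : shiftmx k *m (Y^t* *m Y) *m (shiftmx k)^t* =
    (Y *m (shiftmx k)^t*)^t* *m (Y *m (shiftmx k)^t*).
  by rewrite trmxC_mul trmxCK !mulmxA.
have gramE (B : 'M[C]_N) c : (B^t* *m B) c c = \sum_l `|B l c| ^+ 2.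
  by rewrite mxE; apply: eq_bigr => l _; rewrite trmxCE normCKC.
rewrite gramE; under [RHS]eq_bigr do rewrite gramE mulr_sumr.
rewrite [RHS]exchange_big/=; apply: eq_bigr => l _.
have -> : (Y *m (shiftmx k)^t*) l a = ((shiftmx k *m Y^t*) a l)^*.
  by rewrite -trmxCE trmxC_mul trmxCK.
rewrite norm_conjC.
have -> : (shiftmx k *m Y^t*) a l = (shiftmx k *m col l (Y^t*)) a 0.
  by rewrite !mxE; apply: eq_bigr => b _; rewrite !mxE.
rewrite shiftmx_mul_entry; apply: eq_bigr => b _.
by rewrite !mxE norm_conjC.
Qed.

(* Summing the diagonal over the exponents of degree at most [J], the shifted
   terms only cancel contributions of degree less than [J]. *)
Lemma agler_level (Y : 'I_d -> 'M[C]_N) (J : nat) :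
  \sum_k \sum_(a | mi_deg (expo a) == J) ((Y k)^t* *m Y k) a a <=
  \sum_(a | (mi_deg (expo a) <= J)%N) agler_map shiftmx Y a a.
Proof.
have pos k b : 0 <= ((Y k)^t* *m Y k) b b.
  by rewrite mxE sumr_ge0// => l _; rewrite trmxCE mulrC mul_conjC_ge0.
under [leRHS]eq_bigr do rewrite /agler_map summxE.
rewrite [leRHS]exchange_big/=; apply: ler_sum => k _.
have -> : \sum_(a | (mi_deg (expo a) <= J)%N)
    (defect (shiftmx k) ((Y k)^t* *m Y k)) a a =
    \sum_(a | (mi_deg (expo a) <= J)%N) ((Y k)^t* *m Y k) a a -
    \sum_(a | (mi_deg (expo a) <= J)%N) \sum_b
     ((expo a == mi_inc k (expo b)) && (comp a == comp b))%:R *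
     ((Y k)^t* *m Y k) b b.
  rewrite -sumrB; apply: eq_bigr => a _.
  by rewrite [LHS]mxE; congr (_ + _); rewrite mxE shiftmx_diag.
rewrite lerBrDr [leRHS](bigID (fun a => mi_deg (expo a) == J))/=.
rewrite [X in _ <= X + _](eq_bigl (fun a => mi_deg (expo a) == J)); last first.
  by move=> a; case: eqP => [->|]; rewrite ?leqnn ?andbT ?andbF.
rewrite lerD2l exchange_big/=.
rewrite [leRHS]big_mkcond/=; apply: ler_sum => b _; rewrite -mulr_suml.
have [bJ|bJ] := ltnP (mi_deg (expo b)) J.
  rewrite ltnW// ltn_eqF//= -[leRHS]mul1r ler_wpM2r//.
  have [a ab|ab] := pickP (fun a => (expo a == mi_inc k (expo b)) && (comp a == comp b)).
    rewrite big_mkcond/= (bigD1 a)//= ab big1 ?addr0 => [|a' aa'].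
      by case: ifP => _; rewrite ?ler01.
    case: ifP => // _; apply/eqP.
    rewrite pnatr_eq0 eqb0; apply: contra aa' => /andP[/eqP e /eqP c].
    move: ab; rewrite -e -c => /andP[/eqP e' /eqP c'].
    by apply/eqP/expo_comp_inj.
  by rewrite big1 ?ler01// => a _; rewrite ab.
rewrite big1 ?mul0r => [|a aJ]; first by case: ifP.
case: eqP => //= e; move: aJ; rewrite e mi_deg_inc => aJ.
by have := leq_trans aJ bJ; rewrite ltnn.
Qed.

End TruncatedShift.

(** * The Herglotz-Agler condition on shifts *)

Section SumFiniteSupport.
Local Open Scope classical_set_scope.
Local Open Scope ring_scope.

Lemma sum_injective_support (K : numFieldType) (V : normedModType K)
    (T : choiceType) (I : finType) (f : I -> T) (g : T -> V) :
    injective f -> (forall t, (forall i, f i != t) -> g t = 0) ->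
  summability.sum g = \sum_i g (f i).
Proof.
move=> finj g0; apply/cvg_lim; first exact: norm_hausdorff.
apply: cvg_near_cst; exists [fset f i | i in I]%fset => // B /= AB.
rewrite /summability.partial_sum -(big_seq_fsetE _ _ xpredT)/=.
rewrite (bigID (fun t => t \in codom f))/= [X in _ + X]big1 ?addr0; last first.
  move=> t tf; apply: g0 => i; apply: contra tf => /eqP <-; exact: codom_f.
rewrite -big_filter -[RHS](big_map f xpredT g); apply: perm_big.
apply: uniq_perm; rewrite ?filter_uniq ?fset_uniq//.
  by rewrite map_inj_uniq// index_enum_uniq.
move=> t; rewrite mem_filter; apply/andP/mapP => [[/codomP[i ->] _]|[i _ ->]].
  by exists i; rewrite ?mem_index_enum.
split; first exact: codom_f.
by apply: (fsubsetP AB); apply/imfsetP; exists i.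
Qed.

End SumFiniteSupport.

Section Ell2Operators.
Context {R : realType} {N : nat}.
Local Notation C := R[i].

Definition ell2_op (A : 'M[C]_N) (x : ell2 R N) : ell2 R N := (x : 'rV[C]_N) *m A.

Lemma ell2_op_linear A : linear (ell2_op A).
Proof. by move=> a x y; rewrite /ell2_op mulmxDl scalemxAl. Qed.

HB.instance Definition _ A :=
  GRing.isLinear.Build C (ell2 R N) (ell2 R N) *:%R (ell2_op A) (ell2_op_linear A).

Lemma ell2_op_comm (A B : 'M[C]_N) x : A *m B = B *m A ->
  ell2_op A (ell2_op B x) = ell2_op B (ell2_op A x).
Proof. by move=> AB; rewrite /ell2_op -!mulmxA AB. Qed.

Lemma ell2_op_contraction (r : R) (A : 'M[C]_N) : 0 <= r -> r < 1 ->
    (forall x : 'rV[C]_N, (x *m A *m (x *m A)^t*) 0 0 <=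
       r%:C%C ^+ 2 * (x *m x^t*) 0 0) ->
  strict_contraction (ell2_op A).
Proof.
move=> r0 r1 xA; exists r => // x.
rewrite -ler_sqr ?nnegrE ?mulr_ge0 ?lecR// exprMn !ell2_hilbert.
by rewrite /= !dotmxE xA.
Qed.

End Ell2Operators.

Section ShiftMatrices.
Context {C : numClosedFieldType}.

(** Conjugation by [Y] turns the form of [Y Y^*] into the Euclidean norm: with [w = x Y^-1], the
    norm of [x] is the form at [w], and [psd] says that the shift does not increase it. *)
Lemma shift_conj_contraction N (Y S : 'M[C]_N) (r : C) (x : 'rV[C]_N) :
    r^* = r -> 0 <= r -> Y \in unitmx ->
    (forall v : 'cV[C]_N,
      0 <= (v^t* *m (Y *m Y^t* - S^t* *m (Y *m Y^t*) *m S) *m v) 0 0) ->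
  forall A, A = r *: (invmx Y *m S^t* *m Y) ->
  (x *m A *m (x *m A)^t*) 0 0 <= r ^+ 2 * (x *m x^t*) 0 0.
Proof.
move=> rr r0 Yu psd A AE; pose w := x *m invmx Y.
have xw : x = w *m Y by rewrite /w mulmxKV.
have -> : x *m A = r *: (w *m S^t* *m Y) by rewrite AE -scalemxAr /w !mulmxA.
rewrite trmxCZ rr -scalemxAl -scalemxAr scalerA mxE -expr2.
rewrite ler_wpM2l ?exprn_ge0//.
have := psd (w^t*); rewrite trmxCK mulmxBr mulmxBl [X in 0 <= X -> _]mxE.
rewrite [X in 0 <= _ + X -> _]mxE subr_ge0 xw.
by rewrite !trmxC_mul !trmxCK !mulmxA.
Qed.

Lemma quad_sub_conj N (E S : 'M[C]_N) (v : 'cV[C]_N) :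
  (v^t* *m (E - S^t* *m E *m S) *m v) 0 0 =
  (v^t* *m E *m v) 0 0 - ((S *m v)^t* *m E *m (S *m v)) 0 0.
Proof.
rewrite mulmxBr mulmxBl [LHS]mxE [X in _ + X = _]mxE trmxC_mul.
by rewrite !mulmxA.
Qed.

Lemma quad_add_scalar N (E : 'M[C]_N) (e : C) (v : 'cV[C]_N) :
  (v^t* *m (E + e *: 1%:M) *m v) 0 0 =
  (v^t* *m E *m v) 0 0 + e * (v^t* *m v) 0 0.
Proof.
by rewrite mulmxDr mulmxDl [LHS]mxE -scalemxAr -scalemxAl mulmx1 [X in _ + X = _]mxE.
Qed.

Lemma trace_add_trmxC N (E B : 'M[C]_N) : E^t* = E ->
  \tr (E *m (B + B^t*)) = \tr (E *m B) + (\tr (E *m B))^*.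
Proof.
move=> Eh; rewrite mulmxDr mxtraceD; congr (_ + _).
by rewrite -[E in LHS]Eh -trmxC_mul mxtrace_mulC trace_map_mx mxtrace_tr mxtrace_mulC.
Qed.

Lemma shift_conj_comm N (Y S1 S2 : 'M[C]_N) (r : C) : Y \in unitmx ->
    S1^t* *m S2^t* = S2^t* *m S1^t* ->
  (r *: (invmx Y *m S1^t* *m Y)) *m (r *: (invmx Y *m S2^t* *m Y)) =
  (r *: (invmx Y *m S2^t* *m Y)) *m (r *: (invmx Y *m S1^t* *m Y)).
Proof.
move=> Yu S12; rewrite -!scalemxAl -!scalemxAr; congr (_ *: (_ *: _)).
by rewrite -!mulmxA !mulKVmx// !mulmxA -!(mulmxA (invmx Y)) S12.
Qed.

Lemma shift_conj_monomial d M n (Y : 'M[C]_#|{: {ffun 'I_d -> 'I_M.+1} * 'I_n}|)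
    (r a : C) u (j : 'I_n) (k : 'I_d) : Y \in unitmx ->
  (a *: (monomial_row M u j *m Y)) *m
    (r *: (invmx Y *m (shiftmx M n k)^t* *m Y)) =
  (a * r) *: (monomial_row M (mi_inc k u) j *m Y).
Proof.
move=> Yu; rewrite -scalemxAl -scalemxAr scalerA -!mulmxA mulKVmx//.
by rewrite mulmxA monomial_row_shift.
Qed.

Lemma shiftmx_comm d M n (j k : 'I_d) :
  (@shiftmx C d M n j)^t* *m (shiftmx M n k)^t* =
  (shiftmx M n k)^t* *m (shiftmx M n j)^t*.
Proof.
apply/row_matrixP => a; rewrite !rowE !mulmxA -monomial_row_delta.
rewrite !monomial_row_shift; congr monomial_row.
by apply/ffunP => i; rewrite !ffunE addnAC.
Qed.

Lemma sum_delta_quad d M n (u : {ffun 'I_d -> nat}) (j : 'I_n)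
    (Y : 'M[C]_#|{: {ffun 'I_d -> 'I_M.+1} * 'I_n}|)
    (kappa : 'I_#|{: {ffun 'I_d -> 'I_M.+1} * 'I_n}| -> C) :
  ((\sum_b kappa b *: ((delta_mx 0 b : 'rV[C]_#|{: {ffun 'I_d -> 'I_M.+1} * 'I_n}|) *m Y)) *m (monomial_row M u j *m Y)^t*) 0 0 =
  \sum_b \sum_a (Y *m Y^t*) b a * kappa b * ((expo a == u) && (comp a == j))%:R.
Proof.
rewrite mulmx_suml summxE; apply: eq_bigr => b _.
rewrite -scalemxAl trmxC_mul -!mulmxA -rowE row_mul mulmxA -row_mul mxE.
rewrite mxE mulr_sumr; apply: eq_bigr => a _; rewrite !mxE conj_bool.
by rewrite mulrA (mulrC (kappa b)).
Qed.

End ShiftMatrices.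

Section AglerPositivity.
Context {R : realType} (d M n : nat).
Local Notation C := R[i].
Local Notation X := ({ffun 'I_d -> 'I_M.+1} * 'I_n)%type.
Local Notation N := #|{: X}|.
Variable c : {ffun 'I_d -> nat} -> 'M[C]_n.
Local Notation S := (@shiftmx C d M n).
Local Notation ev := (@monomial_row C d M n).

(** The coefficient matrix of the function [F(r z)] seen as a kernel in two variables: it is
    constant in the other variable, so only rows of exponent zero are nonzero. *)
Definition taylor_row (r : R) : 'M[C]_N := \matrix_(a, b)
  ((expo a == mi0 d)%:R * (c (expo b) (comp a) (comp b) * r%:C%C ^+ mi_deg (expo b))).

Hypothesis hd : (0 < d)%N.
Hypothesis c_accretive : forall (H : completeNormedModType C)
    (ip : {dot H for Num.conj}) (T : 'I_d -> {linear H -> H}),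
  hilbert_product ip -> commuting_tuple T -> (forall k, strict_contraction (T k)) ->
  op_accretive ip (op_eval c T).

Definition shift_op (r : R) (Y : 'M[C]_N) k : {linear (ell2 R N) -> (ell2 R N)} :=
  ell2_op (r%:C%C *: (invmx Y *m (S k)^t* *m Y)).

(** Needed because [op_power] applies the operators one variable at a time; it is the exponent
    reached after the variables in [l]. *)
Definition restrict_mi (l : seq 'I_d) (t : {ffun 'I_d -> nat}) :
  {ffun 'I_d -> nat} := [ffun i => if i \in l then t i else 0%N].

Lemma op_power_monomial (r : R) (Y : 'M[C]_N) (t : {ffun 'I_d -> nat}) j :
    Y \in unitmx ->
  op_power (shift_op r Y) t (ev (mi0 d) j *m Y) =
  r%:C%C ^+ mi_deg t *: (ev t j *m Y).
Proof.
move=> Yu; set T := shift_op r Y.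
have step k m (a : C) u : iter m (T k) (a *: (ev u j *m Y)) =
    (a * r%:C%C ^+ m) *: (ev (iter m (mi_inc k) u) j *m Y).
  elim: m => [|m IH]; first by rewrite mulr1.
  by rewrite iterS IH; apply: etrans (shift_conj_monomial _ _ _ _ _ Yu) _;
    rewrite exprSr mulrA.
have key l : uniq l -> foldr (fun k => iter (t k) (T k)) (ev (mi0 d) j *m Y) l =
    r%:C%C ^+ (\sum_(k <- l) t k)%N *: (ev (restrict_mi l t) j *m Y).
  elim: l => [_|k l IH].
    rewrite big_nil expr0 scale1r (_ : restrict_mi [::] t = mi0 d)//.
  rewrite cons_uniq => /andP[kl ul].
  rewrite (_ : foldr _ _ _ = iter (t k) (T k) (foldr (fun k => iter (t k) (T k))
    (ev (mi0 d) j *m Y) l)); last by [].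
  rewrite (IH ul) step big_cons exprD mulrC; congr (_ *: (ev _ j *m Y)).
  apply/ffunP => i; rewrite iter_mi_inc !ffunE inE.
  have [->|ik] := eqVneq i k; first by rewrite (negbTE kl) muln1.
  by rewrite muln0 addn0.
have E1 : (\sum_(k <- enum 'I_d) t k)%N = mi_deg t by rewrite /mi_deg big_enum.
have E2 : restrict_mi (enum 'I_d) t = t.
  by apply/ffunP => i; rewrite ffunE mem_enum.
by have := key _ (enum_uniq 'I_d); rewrite E1 E2.
Qed.

Lemma op_eval_monomial (r : R) (Y : 'M[C]_N) i :
    Y \in unitmx ->
  op_eval c (shift_op r Y)
    (fun j => ev (mi0 d) j *m Y) i =
  \sum_b (c (expo b) i (comp b) * r%:C%C ^+ mi_deg (expo b)) *: (delta_mx 0 b *m Y).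
Proof.
move=> Yu; pose f (s : {ffun 'I_d -> 'I_M.+1}) : {ffun 'I_d -> nat} :=
  [ffun k => val (s k)].
have finj : injective f.
  move=> s t /ffunP st; apply/ffunP => k; apply: val_inj.
  by have := st k; rewrite !ffunE.
rewrite /op_eval (sum_injective_support finj); last first.
  move=> t tf; apply: big1 => j _; rewrite op_power_monomial//.
  have [k tk] : exists k, (M < t k)%N.
    apply: contrapT => /forallNP tM.
    have /negP[] := tf [ffun k => inord (t k)]; apply/eqP/ffunP => k.
    by rewrite /f !ffunE/= inordK// ltnS leqNgt; apply/negP.
  by rewrite (monomial_row_out _ tk) mul0mx !scaler0.
rewrite [RHS](reindex (enum_rank : X -> 'I_N)); last first.
  by apply: onW_bij; exact: enum_rank_bij.
rewrite [RHS](eq_bigr (fun x : X => c (f x.1) i x.2 *: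
    op_power (shift_op r Y)
      (f x.1) (ev (mi0 d) x.2 *m Y))).
  by rewrite -(pair_big xpredT xpredT (fun s j => c (f s) i j *:
    op_power (shift_op r Y)
      (f s) (ev (mi0 d) j *m Y))).
move=> x _; rewrite op_power_monomial// scalerA.
have E : expo (enum_rank x) = f x.1.
  by apply/ffunP => k; rewrite !ffunE enum_rankK.
have E' : comp (enum_rank x) = x.2 by rewrite /comp enum_rankK.
by rewrite -monomial_row_delta E E'.
Qed.

(** The Herglotz-Agler inequality is tested on the constant monomials. The operators carry them to
    all monomials, so the inner product becomes the trace of the Gram matrix [Y Y^*] against the
    Taylor block. *)
Lemma accretive_trace (r : R) (Y : 'M[C]_N) : 0 <= r -> r < 1 -> Y \in unitmx ->
    (forall k, psdmx (Y *m Y^t* - (S k)^t* *m (Y *m Y^t*) *m S k)) ->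
  0 <= \tr (Y *m Y^t* *m taylor_row r) + (\tr (Y *m Y^t* *m taylor_row r))^*.
Proof.
move=> r0 r1 Yu Ypsd.
have Tc k : strict_contraction (shift_op r Y k).
  apply: (ell2_op_contraction r0 r1) => x.
  have r0' : 0 <= r%:C%C :> C by rewrite lecR.
  exact: (shift_conj_contraction x (conjc_real r) r0' Yu (Ypsd k) erefl).
have Tcomm : commuting_tuple (shift_op r Y).
  move=> j k x; apply: ell2_op_comm.
  exact: (shift_conj_comm _ Yu (shiftmx_comm _ _ _ _)).
have := @c_accretive _ ell2_dot (shift_op r Y) ell2_hilbert Tcomm Tc
  (fun j => ev (mi0 d) j *m Y).
set P := (X in 0 <= X + _); set Q := (X in 0 <= _ + X).
have PE : P = \tr (Y *m Y^t* *m taylor_row r).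
  rewrite [P](eq_bigr (fun i => \sum_b \sum_a (Y *m Y^t*) b a *
     (c (expo b) i (comp b) * r%:C%C ^+ mi_deg (expo b)) *
     ((expo a == mi0 d) && (comp a == i))%:R)); last first.
    move=> i _; rewrite op_eval_monomial// /= dotmxE.
    exact: sum_delta_quad.
  rewrite exchange_big; apply: eq_bigr => b _; rewrite [RHS]mxE exchange_big/=.
  apply: eq_bigr => a _; rewrite (bigD1 (comp a))//= big1 => [|i ia].
    have -> : taylor_row r a b = (c (expo b) (comp a) (comp b) *
        r%:C%C ^+ mi_deg (expo b)) * (expo a == mi0 d)%:R by rewrite mxE mulrC.
    by rewrite addr0 eqxx andbT -[LHS]mulrA.
  by rewrite (eq_sym (comp a)) (negbTE ia) andbF mulr0.
have QE : Q = P^*.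
  rewrite rmorph_sum; apply: eq_bigr => i _; rewrite /= !dotmxE.
  by rewrite -trmxCE trmxC_mul trmxCK.
by rewrite QE PE.
Qed.

(** The form does not increase along the iterates of the shift, and these end at zero by
    nilpotency. *)
Lemma psd_of_shift (E : 'M[C]_N) k : psdmx (E - (S k)^t* *m E *m S k) -> psdmx E.
Proof.
move=> psd v.
have step (w : 'cV[C]_N) : ((S k *m w)^t* *m E *m (S k *m w)) 0 0 <= (w^t* *m E *m w) 0 0.
  by rewrite -subr_ge0; have := psd w; rewrite quad_sub_conj.
have it m : (let w := iter m (fun x => S k *m x) v in w^t* *m E *m w) 0 0 <=
    (v^t* *m E *m v) 0 0.
  by elim: m => [|m IH]; [exact: lexx|rewrite iterS; exact: le_trans (step _) IH].
by have := it M.+1; rewrite /= -iterS shiftmx_nilpotent mulmx0 mxE.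
Qed.

(** The multiple of the identity makes the form definite, so that its factor is invertible, and
    preserves the shift inequalities because the shifts also contract the Euclidean norm. *)
Lemma accretive_trace_lt1 (E : 'M[C]_N) (r : R) : E^t* = E ->
    (forall k, psdmx (E - (S k)^t* *m E *m S k)) -> 0 <= r -> r < 1 ->
  forall G, G = E + (1 - r)%:C%C *: 1%:M ->
  0 <= \tr (G *m taylor_row r) + (\tr (G *m taylor_row r))^*.
Proof.
move=> Eh Epsd r0 r1 G GE; pose e : C := (1 - r)%:C%C.
have e0 : 0 < e by rewrite ltcR subr_gt0.
have Ep := psd_of_shift (Epsd (Ordinal hd)).
have Gh : G^t* = G by rewrite GE trmxCD Eh trmxCZ trmxC1 conjc_real.
have Gp (v : 'cV[C]_N) : (v^t* *m G *m v) 0 0 = (v^t* *m E *m v) 0 0 + e * (v^t* *m v) 0 0.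
  by rewrite GE; exact: quad_add_scalar.
have [Z ZE] : exists Z : 'M[C]_N, G = Z^t* *m Z.
  apply: (psd_factor Gh) => v; rewrite Gp; apply: addr_ge0; first exact: Ep.
  exact: mulr_ge0 (ltW e0) (gram_ge0 v).
have GY : G = Z^t* *m (Z^t*)^t* by rewrite trmxCK.
rewrite GY; apply: (accretive_trace r0 r1).
  rewrite -row_free_unit; apply: inj_row_free => v vZ.
  have : (v *m v^t*) 0 0 <= 0.
    rewrite -(ler_pM2l e0) mulr0.
    have := Gp (v^t*); rewrite trmxCK GY mulmxA vZ !mul0mx mxE => /esym h.
    rewrite -h lerDr; have := Ep (v^t*); by rewrite trmxCK.
  move=> vv; apply: row_norm_eq0; apply/matrixP => i j.
  rewrite (ord1 i) (ord1 j) [RHS]mxE; apply: le_anti; apply/andP; split=> //.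
  by have := gram_ge0 (v^t*); rewrite trmxCK.
move=> k v; rewrite -GY quad_sub_conj subr_ge0 !Gp lerD//.
  by have := Epsd k v; rewrite quad_sub_conj subr_ge0.
rewrite ler_pM2l//.
have gE (w : 'cV[C]_N) : (w^t* *m w) 0 0 = \sum_a `|w a 0| ^+ 2.
  by rewrite mxE; apply: eq_bigr => a _; rewrite trmxCE normCKC.
by rewrite !gE; exact: shiftmx_contraction.
Qed.

Lemma ge0_at_1 (f : R -> R) : continuous f ->
  (forall r, 0 <= r -> r < 1 -> 0 <= f r) -> 0 <= f 1.
Proof.
move=> fc fp; rewrite leNgt; apply/negP => f1.
have /cvgrPdist_lt/(_ (- f 1)) := fc 1; rewrite oppr_gt0 => /(_ f1).
rewrite -nbhs_ballE/= => -[e /= e0 fe].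
pose r := 1 - Num.min (e / 2) 1.
have m0 : 0 < Num.min (e / 2) 1 by rewrite lt_min ltr01 divr_gt0.
have r0 : 0 <= r by rewrite subr_ge0 ge_min lexx orbT.
have r1 : r < 1 by rewrite ltrBlDr ltrDl.
have hr : ball (1 : R) e r.
  rewrite -ball_normE /ball_ /= /r subKr gtr0_norm// gt_min ltr_pdivrMr//.
  by rewrite ltr_pMr// ltr1n.
have := fe _ hr; rewrite /=.
rewrite ltr_norml opprK ltrDl oppr_gt0 => /andP[h1 _].
by have := fp _ r0 r1; rewrite leNgt h1.
Qed.

Lemma accretive_trace_ge0 (E : 'M[C]_N) : E^t* = E ->
    (forall k, psdmx (E - (S k)^t* *m E *m S k)) ->
  0 <= \tr (E *m (taylor_row 1 + (taylor_row 1)^t*)).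
Proof.
move=> Eh Epsd.
have trE (B : 'M[C]_N) : \tr (E *m (B + B^t*)) = \tr (E *m B) + (\tr (E *m B))^*.
  exact: trace_add_trmxC Eh.
rewrite trE.
have two (x : C) : (0 <= x + x^*) = (0 <= Re x).
  case: x => x y; rewrite lecE/= subrr eqxx/=; lra.
pose f (r : R) := Re (\tr ((E + (1 - r)%:C%C *: 1%:M) *m taylor_row r)).
have f1 : f 1 = Re (\tr (E *m taylor_row 1)).
  by rewrite /f subrr scale0r addr0.
rewrite two -f1; apply: ge0_at_1 => [|r r0 r1]; last first.
  by rewrite -two; exact: accretive_trace_lt1 erefl.
suff [] : cpart_continuous (fun r : R =>
  \tr ((E + (1 - r)%:C%C *: 1%:M) *m taylor_row r)) by [].
have idc : cpart_continuous (fun r : R => r%:C%C : C).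
  split=> x /=; [exact: cvg_id|exact: cst_continuous].
have powc m : cpart_continuous (fun r : R => r%:C%C ^+ m : C).
  elim: m => [|m IH]; first exact: cpart_cst.
  rewrite (_ : (fun _ => _) = (fun r : R => r%:C%C * r%:C%C ^+ m)).
    exact: cpartM.
  by apply/funext => r; rewrite exprS.
have Hc a b : cpart_continuous (fun r => taylor_row r a b).
  rewrite (_ : (fun _ => _) = (fun r => (expo a == mi0 d)%:R *
    (c (expo b) (comp a) (comp b) * r%:C%C ^+ mi_deg (expo b)))).
    by apply: cpartM; [exact: cpart_cst|apply: cpartM => //; exact: cpart_cst].
  by apply/funext => r; rewrite mxE.
have Gc a b : cpart_continuous (fun r : R => (E + (1 - r)%:C%C *: 1%:M) a b).
  rewrite (_ : (fun _ => _) = (fun r : R => E a b + (1 - r%:C%C) * (a == b)%:R)).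
    apply: cpartD; first exact: cpart_cst.
    apply: cpartM; last exact: cpart_cst.
    by apply: cpartD; [exact: cpart_cst|exact: cpartN].
  by apply/funext => r; rewrite !mxE rmorphB/= rmorph1.
rewrite (_ : (fun _ => _) = (fun r : R => \sum_a
  ((E + (1 - r)%:C%C *: 1%:M) *m taylor_row r) a a))//.
by apply: cpart_sum => a; exact: cpart_mulmx.
Qed.

End AglerPositivity.

(** * From Taylor blocks to an Agler decomposition *)

Section KernelPolynomials.
Context {C : numClosedFieldType} (d D n : nat).
(** One more than the degree bound [D], so that a monomial of degree at most [D] times a variable
    stays in the box. *)
Local Notation M := D.+1.
Local Notation box := {ffun 'I_d -> 'I_M.+1}.
Local Notation X := (box * 'I_n)%type.
Local Notation N := #|{: X}|.
Local Notation S := (@shiftmx C d M n).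
Local Notation ev := (@monomial_row C d M n).
Implicit Types (a b : 'I_N) (u v : {ffun 'I_d -> nat}) (k : 'I_d).

Definition box_mi (B : nat) (s : {ffun 'I_d -> 'I_B.+1}) : {ffun 'I_d -> nat} :=
  [ffun k => val (s k)].
Definition mi_add u v : {ffun 'I_d -> nat} := [ffun k => u k + v k]%N.

Lemma mi_inc_add k u v : mi_inc k (mi_add u v) = mi_add (mi_inc k u) v.
Proof. by apply/ffunP => i; rewrite !ffunE addnAC. Qed.

Lemma box_mi_inj B : injective (@box_mi B).
Proof.
move=> s t /ffunP st; apply/ffunP => k; apply: val_inj.
by have := st k; rewrite !ffunE.
Qed.

Lemma sum_expo (V : nmodType) (f : {ffun 'I_d -> nat} -> 'I_n -> V) :
  \sum_(a : 'I_N) f (expo a) (comp a) = \sum_(s : box) \sum_j f (box_mi s) j.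
Proof.
rewrite pair_big/= (reindex (enum_rank : X -> 'I_N)); last first.
  by apply: onW_bij; exact: enum_rank_bij.
apply: eq_bigr => x _; congr (f _ _); last by rewrite /comp enum_rankK.
by apply/ffunP => k; rewrite !ffunE enum_rankK.
Qed.

Lemma mi_deg_ge u k : (u k <= mi_deg u)%N.
Proof. by rewrite /mi_deg (bigD1 k)//= leq_addr. Qed.

(** [agler_level] bounds the diagonal of the positive terms in each degree; the constant counts the
    possible degrees, from 0 to [d * M]. *)
Lemma agler_shift_coercive : exists2 c : nat, true & forall Y : 'I_d -> 'M[C]_N,
  \sum_k mxnrm2 (Y k) <= c%:R * \sum_i \sum_j `|agler_map S Y i j|.
Proof.
exists (d * M).+1 => // Y.
have le1 (J : 'I_(d * M).+1) :
    \sum_k \sum_(a | mi_deg (expo a) == J) ((Y k)^t* *m Y k) a a <=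
    \sum_i \sum_j `|agler_map S Y i j|.
  have h := agler_level Y J.
  have h0 : 0 <= \sum_k \sum_(a | mi_deg (expo a) == J) ((Y k)^t* *m Y k) a a.
    apply: sumr_ge0 => k _; apply: sumr_ge0 => a _.
    by rewrite mxE sumr_ge0// => l _; rewrite trmxCE mulrC mul_conjC_ge0.
  apply: (le_trans h); rewrite -(ger0_norm (le_trans h0 h)).
  apply: (le_trans (ler_norm_sum _ _ _)); rewrite big_mkcond/=.
  apply: ler_sum => a _; case: ifP => _; last exact: sumr_ge0.
  by rewrite (bigD1 a)//= lerDl sumr_ge0.
rewrite (_ : \sum_k mxnrm2 (Y k) = \sum_(J < (d * M).+1) \sum_k
    \sum_(a | mi_deg (expo a) == J) ((Y k)^t* *m Y k) a a).
  apply: (le_trans (ler_sum _ (fun J _ => le1 J))).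
  by rewrite sumr_const card_ord mulr_natl.
rewrite [RHS]exchange_big/=; apply: eq_bigr => k _.
rewrite /mxnrm2 /mxtrace.
rewrite (partition_big (fun a => inord (mi_deg (expo a)) : 'I_(d * M).+1) xpredT)//=.
apply: eq_bigr => J _; apply: eq_bigl => a; rewrite -val_eqE/= inordK//.
rewrite ltnS (_ : d * M = \sum_(k < d) M)%N; last by rewrite sum_nat_const card_ord.
by apply: leq_sum => i _; exact: expo_le.
Qed.

Definition zmon (z : 'rV[C]_d) u : C := \prod_k z 0 k ^+ u k.

Lemma zmon_inc z k u : zmon z (mi_inc k u) = z 0 k * zmon z u.
Proof.
rewrite /zmon (bigD1 k)//= [in RHS](bigD1 k)//= ffunE eqxx addn1 exprS -mulrA.
congr (_ * (_ * _)); apply: eq_bigr => i /negbTE ik.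
by rewrite ffunE ik addn0.
Qed.

Definition zmon_mx (z : 'rV[C]_d) : 'M[C]_(N, n) :=
  \matrix_(a, j) ((comp a == j)%:R * zmon z (expo a)).

(** Multiplication by the polynomial [q], truncated to the box and acting on monomial rows from the
    right. *)
Definition mul_mx_of (q : {ffun 'I_d -> nat} -> C) : 'M[C]_N :=
  \matrix_a \sum_(s : box) q (box_mi s) *: ev (mi_add (expo a) (box_mi s)) (comp a).

Lemma ev_mul_mx q u j : ev u j *m mul_mx_of q =
  \sum_(s : box) q (box_mi s) *: ev (mi_add u (box_mi s)) j.
Proof.
have [uM|] := pselect (forall i, u i <= M)%N.
  have [a <- <-] := expo_surj j uM.
  by rewrite monomial_row_delta -rowE rowK.
move=> /existsNP[i /negP]; rewrite -ltnNge => ui.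
rewrite (monomial_row_out _ ui) mul0mx big1// => s _.
rewrite (@monomial_row_out _ _ _ _ _ _ i) ?scaler0//.
by rewrite ffunE (leq_trans ui)// leq_addr.
Qed.

Lemma shift_mul_mx_comm q k :
  (S k)^t* *m mul_mx_of q = mul_mx_of q *m (S k)^t*.
Proof.
apply/row_matrixP => a; rewrite !rowE !mulmxA -monomial_row_delta.
rewrite monomial_row_shift !ev_mul_mx mulmx_suml; apply: eq_bigr => s _.
by rewrite -scalemxAl monomial_row_shift mi_inc_add.
Qed.

(** At the edge of the box the truncated shift gives zero instead of the next monomial; the degree
    bound keeps [a] away from it. *)
Lemma zmon_mx_shift z k a j : (mi_deg (expo a) <= D)%N ->
  ((S k)^t* *m zmon_mx z) a j = z 0 k * zmon_mx z a j.
Proof.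
move=> aD.
have [b be bc] : exists2 b : 'I_N, expo b = mi_inc k (expo a) & comp b = comp a.
  apply: expo_surj => i; apply: leq_trans (mi_deg_ge _ i) _.
  by rewrite mi_deg_inc ltnS.
transitivity ((row a ((S k)^t*) *m zmon_mx z) 0 j).
  by rewrite -row_mul [RHS]mxE.
rewrite rowE -monomial_row_delta monomial_row_shift -be -bc monomial_row_delta.
by rewrite -rowE !mxE be bc zmon_inc mulrCA.
Qed.

Definition row_block (f : {ffun 'I_d -> nat} -> 'M[C]_n) : 'M[C]_(n, N) :=
  \matrix_(i, a) f (expo a) i (comp a).

Lemma expo_box a : exists t : box, box_mi t = expo a.
Proof. by exists (enum_val a).1; apply/ffunP => k; rewrite !ffunE. Qed.

(** Truncation does no harm to a product: all factors of a monomial in the box lie in the box. *)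
Lemma row_block_mul (f g : {ffun 'I_d -> nat} -> 'M[C]_n) q :
    (forall t : box, \sum_(s : box) \sum_(s' : box)
      (mi_add (box_mi s') (box_mi s) == box_mi t)%:R *:
        (q (box_mi s) *: f (box_mi s')) = g (box_mi t)) ->
  row_block f *m mul_mx_of q = row_block g.
Proof.
move=> conv; apply/matrixP => i b; rewrite mxE [RHS]mxE.
pose h u (j : 'I_n) : C := f u i j *
  (\sum_(s : box) q (box_mi s) *: ev (mi_add u (box_mi s)) j) 0 b.
transitivity (\sum_(a : 'I_N) h (expo a) (comp a)).
  by apply: eq_bigr => a _; rewrite /h !mxE.
rewrite sum_expo; have [t tE] := expo_box b.
rewrite -tE -conv summxE.
under [RHS]eq_bigr do rewrite summxE.
rewrite [RHS]exchange_big/=; apply: eq_bigr => s' _.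
rewrite (bigD1 (comp b))//= big1 ?addr0 => [|j jb].
  rewrite /h summxE mulr_sumr; apply: eq_bigr => s _.
  rewrite !mxE eqxx andbT tE eq_sym; case: (_ == expo b); last first.
    by rewrite mulr0 mul0r mulr0.
  by rewrite mulr1 mul1r mulrC.
rewrite /h summxE big1 ?mulr0// => s _.
by rewrite !mxE (eq_sym (comp b)) (negbTE jb) andbF mulr0.
Qed.

Lemma row_block_eval f z :
  row_block f *m zmon_mx z = \sum_(s : box) zmon z (box_mi s) *: f (box_mi s).
Proof.
apply/matrixP => i j; rewrite mxE summxE.
pose h u (j' : 'I_n) : C := f u i j' * ((j' == j)%:R * zmon z u).
transitivity (\sum_(a : 'I_N) h (expo a) (comp a)).
  by apply: eq_bigr => a _; rewrite /h !mxE.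
rewrite sum_expo; apply: eq_bigr => s _; rewrite (bigD1 j)//= /h eqxx mul1r.
rewrite big1 ?addr0 => [|j' /negbTE ->]; last by rewrite mul0r mulr0.
by rewrite mxE mulrC.
Qed.

Section Decomposition.
Variables (c : {ffun 'I_d -> nat} -> 'M[C]_n).
Variables (q : {ffun 'I_d -> nat} -> C) (P : {ffun 'I_d -> nat} -> 'M[C]_n).
Hypothesis q_deg : forall u, (D < mi_deg u)%N -> q u = 0.
Hypothesis P_deg : forall u, (D < mi_deg u)%N -> P u = 0.
Hypothesis conv : forall t : box, \sum_(s : box) \sum_(s' : box)
  (mi_add (box_mi s') (box_mi s) == box_mi t)%:R *: (q (box_mi s) *: c (box_mi s')) =
  P (box_mi t).
(** By orthogonality of monomials, this sum is the mean over the torus of the trace of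
    [q^* P + P^* q]. *)
Hypothesis diag_sum : \sum_(s : box) \sum_i
  ((q (box_mi s))^* * P (box_mi s) i i + (P (box_mi s) i i)^* * q (box_mi s)) = 0.

Local Notation unit_block := (row_block (fun u => (u == mi0 d)%:R%:M)).
Local Notation q_block := (row_block (fun u => (q u)%:M)).

Definition taylor_block : 'M[C]_N := unit_block^t* *m row_block c.

Definition kernel_block : 'M[C]_N :=
  q_block^t* *m row_block P + (row_block P)^t* *m q_block.

Lemma unit_block_mul : unit_block *m mul_mx_of q = q_block.
Proof.
apply: row_block_mul => t; rewrite (bigD1 t)//= [X in _ + X]big1 ?addr0 => [|s st].
  have t0 : box_mi [ffun=> 0 : 'I_M.+1] = mi0 d.
    by apply/ffunP => k; rewrite !ffunE.
  rewrite (bigD1 [ffun=> 0])//= big1 ?addr0 => [|s' s'0].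
    rewrite t0 eqxx (_ : mi_add (mi0 d) (box_mi t) = box_mi t) ?eqxx ?scale1r.
      by rewrite scale_scalar_mx mulr1.
    by apply/ffunP => k; rewrite !ffunE.
  rewrite -t0 (inj_eq (@box_mi_inj _)) (negbTE s'0).
  by rewrite scale_scalar_mx mulr0 raddf0 scaler0.
apply: big1 => s' _.
case: (eqVneq (box_mi s') (mi0 d)) => [->|_]; last first.
  by rewrite scale_scalar_mx mulr0 raddf0 scaler0.
case: eqP => [e|_]; last by rewrite scale0r.
case/eqP: st; apply: box_mi_inj; rewrite -e.
by apply/ffunP => k; rewrite !ffunE.
Qed.

(** Congruence by multiplication by [q] turns the kernel [F(w)^* + F(z)] into the polynomial kernel
    [q(w)^* P(z) + P(w)^* q(z)]. *)
Lemma kernel_block_mul :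
  (mul_mx_of q)^t* *m (taylor_block + taylor_block^t*) *m mul_mx_of q =
  kernel_block.
Proof.
rewrite mulmxDr mulmxDl /taylor_block /kernel_block.
rewrite trmxC_mul trmxCK !mulmxA -!trmxC_mul -!mulmxA.
by rewrite unit_block_mul (row_block_mul conv).
Qed.

Lemma kernel_block_diag (J : nat) : (D <= J)%N ->
  \sum_(a : 'I_N | (mi_deg (expo a) <= J)%N) kernel_block a a = 0.
Proof.
move=> DJ; rewrite -[RHS]diag_sum -(sum_expo (fun u i =>
  (q u)^* * P u i i + (P u i i)^* * q u)).
rewrite big_mkcond/=; apply: eq_bigr => a _.
have -> : kernel_block a a = (q (expo a))^* * P (expo a) (comp a) (comp a) +
    (P (expo a) (comp a) (comp a))^* * q (expo a).
  rewrite mxE; congr (_ + _); rewrite mxE (bigD1 (comp a))//= big1 ?addr0 => [|i ia].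
  - by rewrite !mxE eqxx mulr1n.
  - by rewrite !mxE (negbTE ia) mulr0n conjC0 mul0r.
  - by rewrite !mxE eqxx mulr1n.
  - by rewrite !mxE (negbTE ia) mulr0n mulr0.
case: leqP => // Ja; have Da := leq_ltn_trans DJ Ja.
by rewrite (q_deg Da) (P_deg Da) !mxE conjC0 !mul0r addr0.
Qed.

Definition box_eval (f : {ffun 'I_d -> nat} -> C) z : C :=
  \sum_(s : box) f (box_mi s) * zmon z (box_mi s).

Definition box_eval_mx (f : {ffun 'I_d -> nat} -> 'M[C]_n) z : 'M[C]_n :=
  \sum_(s : box) zmon z (box_mi s) *: f (box_mi s).

Lemma kernel_block_eval w z :
  (zmon_mx w)^t* *m kernel_block *m zmon_mx z =
  (box_eval q w)^* *: box_eval_mx P z + box_eval q z *: (box_eval_mx P w)^t*.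
Proof.
have qE y : q_block *m zmon_mx y = (box_eval q y)%:M.
  rewrite row_block_eval /box_eval raddf_sum/=; apply: eq_bigr => s _.
  by rewrite scale_scalar_mx mulrC.
rewrite mulmxDr mulmxDl !mulmxA -!trmxC_mul -!mulmxA !qE row_block_eval.
rewrite row_block_eval -/(box_eval_mx P z) -/(box_eval_mx P w).
rewrite mul_mx_scalar; congr (_ + _).
by rewrite tr_scalar_mx map_scalar_mx mul_scalar_mx.
Qed.

Theorem agler_decomposition (Y : 'I_d -> 'M[C]_N) :
    taylor_block + taylor_block^t* = agler_map S Y ->
  exists Z : 'I_d -> 'M[C]_N, forall w z,
    (box_eval q w)^* *: box_eval_mx P z + box_eval q z *: (box_eval_mx P w)^t* =
    \sum_k (1 - (w 0 k)^* * z 0 k) *: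
      ((Z k *m zmon_mx w)^t* *m (Z k *m zmon_mx z)).
Proof.
move=> KY; pose Z k := Y k *m mul_mx_of q; exists Z => w z.
(* Multiplication by [q] commutes with the shifts, so the congruence carries Agler sums to Agler
   sums. *)
have LZ : kernel_block = agler_map S Z.
  rewrite -kernel_block_mul KY /agler_map mulmx_sumr mulmx_suml.
  apply: eq_bigr => k _; rewrite /defect mulmxBr mulmxBl; congr (_ - _).
    by rewrite /Z trmxC_mul !mulmxA.
  have QS : (mul_mx_of q)^t* *m S k = S k *m (mul_mx_of q)^t*.
    by rewrite -[S k]trmxCK -!trmxC_mul shift_mul_mx_comm.
  rewrite /Z trmxC_mul !mulmxA QS -!mulmxA; congr (_ *m (_ *m (_ *m (_ *m _)))).
  by rewrite shift_mul_mx_comm.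
(* From degree [D] on, [agler_level] bounds a sum of squares by a diagonal sum that vanishes. *)
have Z0 k l a : (D <= mi_deg (expo a))%N -> Z k l a = 0.
  move=> Da; have := agler_level Z (mi_deg (expo a)).
  rewrite -LZ kernel_block_diag// => le0.
  have gramE j b : ((Z j)^t* *m Z j) b b = \sum_m `|Z j m b| ^+ 2.
    by rewrite mxE; apply: eq_bigr => m _; rewrite trmxCE normCKC.
  have ge0 j b : 0 <= ((Z j)^t* *m Z j) b b.
    by rewrite gramE sumr_ge0// => m _; exact: exprn_ge0.
  have ge0' j : 0 <= \sum_(b : 'I_N | mi_deg (expo b) == mi_deg (expo a))
      ((Z j)^t* *m Z j) b b by exact: sumr_ge0.
  have : \sum_j \sum_(b : 'I_N | mi_deg (expo b) == mi_deg (expo a))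
      ((Z j)^t* *m Z j) b b == 0.
    by rewrite eq_le le0 sumr_ge0.
  rewrite psumr_eq0// => /allP/(_ k (mem_index_enum _))/=.
  rewrite psumr_eq0// => /allP/(_ a (mem_index_enum _)); rewrite eqxx/= gramE.
  rewrite psumr_eq0 => [|m _]; last exact: exprn_ge0.
  move=> /allP/(_ l (mem_index_enum _))/=.
  by rewrite expf_eq0/= normr_eq0 => /eqP.
(* Where the truncated shift differs from multiplication by [y_k], the columns of [Z k] are zero. *)
have ZS k y : Z k *m (S k)^t* *m zmon_mx y = y 0 k *: (Z k *m zmon_mx y).
  rewrite -mulmxA; apply/matrixP => l j; rewrite mxE [RHS]mxE mxE mulr_sumr.
  apply: eq_bigr => a _; have [Da|Da] := leqP D (mi_deg (expo a)).
    by rewrite Z0// !mul0r mulr0.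
  by rewrite (zmon_mx_shift _ _ _ (ltnW Da)) mulrCA.
rewrite -kernel_block_eval LZ /agler_map mulmx_sumr mulmx_suml.
apply: eq_bigr => k _; rewrite /defect mulmxBr mulmxBl scalerBl scale1r.
congr (_ - _); first by rewrite !trmxC_mul !mulmxA.
have -> : (zmon_mx w)^t* *m (S k *m ((Z k)^t* *m Z k) *m (S k)^t*) *m zmon_mx z =
    (Z k *m (S k)^t* *m zmon_mx w)^t* *m (Z k *m (S k)^t* *m zmon_mx z).
  by rewrite !trmxC_mul trmxCK !mulmxA.
by rewrite !ZS trmxCZ -scalemxAl -scalemxAr scalerA.
Qed.

End Decomposition.
End KernelPolynomials.

(** * Averages over roots of unity *)

Section Circle.
Context {R : realType}.
Local Notation C := R[i].

Definition cis (x : R) : C := (cos x +i* sin x)%C.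

Lemma cis0 : cis 0 = 1.
Proof. by rewrite /cis cos0 sin0. Qed.

Lemma cisD x y : cis (x + y) = cis x * cis y.
Proof. by rewrite /cis cosD sinD (addrC (sin x * cos y)). Qed.

Lemma cisX x m : cis x ^+ m = cis (m%:R * x).
Proof.
elim: m => [|m IH]; first by rewrite mul0r cis0.
by rewrite exprS IH -cisD -natr1 mulrDl mul1r addrC.
Qed.

Lemma normr_cis x : `|cis x| = 1.
Proof. by rewrite normc_def/= cos2Dsin2 sqrtr1. Qed.

Lemma mul_cis_conj x : cis x * (cis x)^* = 1.
Proof. by rewrite -normCK normr_cis expr1n. Qed.

Lemma cis2pi : cis (2 * pi) = 1.
Proof. by rewrite mulr_natl /cis cos2pi sin2pi. Qed.

Lemma cis_neq1 x : 0 < x -> x < 2 * pi -> cis x != 1.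
Proof.
move=> x0 x2pi; apply/eqP => -[c1 _].
have xE : x = (x / 2) *+ 2 by rewrite -mulr_natr divfK.
have : 0 < sin (x / 2) by rewrite sin_gt0_pi// divr_gt0//= ltr_pdivrMr// mulrC.
move=> s0; have : cos x < 1.
  rewrite xE cos_mulr2n cos2sin2.
  have : 0 < sin (x / 2) ^+ 2 by rewrite exprn_gt0.
  lra.
by rewrite c1 ltxx.
Qed.

Definition unity_root (N : nat) (j : nat) : C := cis (2 * pi * j%:R / N%:R).

Lemma unity_rootE N j : unity_root N j = unity_root N 1 ^+ j.
Proof. by rewrite /unity_root cisX; congr cis; ring. Qed.

Lemma unity_rootD N i j : unity_root N (i + j) = unity_root N i * unity_root N j.
Proof. by rewrite /unity_root -cisD natrD; congr cis; ring. Qed.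

Lemma unity_rootX N j : (0 < N)%N -> unity_root N j ^+ N = 1.
Proof.
move=> N0; rewrite unity_rootE exprAC.
suff -> : unity_root N 1 ^+ N = 1 by rewrite expr1n.
by rewrite /unity_root cisX mulr1 mulrC divfK ?cis2pi// pnatr_eq0 -lt0n.
Qed.

Lemma unity_root_neq1 N j : (0 < j)%N -> (j < N)%N -> unity_root N j != 1.
Proof.
move=> j0 jN; have N0 : (0 < N)%N by exact: leq_ltn_trans jN.
apply: cis_neq1; first by rewrite !mulr_gt0 ?pi_gt0 ?invr_gt0 ?ltr0n.
by rewrite ltr_pdivrMr ?ltr0n// ltr_pM2l ?mulr_gt0 ?pi_gt0// ltr_nat.
Qed.

Lemma unity_root_inj N i j : (i < N)%N -> (j < N)%N ->
  unity_root N i = unity_root N j -> i = j.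
Proof.
wlog ij : i j / (i <= j)%N => [hw iN jN e|iN jN].
  by case/orP: (leq_total i j) => ij; [|apply/esym]; apply: hw.
have u0 : unity_root N i != 0 by rewrite -normr_eq0 normr_cis oner_neq0.
rewrite -{1}(subnK ij) unity_rootD => /eqP.
rewrite -{1}[unity_root N i]mul1r (inj_eq (mulIf u0)) eq_sym.
have [ij0 _|ji] := posnP (j - i)%N.
  by apply/eqP; rewrite eqn_leq ij -subn_eq0 ij0.
by rewrite (negbTE (unity_root_neq1 ji (leq_ltn_trans (leq_subr _ _) jN))).
Qed.

(** For [s] and [t] distinct this is a geometric sum whose ratio is an [N]-th root of unity other
    than 1. *)
Lemma unity_root_orth N s t : (s < N)%N -> (t < N)%N ->
  \sum_(j < N) unity_root N j ^+ s * (unity_root N j ^+ t)^* =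
  N%:R * (s == t)%:R.
Proof.
move=> sN tN; have N0 : (0 < N)%N by exact: leq_ltn_trans sN.
have jE (j : 'I_N) : unity_root N j ^+ s * (unity_root N j ^+ t)^* =
    (unity_root N s * (unity_root N t)^*) ^+ j.
  rewrite exprMn !rmorphXn/= (unity_rootE N j) (unity_rootE N s) (unity_rootE N t).
  by rewrite !rmorphXn -!exprM (mulnC s) (mulnC t).
rewrite (eq_bigr _ (fun j _ => jE j)).
case: eqVneq => [<-|st].
  rewrite mul_cis_conj; under eq_bigr do rewrite expr1n.
  by rewrite sumr_const card_ord mulr1.
set x := _ * _; have x1 : x != 1.
  apply: contra st => /eqP xe; apply/eqP; apply: (unity_root_inj sN tN).
  by rewrite -[LHS]mulr1 -(mul_cis_conj (2 * pi * t%:R / N%:R)) mulrCA mulrC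
    [X in X * _ = _]xe mul1r.
have xN : x ^+ N = 1 by rewrite /x exprMn -rmorphXn !unity_rootX// rmorph1 mulr1.
have /eqP := subrX1 x N; rewrite xN subrr eq_sym mulf_eq0 subr_eq0 (negbTE x1).
by move=> /eqP ->; rewrite mulr0.
Qed.

Definition torus_grid (d N : nat) (e : {ffun 'I_d -> 'I_N}) : 'rV[C]_d :=
  \row_k unity_root N (e k).

Lemma torus_gridE d N (e : {ffun 'I_d -> 'I_N}) :
  torus_grid e = torus_point (\row_k (2 * pi * (e k)%:R / N%:R)).
Proof. by apply/rowP => k; rewrite !mxE. Qed.

(** The sum over the grid factors over the coordinates; exponents below [N] exclude aliasing. *)
Lemma zmon_orth d N (u t : {ffun 'I_d -> nat}) :
    (forall k, u k < N)%N -> (forall k, t k < N)%N ->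
  \sum_(e : {ffun 'I_d -> 'I_N}) zmon (torus_grid e) u * (zmon (torus_grid e) t)^* =
  (N ^ d)%:R * (u == t)%:R.
Proof.
move=> uN tN.
transitivity (\sum_(e : {ffun 'I_d -> 'I_N}) \prod_k
    (unity_root N (e k) ^+ u k * (unity_root N (e k) ^+ t k)^*)).
  apply: eq_bigr => e _; rewrite rmorph_prod -big_split/=.
  by apply: eq_bigr => k _; rewrite mxE.
rewrite -(bigA_distr_bigA (fun k (j : 'I_N) =>
  unity_root N j ^+ u k * (unity_root N j ^+ t k)^*)).
under eq_bigr do rewrite unity_root_orth//.
rewrite big_split/= prodr_const card_ord natrX; congr (_ * _).
case: eqVneq => [->|ut]; first by rewrite big1// => k _; rewrite eqxx.
have [k uk] : exists k, u k != t k.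
  apply: contrapT => /forallNP h; case/eqP: ut; apply/ffunP => k.
  by apply/eqP; have /negP := h k; rewrite negbK.
by rewrite (bigD1 k)//= (negbTE uk) mul0r.
Qed.

Lemma zmonZ d (r : C) (z : 'rV[C]_d) u : zmon (r *: z) u = r ^+ mi_deg u * zmon z u.
Proof.
rewrite /zmon /mi_deg -prodrXr -big_split/=.
by apply: eq_bigr => k _; rewrite mxE exprMn.
Qed.

Lemma zmon_mi_add d (z : 'rV[C]_d) u v : zmon z (mi_add u v) = zmon z u * zmon z v.
Proof.
by rewrite /zmon -big_split/=; apply: eq_bigr => k _; rewrite ffunE exprD.
Qed.

Lemma normr_zmon_grid d N (e : {ffun 'I_d -> 'I_N}) u : `|zmon (torus_grid e) u| = 1.
Proof.
rewrite /zmon normr_prod big1// => k _.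
by rewrite normrX mxE normr_cis expr1n.
Qed.

End Circle.

(** * Polynomials as sums over boxes *)

Section MpolyBox.
Context {C : fieldType} {d : nat}.

Definition mi_mnm (u : {ffun 'I_d -> nat}) : mpoly.multinom d :=
  mpoly.Multinom [tuple u i | i < d].

Definition mpcoef (p : mpoly.mpoly d C) (u : {ffun 'I_d -> nat}) : C :=
  mpoly.mcoeff (mi_mnm u) p.

Lemma mi_mnmE u k : mpoly.fun_of_multinom (mi_mnm u) k = u k.
Proof. by rewrite /mi_mnm mpoly.mnmE. Qed.

Lemma mpcoef_bound (p : mpoly.mpoly d C) : exists D, forall u,
  (D < mi_deg u)%N -> mpcoef p u = 0.
Proof.
exists (\sum_(m <- mpoly.msupp p) mpoly.mdeg m)%N => u Du.
apply: mpoly.memN_msupp_eq0; apply: contraL Du => um; rewrite -leqNgt.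
have -> : mi_deg u = mpoly.mdeg (mi_mnm u).
  by rewrite mpoly.mdegE; apply: eq_bigr => k _; rewrite mi_mnmE.
by rewrite (big_rem _ um)/= leq_addr.
Qed.

Lemma meval_box (p : mpoly.mpoly d C) (z : 'I_d -> C) (B : nat) :
    (forall u, (B < mi_deg u)%N -> mpcoef p u = 0) ->
  mpoly.meval z p =
  \sum_(s : {ffun 'I_d -> 'I_B.+1}) mpcoef p (box_mi s) * \prod_k z k ^+ box_mi s k.
Proof.
move=> pB; rewrite mpoly.mevalE.
pose h m := mpoly.mcoeff m p * \prod_k z k ^+ mpoly.fun_of_multinom m k.
pose f (s : {ffun 'I_d -> 'I_B.+1}) := mi_mnm (box_mi s).
have finj : injective f.
  move=> s t /(congr1 (@mpoly.fun_of_multinom d)) st.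
  apply: box_mi_inj; apply/ffunP => k.
  by have := congr1 (fun g => g k) st; rewrite !mi_mnmE.
transitivity (\sum_(s : {ffun 'I_d -> 'I_B.+1}) h (f s)); last first.
  apply: eq_bigr => s _; rewrite /h /mpcoef -/(f s); congr (_ * _).
  by apply: eq_bigr => k _; rewrite mi_mnmE.
rewrite -[RHS](big_map f xpredT h) [RHS](bigID (fun m : mpoly.multinom d => m \in mpoly.msupp p))/=.
rewrite [X in _ = _ + X]big1 ?addr0 => [|m mp]; last first.
  by rewrite /h mpoly.memN_msupp_eq0// mul0r.
rewrite -[RHS]big_filter; apply: perm_big; apply: uniq_perm.
- exact: mpoly.msupp_uniq.
- by rewrite filter_uniq// map_inj_uniq// index_enum_uniq.
move=> m; rewrite mem_filter; case: (boolP (m \in _)) => //= mp.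
have uB : (mi_deg [ffun k => mpoly.fun_of_multinom m k] <= B)%N.
  rewrite leqNgt; apply/negP => /pB; rewrite /mpcoef => /eqP.
  rewrite mpoly.mcoeff_eq0 => /negP; apply.
  suff -> : mi_mnm [ffun k => mpoly.fun_of_multinom m k] = m by [].
  by apply/mpoly.mnmP => k; rewrite mi_mnmE ffunE.
apply/esym/mapP; exists [ffun k => inord (mpoly.fun_of_multinom m k)]; first by rewrite mem_index_enum.
apply/mpoly.mnmP => k; rewrite /f mi_mnmE !ffunE /= inordK//.
by rewrite ltnS (leq_trans _ uB)//; have := mi_deg_ge [ffun k => mpoly.fun_of_multinom m k] k; rewrite ffunE.
Qed.

End MpolyBox.

(** * Absolutely summable power series *)

Section SupportSums.
Context {T : choiceType} {V : zmodType}.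

Lemma eq_sum_support (s1 s2 : seq T) (g : T -> V) : uniq s1 -> uniq s2 ->
    (forall t, g t != 0 -> (t \in s1) = (t \in s2)) ->
  \sum_(t <- s1) g t = \sum_(t <- s2) g t.
Proof.
move=> u1 u2 s12.
have E (s : seq T) : \sum_(t <- s) g t = \sum_(t <- [seq t <- s | g t != 0]) g t.
  rewrite big_filter (bigID (fun t => g t != 0))/= [X in _ + X]big1 ?addr0//.
  by move=> t; rewrite negbK => /eqP.
rewrite E [RHS]E; apply: perm_big; apply: uniq_perm; rewrite ?filter_uniq// => t.
by rewrite !mem_filter; case: (boolP (g t != 0)) => //= gt; exact: s12.
Qed.

Lemma eq_sum_support_inj (I J : finType) (f : I -> T) (h : J -> T) (g : T -> V) :
    injective f -> injective h ->
    (forall t, g t != 0 -> (t \in codom f) = (t \in codom h)) ->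
  \sum_i g (f i) = \sum_j g (h j).
Proof.
move=> fi hi fh; rewrite -(big_map f xpredT g) -(big_map h xpredT g).
apply: eq_sum_support; rewrite ?map_inj_uniq ?index_enum_uniq// => t gt.
have E (K : finType) (k : K -> T) : (t \in [seq k i | i <- index_enum K]) = (t \in codom k).
  by apply/mapP/codomP => [[i _ ->]|[i ->]]; exists i; rewrite ?mem_index_enum.
by rewrite !E; exact: fh.
Qed.

End SupportSums.

Section PowerSeries.
Local Open Scope classical_set_scope.
Local Open Scope ring_scope.
Context {R : realType} {d : nat}.
Local Notation C := R[i].
Local Notation mi := {ffun 'I_d -> nat}.

Lemma mem_box (B : nat) (u : mi) :
  (u \in codom (@box_mi d B)) = [forall k, (u k <= B)%N].
Proof.
apply/codomP/forallP => [[s ->] k|uB]; first by rewrite ffunE -ltnS; exact: ltn_ord.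
exists [ffun k => inord (u k)]; apply/ffunP => k.
by rewrite !ffunE /= inordK// ltnS.
Qed.

Lemma sum_box_support (V : zmodType) (B B' : nat) (g : mi -> V) :
    (forall u, g u != 0 -> forall k, (u k <= B)%N && (u k <= B')%N) ->
  \sum_(s : {ffun 'I_d -> 'I_B.+1}) g (box_mi s) =
  \sum_(s : {ffun 'I_d -> 'I_B'.+1}) g (box_mi s).
Proof.
move=> gB; apply: eq_sum_support_inj; try exact: box_mi_inj.
move=> t /gB tB; rewrite !mem_box; apply/forallP/forallP => _ k;
  by have /andP[] := tB k.
Qed.

(** The box is only a finite index type: it contains every multi-index of degree at most [J]. *)
Definition degsum (V : nmodType) (J : nat) (f : mi -> V) : V :=
  \sum_(s : {ffun 'I_d -> 'I_J.+1} | (mi_deg (box_mi s) <= J)%N) f (box_mi s).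

(** A finite set of multi-indices lies in a box, over which the sum is a product of [d] one-variable
    geometric sums. *)
Lemma geometric_sum_le (A : {fset mi}) (y : R) : 0 <= y -> y < 1 ->
  \sum_(t <- A) y ^+ mi_deg t <= (1 - y)^-1 ^+ d.
Proof.
move=> y0 y1; pose B := (\sum_(t <- A) mi_deg t)%N.
have AB t k : t \in A -> (t k <= B)%N.
  move=> tA; apply: leq_trans (mi_deg_ge t k) _.
  by rewrite /B (big_rem _ tA)/= leq_addr.
apply: (@le_trans _ _ (\sum_(s : {ffun 'I_d -> 'I_B.+1}) y ^+ mi_deg (box_mi s))).
  rewrite -(big_map (@box_mi d B) xpredT (fun t => y ^+ mi_deg t)).
  rewrite [leRHS](bigID (fun t => t \in A))/= ler_wpDr//.
    by apply: sumr_ge0 => t _; exact: exprn_ge0.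
  rewrite -[leRHS]big_filter (perm_big [seq t <- [seq box_mi i | i <-
    index_enum {ffun 'I_d -> 'I_B.+1}] | t \in A])//.
  apply: uniq_perm; rewrite ?fset_uniq ?filter_uniq ?map_inj_uniq ?index_enum_uniq//.
    exact: box_mi_inj.
  move=> t; rewrite mem_filter; case: (boolP (t \in A)) => //= tA.
  apply/esym/mapP; have : t \in codom (@box_mi d B).
    by rewrite mem_box; apply/forallP => k; exact: AB.
  by move=> /codomP[s ->]; exists s; rewrite ?mem_index_enum.
have -> : \sum_(s : {ffun 'I_d -> 'I_B.+1}) y ^+ mi_deg (box_mi s) =
    \prod_(k < d) \sum_(j < B.+1) y ^+ j.
  rewrite bigA_distr_bigA/=; apply: eq_bigr => s _.
  by rewrite /mi_deg -prodrXr; apply: eq_bigr => k _; rewrite ffunE.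
rewrite prodr_const card_ord; apply: lerXn2r; rewrite ?nnegrE ?invr_ge0 ?subr_ge0 ?(ltW y1)//.
  by apply: sumr_ge0 => j _; exact: exprn_ge0.
have y1' : 0 < 1 - y by rewrite subr_gt0.
rewrite -(ler_pM2l y1') mulfV ?gt_eqF// -opprB mulNr -subrX1 opprB.
by rewrite lerBlDr lerDl exprn_ge0.
Qed.

Section Tail.
Context {V : normedModType C} (f : mi -> V) (K l y : R).
Hypothesis K0 : 0 <= K.
Hypothesis l0 : 0 <= l.
Hypothesis l1 : l <= 1.
Hypothesis y0 : 0 <= y.
Hypothesis y1 : y < 1.
Hypothesis fK : forall t, `|f t| <= (K * (l * y) ^+ mi_deg t)%:C%C.

(** The ratio of the terms is split into [l] and [y]: powers of [l] beyond [J] give the decay, and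
    [y] keeps the sum over all multi-indices finite. *)
Let tail (J : nat) : C := (K * l ^+ J.+1 * (1 - y)^-1 ^+ d)%:C%C.

Lemma partial_sumE (A : {fset mi}) : summability.partial_sum f A = \sum_(t <- A) f t.
Proof. by rewrite /summability.partial_sum -(big_seq_fsetE _ _ xpredT). Qed.

Lemma partial_sum_tail (J : nat) (A : {fset mi}) :
    (forall t, (mi_deg t <= J)%N -> t \in A) ->
  `|summability.partial_sum f A - degsum J f| <= tail J.
Proof.
move=> JA; rewrite partial_sumE (bigID (fun t => mi_deg t <= J)%N)/=.
have -> : \sum_(t <- A | (mi_deg t <= J)%N) f t = degsum J f.
  rewrite /degsum big_mkcond [RHS]big_mkcond/=.
  pose g t := if (mi_deg t <= J)%N then f t else 0.
  rewrite -(big_map (@box_mi d J) xpredT g).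
  apply: eq_sum_support; rewrite ?fset_uniq ?map_inj_uniq ?index_enum_uniq//.
    exact: box_mi_inj.
  move=> t; rewrite /g; case: ifP => [tJ _|]; last by rewrite eqxx.
  rewrite (JA _ tJ); apply/esym/mapP.
  have : t \in codom (@box_mi d J).
    by rewrite mem_box; apply/forallP => k; exact: leq_trans (mi_deg_ge t k) tJ.
  by move=> /codomP[s ->]; exists s; rewrite ?mem_index_enum.
rewrite addrAC subrr add0r; apply: (le_trans (ler_norm_sum _ _ _)).
apply: (@le_trans _ _ (\sum_(t <- A) (K * l ^+ J.+1 * y ^+ mi_deg t)%:C%C)).
  rewrite big_mkcond/=; apply: ler_sum => t _; case: ifP => [tJ|_]; last first.
    by rewrite lecR !mulr_ge0 ?exprn_ge0.
  apply: (le_trans (fK t)); rewrite lecR exprMn mulrA ler_wpM2r ?exprn_ge0//.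
  by rewrite ler_wpM2l// ler_wiXn2l// ltnNge tJ.
rewrite -raddf_sum/= lecR -mulr_sumr ler_wpM2l ?mulr_ge0 ?exprn_ge0//.
exact: geometric_sum_le.
Qed.

Lemma totally_deg (J : nat) :
  \forall A \near @summability.totally mi, forall t, (mi_deg t <= J)%N -> t \in A.
Proof.
exists [fset box_mi s | s in {ffun 'I_d -> 'I_J.+1}]%fset => // A /= BA t tJ.
apply: (fsubsetP BA).
have : t \in codom (@box_mi d J).
  by rewrite mem_box; apply/forallP => k; exact: leq_trans (mi_deg_ge t k) tJ.
by move=> /codomP[s ->]; apply/imfsetP; exists s.
Qed.

Lemma limit_tail (L : V) (J : nat) :
    summability.partial_sum f @ summability.totally --> L ->
  `|L - degsum J f| <= tail J.
Proof.
move=> fL; apply/ler_addgt0Pr => e e0.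
have /cvgrPdist_lt/(_ _ e0) near1 := fL.
have [A [h1 h2]] := @filter_ex _ _ _ _ (filterI near1 (totally_deg J)).
rewrite -[L](subrK (summability.partial_sum f A)) -addrA.
apply: (le_trans (ler_normD _ _)); rewrite [leRHS]addrC.
by apply: lerD; [exact: ltW|exact: partial_sum_tail].
Qed.

End Tail.

(** Outside a finite set [A] a term is the difference of two partial sums that are both within 1 of
    the limit; the finitely many others are bounded by their sum. *)
Lemma bounded_terms (V : normedModType C) (f : mi -> V) (L : V) :
    summability.partial_sum f @ summability.totally --> L ->
  exists2 K : R, 0 <= K & forall t, `|f t| <= K%:C%C.
Proof.
move=> fL; have /cvgrPdist_lt/(_ 1 ltr01) := fL => -[A _ /= AL].
have reC (x : V) : `|x| = (Re `|x|)%:C%C by rewrite RRe_real// ger0_real.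
have reP (x : V) : 0 <= Re `|x| by have := normr_ge0 x; rewrite lecE => /andP[].
exists (2 + \sum_(t <- A) Re `|f t|).
  by apply: addr_ge0 => //; apply: sumr_ge0 => t _; exact: reP.
move=> t; have [tA|tA] := boolP (t \in A).
  rewrite reC lecR (big_rem _ tA)/= addrCA lerDl; apply: addr_ge0 => //.
  by apply: sumr_ge0 => s _; exact: reP.
have h1 := AL _ (fsubset_refl A); have h2 := AL (t |` A)%fset (fsubsetUr _ _).
have ft : f t = summability.partial_sum f (t |` A)%fset - summability.partial_sum f A.
  by rewrite !partial_sumE big_fsetU1//= addrK.
rewrite ft rmorphD/=.
apply: (@le_trans _ _ (1 + 1)).
  rewrite -(subrK L (summability.partial_sum f (t |` A)%fset)) -addrA.
  apply: (le_trans (ler_normD _ _)); apply: lerD; last exact: ltW.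
  by rewrite distrC ltW.
by rewrite rmorph_nat -mulr2n lerDl lecR; apply: sumr_ge0 => s _; exact: reP.
Qed.

End PowerSeries.

Section TaylorProduct.
Local Open Scope classical_set_scope.
Local Open Scope ring_scope.
Context {R : realType} {d : nat}.
Local Notation C := R[i].
Local Notation mi := {ffun 'I_d -> nat}.

Lemma eq0_of_small (x : C) (B : R) :
  (forall l : R, 0 < l -> l <= 1 -> `|x| <= (B * l)%:C%C) -> x = 0.
Proof.
move=> xB; apply/eqP; rewrite -normr_le0; apply/ler_addgt0Pr => e e0; rewrite add0r.
have [r r0 ->] : exists2 r : R, 0 < r & e = r%:C%C.
  by exists (Re e); [move: e0; rewrite ltcE => /andP[]|rewrite RRe_real ?gtr0_real].
have B1 : 0 < `|B| + 1 by rewrite ltr_wpDl.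
pose l := Num.min 1 (r / (`|B| + 1)).
have l0 : 0 < l by rewrite lt_min ltr01 divr_gt0.
apply: (le_trans (xB l l0 _)); first by rewrite ge_min lexx.
rewrite lecR; apply: (@le_trans _ _ ((`|B| + 1) * l)).
  apply: ler_wpM2r; first exact: ltW.
  by apply: (le_trans (ler_norm _)); rewrite lerDl.
by rewrite -ler_pdivlMl// mulrC ge_min lexx orbT.
Qed.

Variables (F : 'rV[C]_d -> C) (c q P : mi -> C) (D : nat).
Local Notation box := {ffun 'I_d -> 'I_D.+1}.
Hypothesis cF : forall z, polydisc z ->
  summability.partial_sum (fun t => zmon z t * c t : C^o) @ summability.totally
    --> (F z : C^o).
Hypothesis qF : forall z, polydisc z ->
  (\sum_(s : box) q (box_mi s) * zmon z (box_mi s)) * F z =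
  \sum_(s : box) P (box_mi s) * zmon z (box_mi s).

Lemma taylor_coef_bound : exists2 K : R, 0 <= K &
  forall t, `|c t| <= (K * 2 ^+ mi_deg t)%:C%C.
Proof.
(* The terms at the point with all coordinates 1/2 are bounded, whence growth of at most
   [2 ^ mi_deg t]. *)
pose z : 'rV[C]_d := (2^-1 : C) *: const_mx 1.
have zD : polydisc z.
  move=> k; rewrite !mxE mulr1 ger0_norm ?invr_ge0 ?ler0n//.
  by rewrite invf_lt1 ?ltr0n// ltr1n.
have [K K0 fK] := bounded_terms (cF zD); exists K => // t.
have := fK t; rewrite /z zmonZ (_ : zmon _ _ = 1) ?mulr1; last first.
  by apply: big1 => k _; rewrite mxE expr1n.
rewrite normrM normrX ger0_norm ?invr_ge0 ?ler0n// => h.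
rewrite rmorphM rmorphXn/= rmorph_nat -ler_pdivrMr ?exprn_gt0 ?ltr0n//.
by rewrite mulrC -exprVn.
Qed.

(** A discrete Cauchy formula: average [q F = P] against a monomial over a torus grid of radius
    [l / 4]. Degrees beyond [J] of the Taylor series cost order [l ^ (J + 1)], while the coefficient
    sought carries [l ^ J]; the discrepancy is thus of order [l] for every small [l]. *)
Lemma taylor_product (t : box) :
  \sum_(s : box) \sum_(s' : box)
    (mi_add (box_mi s') (box_mi s) == box_mi t)%:R * (q (box_mi s) * c (box_mi s')) =
  P (box_mi t).
Proof.
have [K K0 cK] := taylor_coef_bound.
(* The products met below have exponents at most [J + D]; a grid with one more point per coordinate
   prevents aliasing. *)
pose J := mi_deg (box_mi t); pose N := (J + D).+1.
pose coef : C := \sum_(s : box) \sum_(s' : {ffun 'I_d -> 'I_J.+1} |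
    (mi_deg (box_mi s') <= J)%N)
    (mi_add (box_mi s') (box_mi s) == box_mi t)%:R * (q (box_mi s) * c (box_mi s')).
transitivity coef.
  apply: eq_bigr => s _; rewrite /coef [RHS]big_mkcond/=.
  pose g u : C := (mi_add u (box_mi s) == box_mi t)%:R * (q (box_mi s) * c u).
  transitivity (\sum_(s' : box) g (box_mi s')) => //.
  have gJ u : g u != 0 -> [/\ (forall k, (u k <= J)%N), (forall k, (u k <= D)%N) & (mi_deg u <= J)%N].
    rewrite /g; case: (_ =P box_mi t) => [e _|]; last by rewrite mul0r eqxx.
    have ut k : (u k <= box_mi t k)%N by rewrite -e ffunE leq_addr.
    split=> [k|k|].
    - by apply: leq_trans (ut k) _; exact: mi_deg_ge.
    - by apply: leq_trans (ut k) _; rewrite ffunE -ltnS; exact: ltn_ord.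
    - by rewrite /J /mi_deg; apply: leq_sum => k _; exact: ut.
  rewrite (@sum_box_support _ _ D J g) => [|u /gJ[uJ uD _] k]; last by rewrite uJ uD.
  apply: eq_bigr => s' _; case: ifP => // /negP s'J.
  by apply/eqP/negP => /negP/gJ[_ _].
apply/eqP; rewrite -subr_eq0; apply/eqP.
pose Q0 : R := \sum_(s : box) Re `|q (box_mi s)|.
have reP (x : C) : 0 <= Re `|x| by have := normr_ge0 x; rewrite lecE => /andP[].
have Q00 : 0 <= Q0 by apply: sumr_ge0 => s _; exact: reP.
pose B0 : R := Q0 * (K * (1 - 2^-1)^-1 ^+ d).
apply: (@eq0_of_small _ (B0 * 4 ^+ J)) => l l0 l1.
(* Against growth [2 ^ mi_deg u], the radius [l / 4] leaves terms of ratio [l / 2], the split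
   [l * 2^-1] that the tail bound requires. *)
pose rho : C := (l / 4)%:C%C.
have rho0 : 0 < rho by rewrite ltcR divr_gt0.
have rho1 : rho < 1.
  by rewrite ltcR ltr_pdivrMr// mul1r (le_lt_trans l1)// ltr1n.
pose z (e : {ffun 'I_d -> 'I_N}) : 'rV[C]_d := rho *: torus_grid e.
have zk e k : `|z e 0 k| = rho.
  by rewrite !mxE normrM normr_cis mulr1 gtr0_norm.
have zD e : polydisc (z e).
  by move=> k; rewrite zk.
pose f e u : C^o := zmon (z e) u * c u.
have fK e u : `|f e u| <= (K * (l * 2^-1) ^+ mi_deg u)%:C%C.
  rewrite /f normrM zmonZ normrM normr_zmon_grid mulr1 normrX gtr0_norm//.
  apply: (le_trans (ler_wpM2l (exprn_ge0 _ (ltW rho0)) (cK u))).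
  rewrite -rmorphXn -rmorphM/= lecR mulrCA ler_wpM2l// -exprMn.
  by rewrite (_ : l / 4 * 2 = l * 2^-1)//; field.
have half01 : 0 <= (2^-1 : R) /\ 2^-1 < (1 : R) by split; lra.
have tail e := limit_tail K0 (ltW l0) l1 half01.1 half01.2 (fK e) J (cF (zD e)).
pose g e : C := (\sum_(s : box) q (box_mi s) * zmon (z e) (box_mi s)) *
  degsum J (f e) - \sum_(s : box) P (box_mi s) * zmon (z e) (box_mi s).
have gB e : `|g e| <= (B0 * l ^+ J.+1)%:C%C.
  rewrite /g -qF// -mulrBr normrM.
  have -> : B0 * l ^+ J.+1 = Q0 * (K * l ^+ J.+1 * (1 - 2^-1)^-1 ^+ d).
    by rewrite /B0 -!mulrA; congr (_ * (_ * _)); rewrite mulrC.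
  rewrite rmorphM/=; apply: ler_pM => //; last by rewrite distrC; exact: tail.
  apply: (le_trans (ler_norm_sum _ _ _)); rewrite /Q0 raddf_sum/=.
  apply: ler_sum => s _; rewrite normrM.
  rewrite (_ : real_complex _ _ = `|q (box_mi s)|)//.
  rewrite zmonZ normrM normr_zmon_grid mulr1 normrX (gtr0_norm rho0).
  by rewrite ler_piMr// exprn_ile1 ?ltW.
have avg : \sum_e g e * (zmon (torus_grid e) (box_mi t))^* =
    (N ^ d)%:R * rho ^+ J * (coef - P (box_mi t)).
  have A (u : mi) : (forall k, u k < N)%N ->
      \sum_e zmon (z e) u * (zmon (torus_grid e) (box_mi t))^* =
      (N ^ d)%:R * rho ^+ J * (u == box_mi t)%:R.
    move=> uN; have tN k : (box_mi t k < N)%N.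
      by rewrite ffunE ltnS (leq_trans (leq_ord _)) ?leq_addl.
    transitivity (rho ^+ mi_deg u * ((N ^ d)%:R * (u == box_mi t)%:R)).
      rewrite -zmon_orth// mulr_sumr; apply: eq_bigr => e _.
      by rewrite zmonZ mulrA.
    by case: eqP => [->|_]; rewrite ?mulr0// !mulr1 mulrC.
  have sN (s : box) k : (box_mi s k <= D)%N by rewrite ffunE; exact: leq_ord.
  have gE e : g e * (zmon (torus_grid e) (box_mi t))^* =
      \sum_(s : box) \sum_(s' : {ffun 'I_d -> 'I_J.+1} | (mi_deg (box_mi s') <= J)%N)
        q (box_mi s) * c (box_mi s') *
        (zmon (z e) (mi_add (box_mi s') (box_mi s)) * (zmon (torus_grid e) (box_mi t))^*) -
      \sum_(s : box) P (box_mi s) *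
        (zmon (z e) (box_mi s) * (zmon (torus_grid e) (box_mi t))^*).
    rewrite /g mulrBl; congr (_ - _); last first.
      by rewrite mulr_suml; apply: eq_bigr => s _; rewrite mulrA.
    rewrite -mulrA mulr_suml; apply: eq_bigr => s _.
    rewrite /degsum mulr_suml mulr_sumr; apply: eq_bigr => s' _.
    by rewrite /f zmon_mi_add; ring.
  rewrite (eq_bigr _ (fun e _ => gE e)) sumrB mulrBr; congr (_ - _).
    rewrite exchange_big/= /coef mulr_sumr; apply: eq_bigr => s _.
    rewrite exchange_big/= mulr_sumr; apply: eq_bigr => s' s'J.
    rewrite -mulr_sumr A; first by ring.
    move=> k; rewrite ffunE ltnS leq_add// ?sN//.
    by rewrite ffunE; exact: leq_ord.
  rewrite exchange_big/= (bigD1 t)//= [X in _ + X]big1 ?addr0.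
    rewrite -mulr_sumr A ?eqxx ?mulr1 1?mulrC// => k.
    by rewrite ltnS (leq_trans (sN _ _)) ?leq_addl.
  move=> s st; rewrite -mulr_sumr A; last first.
    by move=> k; rewrite ltnS (leq_trans (sN _ _)) ?leq_addl.
  by rewrite (inj_eq (@box_mi_inj _ _)) (negbTE st) !mulr0.
have Nd : 0 < (N ^ d)%:R :> C by rewrite ltr0n expn_gt0.
have : (N ^ d)%:R * rho ^+ J * `|coef - P (box_mi t)| <=
    (N ^ d)%:R * (B0 * l ^+ J.+1)%:C%C.
  have -> : (N ^ d)%:R * rho ^+ J * `|coef - P (box_mi t)| =
      `|\sum_e g e * (zmon (torus_grid e) (box_mi t))^*|.
    by rewrite avg !normrM normr_nat normrX (gtr0_norm rho0).
  apply: (le_trans (ler_norm_sum _ _ _)).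
  apply: (@le_trans _ _ (\sum_(e : {ffun 'I_d -> 'I_N}) (B0 * l ^+ J.+1)%:C%C)).
    apply: ler_sum => e _.
    by rewrite normrM norm_conjC normr_zmon_grid mulr1.
  by rewrite sumr_const card_ffun !card_ord mulr_natl.
rewrite -mulrA ler_pM2l// => h.
have r4 : rho ^+ J = (l ^+ J)%:C%C * (4^-1 ^+ J)%:C%C.
  by rewrite -rmorphM -exprMn rmorphXn.
rewrite -(ler_pM2l (exprn_gt0 J rho0)); apply: (le_trans h).
rewrite r4 -!rmorphM/= lecR.
have -> : l ^+ J * 4^-1 ^+ J * (B0 * 4 ^+ J * l) = B0 * l ^+ J.+1 * (4 ^+ J / 4 ^+ J).
  by rewrite exprS exprVn; ring.
by rewrite divff ?mulr1// expf_neq0// pnatr_eq0.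
Qed.

End TaylorProduct.

(** * Null sets *)

Section NullSets.
Local Open Scope classical_set_scope.
Local Open Scope ring_scope.
Context {R : realType}.

(* Induction on the dimension: integrating over the last coordinate finds a slice
   in which the remaining boxes still have too small a volume. *)
Lemma exists_not_in_boxes (d : nat) (s : nat -> bool) (a b : nat -> nat -> R)
    (p q : nat -> R) :
    (forall l k, a l k <= b l k) -> (forall k, p k < q k) ->
    (\sum_(0 <= l <oo) ((s l)%:R * \prod_(k < d) (b l k - a l k))%:E <
      (\prod_(k < d) (q k - p k))%:E)%E ->
  exists2 x : nat -> R, (forall k, (k < d)%N -> p k <= x k <= q k) &
    forall l, s l -> exists2 k, (k < d)%N & ~~ (a l k <= x k <= b l k).
Proof.
move=> ab pq; elim: d s => [|d IH] s sumlt.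
  (* In dimension 0 the target and every selected box have volume 1, the empty product, so no box
     can be selected. *)
  exists p => // l sl; exfalso; move: sumlt; apply/negP; rewrite -leNgt big_ord0.
  pose u i : \bar R := ((s i)%:R * \prod_(k < 0) (b i k - a i k))%:E.
  have u0 i : (0 <= u i)%E by rewrite lee_fin big_ord0 mulr1.
  apply: (@le_trans _ _ (\sum_(0 <= i < l.+1) u i)%E); last first.
    by apply: nneseries_lim_ge => i _ _; exact: u0.
  rewrite big_nat_recr//= {2}/u sl big_ord0 mulr1 leeDr//.
  by apply: sume_ge0 => i _; exact: u0.
pose v l : R := (s l)%:R * \prod_(k < d) (b l k - a l k).
have v0 l : 0 <= v l.
  by rewrite mulr_ge0// prodr_ge0// => k _; rewrite subr_ge0.
pose I l : set R := `[a l d, b l d]%classic.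
pose D : set R := `[p d, q d]%classic.
pose f l (x : R) : \bar R := ((v l)%:E * (\1_(I l) x)%:E)%E.
have f0 l x : (0 <= f l x)%E by rewrite mule_ge0// lee_fin.
have mI l : measurable (I l) by exact: measurable_itv.
have mD : measurable D by exact: measurable_itv.
have mi1 l (E : set R) : measurable_fun E (EFin \o (\1_(I l) : R -> R)).
  by apply/measurable_EFinP; exact: measurable_indic.
have mf l (E : set R) : measurable_fun E (f l).
  exact: (measurable_funeM _ (mi1 l E)).
pose g x : \bar R := (\sum_(0 <= l <oo) f l x)%E.
have g0 x : (0 <= g x)%E by apply: nneseries_ge0 => l _ _; exact: f0.
have mg : measurable_fun D g.
  have := @ge0_emeasurable_sum _ _ R D f xpredT (fun k x _ _ => f0 k x) (fun k _ => mf k D).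
  by [].
set Vol : R := \prod_(k < d) (q k - p k).
have Vol0 : 0 <= Vol by rewrite prodr_ge0// => k _; rewrite subr_ge0 ltW.
have [x Dx gx] : exists2 x, D x & (g x < Vol%:E)%E.
  apply: contrapT => noslice; move: sumlt; apply/negP; rewrite -leNgt.
  have gge x : D x -> (Vol%:E <= g x)%E.
    by move=> Dx; rewrite leNgt; apply/negP => gx; apply: noslice; exists x.
  have : (\int[lebesgue_measure]_(x in D) (cst Vol%:E) x <=
      \int[lebesgue_measure]_(x in D) g x)%E.
    by apply: ge0_le_integral => //; exact: measurable_cst.
  rewrite integral_cst// (_ : (_ * _)%E = (Vol * (q d - p d))%:E); last first.
    rewrite EFinM; apply: (congr1 (mule _)).
    by transitivity (@lebesgue_measure R D); rewrite // /D lebesgue_measure_itv/= lte_fin pq.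
  rewrite big_ord_recr/= => h; apply: (le_trans h).
  have -> : (\int[lebesgue_measure]_(x in D) g x =
      \sum_(0 <= l <oo) \int[lebesgue_measure]_(x in D) f l x)%E.
    by apply: integral_nneseries => [//|l|l x _]; [exact: mf|exact: f0].
  apply: lee_nneseries => [l _ _|l _].
    by apply: integral_ge0 => x _; exact: f0.
  have -> : (\int[lebesgue_measure]_(x in D) f l x =
      (v l)%:E * lebesgue_measure (I l `&` D))%E.
    transitivity ((v l)%:E * \int[lebesgue_measure]_(x in D) (EFin \o (\1_(I l) : R -> R)) x)%E.
      have ind0 x : D x -> (0 <= (EFin \o (\1_(I l) : R -> R)) x)%E by rewrite lee_fin.
      exact: (ge0_integralZl_EFin (@lebesgue_measure R) mD ind0 (mi1 l D) (v0 l)).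
    by apply: (congr1 (mule (v l)%:E)); exact: (integral_indic (@lebesgue_measure R) mD (mI l)).
  apply: (@le_trans _ _ ((v l)%:E * lebesgue_measure (I l))%E).
    apply: lee_wpmul2l; first by rewrite lee_fin.
    exact: (@le_measure _ _ _ (@lebesgue_measure R) _ _
      (mem_set (measurableI _ _ (mI l) mD)) (mem_set (mI l)) (@subIsetl _ _ _)).
  have muI : lebesgue_measure (I l) = (b l d - a l d)%:E.
    rewrite /I lebesgue_measure_itv/= lte_fin -EFinB.
    by case: ltP => // abl; congr (_%:E); apply/esym/eqP; rewrite subr_eq0 eq_le abl ab.
  apply: (@le_trans _ _ ((v l)%:E * (b l d - a l d)%:E)%E).
    by rewrite -muI.
  by rewrite -EFinM lee_fin big_ord_recr/= mulrA.
(* Only boxes whose last side contains [x] meet the slice, and [g x] is their total volume in the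
   remaining coordinates. *)
have [|y yin yout] := IH (fun l => s l && (a l d <= x <= b l d)).
  apply: le_lt_trans gx; apply: lee_nneseries => l _.
    by rewrite lee_fin mulr_ge0// prodr_ge0// => k _; rewrite subr_ge0.
  rewrite /f -EFinM lee_fin /v mulrAC ler_wpM2r//.
    by rewrite prodr_ge0// => k _; rewrite subr_ge0.
  rewrite indicE; case: (s l) => /=; last by rewrite mul0r.
  rewrite mul1r; case: (boolP (a l d <= x <= b l d)) => [xI|_]; last exact: ler0n.
  by rewrite mem_set// /I/= in_itv.
exists (fun k => if k == d then x else y k) => [k|l sl].
  rewrite ltnS leq_eqVlt; case: eqP => [-> _|_ /= kd]; last exact: yin.
  by move: Dx; rewrite /D/= in_itv.
have [xl|xl] := boolP (a l d <= x <= b l d); last by exists d; rewrite ?eqxx.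
have [|k kd yk] := yout l; first by rewrite sl.
by exists k; [exact: ltnW|rewrite ltn_eqF].
Qed.

Lemma null_box_nonempty (d : nat) (A : set 'rV[R]_d) (p q : 'rV[R]_d) :
    lebesgue_null A -> (forall k, p 0 k < q 0 k) ->
  exists2 x : 'rV[R]_d, (forall k, p 0 k <= x 0 k <= q 0 k) & ~ A x.
Proof.
move=> A0 pq.
(* Coordinates are extended to all of [nat]; the default 1 for [q] against 0 elsewhere keeps the
   required inequalities beyond [d]. *)
pose ext (x : 'rV[R]_d) (e : R) (k : nat) : R :=
  if insub k is Some i then x 0 i else e.
have extE x e (k : 'I_d) : ext x e k = x 0 k by rewrite /ext valK.
have [|a [b [ab Aab sumab]]] := A0 ((\prod_k (q 0 k - p 0 k)) / 2).
  by rewrite divr_gt0// prodr_gt0// => k _; rewrite subr_gt0.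
have pE (x y : 'rV[R]_d) e e' :
    \prod_(k < d) (ext x e k - ext y e' k) = \prod_k (x 0 k - y 0 k).
  by apply: eq_bigr => k _; rewrite !extE.
have [|||x xin xout] := @exists_not_in_boxes d xpredT (fun l => ext (a l) 0)
    (fun l => ext (b l) 0) (ext p 0) (ext q 1).
- by move=> l k; rewrite /ext; case: insubP.
- by move=> k; rewrite /ext; case: insubP.
- rewrite pE; under eq_eseriesr do rewrite pE mul1r.
  apply: (le_lt_trans sumab); rewrite lte_fin ltr_pdivrMr// mulr_natr.
  have : 0 < \prod_k (q 0 k - p 0 k) by rewrite prodr_gt0// => k _; rewrite subr_gt0.
  by rewrite mulr2n ltrDl.
exists (\row_k x k) => [k|/Aab[l _ /= xl]].
  by rewrite mxE; have := xin k (ltn_ord k); rewrite !extE.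
have [k kd] := xout l isT; have := xl (Ordinal kd); rewrite mxE.
by have := extE (a l) 0 (Ordinal kd) => /= ->; rewrite (extE (b l) 0 (Ordinal kd)) => ->.
Qed.

End NullSets.

(** * Boundary values *)

Section Boundary.
Local Open Scope classical_set_scope.
Local Open Scope ring_scope.
Context {R : realType}.
Local Notation C := R[i].

Lemma continuous_sumC (T : topologicalType) (I : finType) (f : I -> T -> C) :
  (forall i, continuous (f i)) -> continuous (fun x => \sum_i f i x).
Proof.
move=> fc x; elim: (index_enum I) => [|i r IH].
  by under eq_fun do rewrite big_nil; exact: cst_continuous.
by under eq_fun do rewrite big_cons; exact: (@continuousD C C^o T _ _ x (fc i x) IH).
Qed.

Lemma continuous_prodC (T : topologicalType) (I : finType) (f : I -> T -> C) :
  (forall i, continuous (f i)) -> continuous (fun x => \prod_i f i x).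
Proof.
by move=> fc x; apply: (cvg_big (@mul_continuous _)) => i _; exact: fc.
Qed.

Lemma continuous_exprC (T : topologicalType) (f : T -> C) m :
  continuous f -> continuous (fun x => f x ^+ m).
Proof.
move=> fc x; elim: m => [|m IHm]; first exact: cst_continuous.
by under eq_fun do rewrite exprS; exact: (continuousM (fc x) IHm).
Qed.

Lemma box_eval_continuous (d D : nat) (f : {ffun 'I_d -> nat} -> C) :
  continuous (fun z : 'rV[C]_d => box_eval D f z).
Proof.
apply: continuous_sumC => s z.
apply: continuousM; first exact: cst_continuous.
apply: continuous_prodC => k; apply: continuous_exprC; exact: coord_continuous.
Qed.

Lemma cpart_torus (d : nat) (k : 'I_d) :
  cpart_continuous (fun x : 'rV[R]_d => torus_point x 0 k).
Proof.
have c1 : continuous (fun x : 'rV[R]_d => x 0 k) by move=> x; exact: coord_continuous.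
under eq_fun do rewrite mxE; split=> x.
  by have := continuous_comp (c1 x) (@continuous_cos R (x 0 k)).
by have := continuous_comp (c1 x) (@continuous_sin R (x 0 k)).
Qed.

Lemma box_eval_mxE (d D n : nat) (P : {ffun 'I_d -> nat} -> 'M[C]_n) z i j :
  box_eval_mx D P z i j = box_eval D (fun u => P u i j) z.
Proof. by rewrite summxE; apply: eq_bigr => s _; rewrite mxE mulrC. Qed.

(** Radial points satisfy [|t_k - z_k| = 1 - |z_k|], so aperture 2 contains them. This makes the
    nontangential filter proper, hence its limits unique. *)
Lemma radial_in_region (d : nat) (t : 'rV[C]_d) (e : R) :
    (forall k, `|t 0 k| = 1) -> 0 < e ->
  exists2 z, nontangential_region t 2 z & ball t e%:C%C z.
Proof.
move=> t1 e0; pose l : R := Num.min e 1 / 2.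
have m0 : 0 < Num.min e 1 by rewrite lt_min e0 ltr01.
have l0 : 0 < l by rewrite divr_gt0.
have l1 : l < 1.
  by rewrite ltr_pdivrMr// mul1r gt_min (ltr_nat R 1 2) orbT.
have le : l < e.
  rewrite ltr_pdivrMr//; apply: (@le_lt_trans _ _ e); first by rewrite ge_min lexx.
  by rewrite mulr_natr mulr2n ltrDl.
pose z : 'rV[C]_d := (1 - l)%:C%C *: t.
have zk k : `|z 0 k| = (1 - l)%:C%C.
  by rewrite !mxE normrM t1 mulr1 gtr0_norm// ltcR subr_gt0.
have tz k : `|t 0 k - z 0 k| = l%:C%C.
  rewrite !mxE -{1}[t 0 k]mul1r -mulrBl normrM t1 mulr1.
  by rewrite -(rmorph1 (real_complex R)) -rmorphB subKr gtr0_norm// ltcR.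
exists z; last first.
  split=> [|i k]; first by rewrite ltcR.
  by rewrite (ord1 i) /ball/= tz ltcR.
split=> k; first by rewrite zk -(rmorph1 (real_complex R)) ltcR gtrBl.
rewrite tz zk -(rmorph1 (real_complex R)) -rmorphB subKr -rmorphM ltcR.
by rewrite mulr_natl mulr2n ltrDl.
Qed.

Section Relation.
Context {d D n : nat}.
Variables (F : 'rV[C]_d -> 'M[C]_n) (q : {ffun 'I_d -> nat} -> C)
  (P : {ffun 'I_d -> nat} -> 'M[C]_n).
Hypothesis qF : forall z, polydisc z -> box_eval D q z *: F z = box_eval_mx D P z.

Lemma boundary_value (t : 'rV[C]_d) (L : 'M[C]_n) i j :
    (forall k, `|t 0 k| = 1) -> nontangential_limit F t L ->
  box_eval D (fun u => P u i j) t = box_eval D q t * L i j.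
Proof.
move=> t1 FL.
have two1 : 1 < 2 :> R by rewrite (ltr_nat R 1 2).
have := FL 2 two1; set G := within _ _ => FG.
have PG : ProperFilter G.
  apply: within_nbhs_proper.
  move=> U /nbhs_ballP[e /= e0 eU].
  have er : e = (Re e)%:C%C by rewrite RRe_real// gtr0_real.
  have [|z zr zt] := @radial_in_region d t (Re e) t1.
    by rewrite -(ltcR 0) -er.
  by exists z; split=> //; apply: eU; rewrite er.
have cG (f : {ffun 'I_d -> nat} -> C) : box_eval D f z @[z --> G] --> box_eval D f t.
  apply: (@cvg_trans _ (box_eval D f z @[z --> t])); last exact: box_eval_continuous.
  move=> U fU; apply: (@filterS _ (nbhs t) _ _ _ _ fU) => z fz _; exact: fz.
have Fij : F z i j @[z --> G] --> L i j.
  exact: (@cvg_comp _ _ _ F (fun M : 'M[C]_n => M i j) _ _ _ FG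
    (@coord_continuous C n n i j L)).
have qFG : box_eval D q z * F z i j @[z --> G] --> box_eval D q t * L i j.
  exact: (cvgM (cG q) Fij).
have PGf : ProperFilter (box_eval D (fun u => P u i j) z @[z --> G]).
  exact: fmap_proper_filter.
apply: (@cvg_unique C^o (@norm_hausdorff C C^o) _ PGf _ _ (cG _)).
apply: cvg_trans qFG; apply: near_eq_cvg.
apply: filterS (withinT _ _) => z [zD _].
by rewrite -box_eval_mxE -qF// mxE.
Qed.

(** A null set contains no box with nonempty interior, so its complement meets every neighbourhood
    of [x]. *)
Lemma null_dense (A : set 'rV[R]_d) (g : 'rV[R]_d -> R) :
    lebesgue_null A -> continuous g ->
    (forall x : 'rV[R]_d, (forall k, 0 <= x 0 k < 2 * pi) -> ~ A x -> g x = 0) ->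
  forall x : 'rV[R]_d, (forall k, 0 <= x 0 k < 2 * pi) -> g x = 0.
Proof.
move=> A0 gc gA x xin; apply/eqP; rewrite -normr_le0; apply/ler_addgt0Pr => e e0.
rewrite add0r.
have /cvgrPdist_lt/(_ _ e0)/nbhs_ballP[r /= r0 rg] := gc x.
(* The box extends to the right of [x] only, by at most [r / 2] and at most halfway to [2 pi], so it
   stays in the parameter domain. *)
pose y : 'rV[R]_d := \row_k Num.min (x 0 k + r / 2) ((x 0 k + 2 * pi) / 2).
have [|z zin zA] := null_box_nonempty (p := x) (q := y) A0.
  move=> k; rewrite mxE lt_min; apply/andP; split; first by rewrite ltrDl divr_gt0.
  by rewrite ltr_pdivlMr// mulr_natr mulr2n ltrD2l; have /andP[] := xin k.
have zb k : x 0 k <= z 0 k /\ z 0 k <= x 0 k + r / 2 /\ z 0 k < 2 * pi.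
  have /andP[z1] := zin k; rewrite mxE le_min => /andP[z2 z3]; split=> //; split=> //.
  apply: (le_lt_trans z3); rewrite ltr_pdivrMr// mulr_natr [ltRHS]mulr2n ltrD2r.
  by have /andP[] := xin k.
have gz : g z = 0.
  apply: gA => // k; have [z1 [_ ->]] := zb k; rewrite andbT (le_trans _ z1)//.
  by have /andP[] := xin k.
have := rg z; rewrite gz subr0 => h; apply/ltW/h; split=> // i k.
rewrite (ord1 i) /ball/= distrC ger0_norm; have [z1 [z2 _]] := zb k.
  rewrite ltrBlDl (le_lt_trans z2)// ltrD2l ltr_pdivrMr// mulr_natr mulr2n.
  by rewrite ltrDl.
by rewrite subr_ge0.
Qed.

(** A discrete Parseval identity: [D.+2] points per coordinate match the exponents from 0 to
    [D.+1]. *)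
Lemma box_eval_average (f g : {ffun 'I_d -> nat} -> C) :
  \sum_(e : {ffun 'I_d -> 'I_D.+2})
    (box_eval D f (torus_grid e))^* * box_eval D g (torus_grid e) =
  (D.+2 ^ d)%:R * \sum_(s : {ffun 'I_d -> 'I_D.+2}) (f (box_mi s))^* * g (box_mi s).
Proof.
have bN (s : {ffun 'I_d -> 'I_D.+2}) k : (box_mi s k < D.+2)%N.
  by rewrite ffunE; exact: ltn_ord.
transitivity (\sum_(s : {ffun 'I_d -> 'I_D.+2}) \sum_(s' : {ffun 'I_d -> 'I_D.+2})
   (f (box_mi s))^* * g (box_mi s') * ((D.+2 ^ d)%:R * (s' == s)%:R) : C).
  transitivity (\sum_(e : {ffun 'I_d -> 'I_D.+2})
    \sum_(s : {ffun 'I_d -> 'I_D.+2}) \sum_(s' : {ffun 'I_d -> 'I_D.+2})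
     (f (box_mi s))^* * g (box_mi s') *
     (zmon (torus_grid e) (box_mi s') * (zmon (torus_grid e) (box_mi s))^*) : C).
    apply: eq_bigr => e _; rewrite rmorph_sum mulr_suml; apply: eq_bigr => s _.
    by rewrite mulr_sumr; apply: eq_bigr => s' _; rewrite rmorphM/=; ring.
  rewrite exchange_big/=; apply: eq_bigr => s _.
  rewrite exchange_big/=; apply: eq_bigr => s' _.
  by rewrite -mulr_sumr zmon_orth// (inj_eq (@box_mi_inj _ _)).
rewrite mulr_sumr; apply: eq_bigr => s _.
rewrite (bigD1 s)//= eqxx mulr1 big1 ?addr0 1?mulrC// => s' /negbTE ->.
by rewrite !mulr0.
Qed.

(** Where the boundary value is [L], the diagonal entries of [q^* P + P^* q] are [|q|^2] times those
    of [L + L^*], hence zero. Being continuous they vanish on the whole torus, in particular on the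
    grid where they are averaged. *)
Lemma boundary_diag_sum :
    ae_torus (fun t : 'rV[C]_d =>
      exists2 L, nontangential_limit F t L & L + (L^t*) = 0) ->
  \sum_(s : {ffun 'I_d -> 'I_D.+2}) \sum_i
    ((q (box_mi s))^* * P (box_mi s) i i + (P (box_mi s) i i)^* * q (box_mi s)) = 0.
Proof.
move=> A0.
pose h (i : 'I_n) (t : 'rV[C]_d) : C :=
  (box_eval D q t)^* * box_eval D (fun u => P u i i) t +
  (box_eval D (fun u => P u i i) t)^* * box_eval D q t.
have torus1 (x : 'rV[R]_d) k : `|torus_point x 0 k| = 1 by rewrite mxE normr_cis.
have hA i (x : 'rV[R]_d) : (forall k, 0 <= x 0 k < 2 * pi) ->
    ~ [set x : 'rV[R]_d | (forall k, 0 <= x 0 k < 2 * pi) /\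
       ~ exists2 L, nontangential_limit F (torus_point x) L & L + (L^t*) = 0] x ->
    h i (torus_point x) = 0.
  move=> xin /not_andP[//|/contrapT[L FL LL]].
  rewrite /h (boundary_value i i (torus1 x) FL).
  have /matrixP/(_ i i) := LL; rewrite mxE trmxCE [RHS]mxE => Lii.
  rewrite rmorphM/= [X in _ + X](_ : _ =
    (box_eval D q (torus_point x))^* * (box_eval D q (torus_point x) * (L i i)^*)).
    by rewrite -mulrDr -mulrDr Lii !mulr0.
  by ring.
have hc i : cpart_continuous (fun x => h i (torus_point x)).
  have Bc (f : {ffun 'I_d -> nat} -> C) :
      cpart_continuous (fun x : 'rV[R]_d => box_eval D f (torus_point x)).
    apply: cpart_sum => s; apply: cpartM; first exact: cpart_cst.
    rewrite /zmon; elim: (index_enum _) => [|k r IH].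
      by under eq_fun do rewrite big_nil; exact: cpart_cst.
    under eq_fun do rewrite big_cons; apply: cpartM => //.
    elim: (box_mi s k) => [|m IHm]; first exact: cpart_cst.
    under eq_fun do rewrite exprS; apply: cpartM => //.
    exact: cpart_torus.
  by apply: cpartD; apply: cpartM => //; exact: cpart_conj.
have h0 i (x : 'rV[R]_d) : (forall k, 0 <= x 0 k < 2 * pi) -> h i (torus_point x) = 0.
  move=> xin; have [c1 c2] := hc i.
  rewrite [LHS]complexE.
  have -> : Re (h i (torus_point x)) = 0.
    by apply: (null_dense A0 c1 _ xin) => y yin /(hA i y yin) ->.
  have -> : Im (h i (torus_point x)) = 0.
    by apply: (null_dense A0 c2 _ xin) => y yin /(hA i y yin) ->.
  by rewrite rmorph0 mulr0 addr0.
rewrite exchange_big/=; apply: big1 => i _.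
have Nd : (D.+2 ^ d)%:R != 0 :> C by rewrite pnatr_eq0 -lt0n expn_gt0.
apply: (mulfI Nd); rewrite mulr0 big_split/= mulrDr.
rewrite -(box_eval_average q (fun u => P u i i)).
rewrite -(box_eval_average (fun u => P u i i) q) -big_split/=.
apply: big1 => e _; rewrite torus_gridE; apply: h0 => k; rewrite mxE.
have D2 : 0 < D.+2%:R :> R by rewrite ltr0n.
have p2 : 0 < 2 * pi :> R by rewrite mulr_gt0 ?pi_gt0.
apply/andP; split; first exact: divr_ge0 (mulr_ge0 (ltW p2) _) (ltW D2).
by rewrite ltr_pdivrMr// ltr_pM2l// ltr_nat.
Qed.

End Relation.
End Boundary.

(** * The kernel decomposition *)

Section Decomposition.
Local Open Scope classical_set_scope.
Local Open Scope ring_scope.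
Context {R : realType} {d : nat}.
Local Notation C := R[i].

Lemma common_denominator (m n : nat) (F : 'rV[C]_d -> 'M[C]_(m, n)) :
    rational_on_polydisc F ->
  exists (q : mpoly.mpoly d C) (P : 'I_m -> 'I_n -> mpoly.mpoly d C),
    forall z, polydisc z -> mpoly.meval (z 0) q != 0 /\
      forall i j, mpoly.meval (z 0) q * F z i j = mpoly.meval (z 0) (P i j).
Proof.
move=> /(_ _ _)/cid-/(_ _ _) h.
pose p i j := projT1 (h i j).
pose r i j := projT1 (cid (projT2 (h i j))).
have prP i j : forall z, polydisc z -> mpoly.meval (z 0) (r i j) != 0 /\
    F z i j = mpoly.meval (z 0) (p i j) / mpoly.meval (z 0) (r i j).
  exact: (projT2 (cid (projT2 (h i j)))).
exists (\prod_(x : 'I_m * 'I_n) r x.1 x.2).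
exists (fun i j => p i j * \prod_(x : 'I_m * 'I_n | x != (i, j)) r x.1 x.2).
move=> z zD; split; first by rewrite rmorph_prod prodf_seq_neq0; apply/allP => x _; have [] := prP x.1 x.2 z zD.
move=> i j; rewrite rmorphM/= (bigD1 (i, j))//= rmorphM/=.
have [r0 ->] := prP i j z zD.
by rewrite mulrAC mulrCA divff// mulr1 mulrC.
Qed.

Lemma taylor_entry (m n : nat) (F : 'rV[C]_d -> 'M[C]_(m, n)) c i j z :
    taylor_coefficients F c -> polydisc z ->
  summability.partial_sum (fun t : {ffun 'I_d -> nat} => zmon z t * c t i j : C^o)
    @ summability.totally --> (F z i j : C^o).
Proof.
move=> Fc zD; have := Fc z zD; set f := (fun t => _) => fF.
have -> : summability.partial_sum (fun t : {ffun 'I_d -> nat} => zmon z t * c t i j : C^o)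
    = fun A => (summability.partial_sum f A) i j.
  apply/funext => A; rewrite !partial_sumE summxE.
  by apply: eq_bigr => t _; rewrite mxE.
exact: (@cvg_comp _ _ _ _ (fun M : 'M[C]_(m, n) => M i j) _ _ _ fF
    (@coord_continuous C m n i j (F z))).
Qed.

Lemma taylor_block_row (D n : nat) (c : {ffun 'I_d -> nat} -> 'M[C]_n) :
  taylor_block D c = taylor_row D.+1 c 1.
Proof.
apply/matrixP => a b; rewrite !mxE rmorph1 expr1n mulr1.
rewrite (bigD1 (comp a))//= big1 ?addr0 => [|i ia]; last first.
  by rewrite trmxCE !mxE eq_sym (negbTE ia) conjC0 mul0r.
by rewrite trmxCE !mxE eqxx mulr1n conjC_nat.
Qed.

Theorem kernel_of_CIHA (n : nat) (F : 'rV[C]_d -> 'M[C]_n) :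
    (0 < d)%N -> (0 < n)%N -> CIHA_rat F ->
  exists (N : 'I_d -> nat) (xi : forall k, 'rV[C]_d -> 'M[C]_(N k, n)),
     [/\ forall k, (0 < N k)%N,
         forall k, rational_on_polydisc (xi k) &
         forall w z : 'rV[C]_d, polydisc w -> polydisc z ->
           (F w)^t* + F z =
             \sum_k (1 - (w 0 k)^* * z 0 k) *: ((xi k w)^t* *m xi k z)].
Proof.
move=> hd hn [/common_denominator[q [P qP]] [_ _ Fb] [_ [c Fc cacc]]].
have [Dq qD] := mpcoef_bound q.
have /(_ _ _)/cid-/(_ _ _) hP := fun i j => mpcoef_bound (P i j).
(* A common degree bound for [q] and all entries of [P]. *)
pose D := (Dq + \sum_i \sum_j projT1 (hP i j))%N.
pose qc : {ffun 'I_d -> nat} -> C := mpcoef q.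
pose Pc u : 'M[C]_n := \matrix_(i, j) mpcoef (P i j) u.
have qc_deg u : (D < mi_deg u)%N -> qc u = 0.
  by move=> Du; apply: qD; apply: leq_ltn_trans Du; rewrite leq_addr.
have Pij_deg i j u : (D < mi_deg u)%N -> mpcoef (P i j) u = 0.
  move=> Du; apply: (projT2 (hP i j)); apply: leq_ltn_trans Du.
  rewrite /D (bigD1 i)//= (bigD1 j)//= addnCA -!addnA leq_addr//.
have Pc_deg u : (D < mi_deg u)%N -> Pc u = 0.
  by move=> Du; apply/matrixP => i j; rewrite !mxE Pij_deg.
have qE (z : 'rV[C]_d) : mpoly.meval (z 0) q = box_eval D qc z.
  by apply: meval_box => u Du; apply: qc_deg; exact: ltnW.
have PE (z : 'rV[C]_d) i j : mpoly.meval (z 0) (P i j) = box_eval D (fun u => Pc u i j) z.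
  transitivity (box_eval D (mpcoef (P i j)) z).
    by apply: meval_box => u Du; apply: Pij_deg; exact: ltnW.
  by apply: eq_bigr => s _; rewrite mxE.
have qF (z : 'rV[C]_d) : polydisc z -> box_eval D qc z *: F z = box_eval_mx D Pc z.
  move=> /qP[_ qPz]; apply/matrixP => i j.
  by rewrite mxE box_eval_mxE -PE -qE.
have q0 (z : 'rV[C]_d) : polydisc z -> box_eval D qc z != 0 by move=> /qP[]; rewrite qE.
have conv (t : {ffun 'I_d -> 'I_D.+2}) : \sum_(s : {ffun 'I_d -> 'I_D.+2})
    \sum_(s' : {ffun 'I_d -> 'I_D.+2})
      (mi_add (box_mi s') (box_mi s) == box_mi t)%:R *:
      (qc (box_mi s) *: c (box_mi s')) = Pc (box_mi t).
  apply/matrixP => i j.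
  have Fij (z : 'rV[C]_d) (zD : polydisc z) := @taylor_entry _ _ F c i j z Fc zD.
  rewrite -(@taylor_product _ _ _ _ qc (fun u => Pc u i j) _ Fij).
    rewrite summxE; apply: eq_bigr => s _.
    by rewrite summxE; apply: eq_bigr => s' _; rewrite !mxE.
  by move=> z /qF/matrixP/(_ i j); rewrite mxE box_eval_mxE.
have diag := boundary_diag_sum qF Fb.
have [Y KY] : exists Y, taylor_block D c + (taylor_block D c)^t* =
    agler_map (shiftmx D.+1 n) Y.
  (* A separating [E] would have negative trace against the Taylor block, which
     [accretive_trace_ge0] excludes. *)
  have [|||[E [EE Epsd]]] // := @agler_alternative _ _ _ (@shiftmx C d D.+1 n)
      (taylor_block D c + (taylor_block D c)^t*).
  - have [c0 _ hc0] := @agler_shift_coercive C d D n.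
    exists c0%:R; first exact: ler0n.
    by move=> Y; rewrite rmorph_nat; exact: hc0.
  - by rewrite trmxCD trmxCK addrC.
  have := accretive_trace_ge0 hd cacc EE Epsd; rewrite -taylor_block_row.
  by move=> /le_lt_trans h /h; rewrite ltxx.
have [Z ZP] := agler_decomposition qc_deg Pc_deg conv diag KY.
(* Dividing by [q] on both sides of the polynomial kernel restores the kernel of [F]. *)
pose xi k (z : 'rV[C]_d) := (box_eval D qc z)^-1 *: (Z k *m zmon_mx D n z).
exists (fun=> #|{: {ffun 'I_d -> 'I_D.+2} * 'I_n}|), xi; split.
- by move=> _; rewrite card_prod card_ffun !card_ord muln_gt0 expn_gt0.
- move=> k a j.
  exists (\sum_b (Z k a b * (comp b == j)%:R) *: mpoly.mpolyX C (mi_mnm (expo b))), q.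
  move=> z zD; split; first by have [] := qP z zD.
  rewrite /xi !mxE qE mulrC raddf_sum/=; congr (_ / _).
  apply: eq_bigr => b _; rewrite mpoly.mevalZ mpoly.mevalX mxE mulrA; congr (_ * _).
  by apply: eq_bigr => i _; rewrite mi_mnmE.
move=> w z wD zD.
pose qw := box_eval D qc w; pose qz := box_eval D qc z.
have FE y : polydisc y -> F y = (box_eval D qc y)^-1 *: box_eval_mx D Pc y.
  by move=> yD; rewrite -qF// scalerA mulVf ?q0// scale1r.
have qw0 : qw^* != 0 by rewrite conjC_eq0; exact: q0.
have qz0 : qz != 0 by exact: q0.
transitivity ((qw^* * qz)^-1 *: \sum_k (1 - (w 0 k)^* * z 0 k) *:
    ((Z k *m zmon_mx D n w)^t* *m (Z k *m zmon_mx D n z))).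
  rewrite -ZP -/qw -/qz scalerDr !scalerA invfM -mulrA mulrCA.
  rewrite -[in X in _ + X *: _]mulrA !mulVf// !mulr1.
  by rewrite !FE// trmxCZ fmorphV addrC.
rewrite scaler_sumr; apply: eq_bigr => k _.
rewrite /xi trmxCZ -scalemxAl -scalemxAr !scalerA fmorphV; congr (_ *: _).
by rewrite invfM; ring.
Qed.

End Decomposition.

(** * Power series of a resolvent *)

Section ResolventCoefficients.
Context {C : numClosedFieldType} {d M n : nat}.
Local Notation mi := {ffun 'I_d -> nat}.

Definition mi_dec k (u : mi) : mi := [ffun i => u i - (i == k)]%N.

Lemma mi_decK k (u : mi) : (0 < u k)%N -> mi_inc k (mi_dec k u) = u.
Proof.
move=> uk; apply/ffunP => i; rewrite !ffunE.
by case: eqP => [->|_]; rewrite ?subnK// subn0 addn0.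
Qed.

Lemma mi_incK k (u : mi) : mi_dec k (mi_inc k u) = u.
Proof. by apply/ffunP => i; rewrite !ffunE addnK. Qed.

Lemma mi_deg_dec k (u : mi) : (0 < u k)%N -> (mi_deg (mi_dec k u)).+1 = mi_deg u.
Proof. by move=> uk; rewrite -(mi_deg_inc k) mi_decK. Qed.

Lemma mi_deg_eq0 (u : mi) : (mi_deg u == 0%N) = (u == mi0 d).
Proof.
rewrite sum_nat_eq0; apply/forallP/eqP => [u0|->]; last by move=> i; rewrite ffunE.
by apply/ffunP => i; rewrite ffunE; apply/eqP/u0.
Qed.

Variables (kap : 'I_M -> 'I_d) (B : 'M[C]_M) (V : 'M[C]_(M, n)).

(** [J] is the recursion fuel: each factor [B P(z)] lowers the remaining degree by one, so starting
    from the degree of [t] it runs out exactly at exponent zero. *)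
Fixpoint resolvent_iter (J : nat) (t : mi) : 'M[C]_(M, n) :=
  if J is J'.+1 then
    \matrix_(a, j) \sum_b B a b *
      (if (0 < t (kap b))%N then resolvent_iter J' (mi_dec (kap b) t) b j else 0)
  else V.

(* The power series coefficients of [(1 - B P(z))^-1 V], where [P(z)] is diagonal
   with entries [z (kap b)]. *)
Definition resolvent_coef (t : mi) : 'M[C]_(M, n) := resolvent_iter (mi_deg t) t.

Lemma resolvent_coefE t a j : resolvent_coef t a j = (t == mi0 d)%:R * V a j +
  \sum_b B a b *
    (if (0 < t (kap b))%N then resolvent_coef (mi_dec (kap b) t) b j else 0).
Proof.
rewrite /resolvent_coef; case t0 : (mi_deg t) => [|J] /=.
  have /eqP := t0; rewrite mi_deg_eq0 => /eqP ->.
  by rewrite eqxx mul1r big1 ?addr0// => b _; rewrite ffunE mulr0.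
rewrite -mi_deg_eq0 t0 mul0r add0r mxE; apply: eq_bigr => b _.
case: ifP => // tb; have := mi_deg_dec tb; rewrite t0 => -[->].
by [].
Qed.

Lemma degsum_shift (U : zmodType) (g : mi -> U) k J :
  degsum J.+1 (fun t => if (0 < t k)%N then g (mi_dec k t) else 0) = degsum J g.
Proof.
rewrite /degsum big_mkcond [RHS]big_mkcond/=.
pose f1 t := if (mi_deg t <= J.+1)%N then
  if (0 < t k)%N then g (mi_dec k t) else 0 else 0.
pose f2 t := if (mi_deg t <= J)%N then g t else 0.
rewrite -/(f1 _) -[RHS]/(\sum_s f2 (box_mi s)).
pose l1 := [seq box_mi s | s <- index_enum {ffun 'I_d -> 'I_J.+2}].
pose l2 := [seq mi_inc k (box_mi s) | s <- index_enum {ffun 'I_d -> 'I_J.+1}].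
have -> : \sum_(s : {ffun 'I_d -> 'I_J.+1}) f2 (box_mi s) = \sum_(t <- l2) f1 t.
  rewrite big_map; apply: eq_bigr => s _; rewrite /f1 mi_deg_inc ltnS mi_incK.
  by rewrite ffunE eqxx addn1.
rewrite -(big_map (@box_mi d J.+1) xpredT f1); apply: eq_sum_support.
- by rewrite map_inj_uniq ?index_enum_uniq//; exact: box_mi_inj.
- rewrite map_inj_uniq ?index_enum_uniq// => s s' /mi_inc_inj; exact: box_mi_inj.
move=> t; rewrite /f1; case: ifP => [tJ|_]; last by rewrite eqxx.
case: ifP => [tk _|_]; last by rewrite eqxx.
have -> : t \in l1.
  have : t \in codom (@box_mi d J.+1).
    by rewrite mem_box; apply/forallP => i; exact: leq_trans (mi_deg_ge t i) tJ.
  by move=> /codomP[s ->]; apply/mapP; exists s; rewrite ?mem_index_enum.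
have : mi_dec k t \in codom (@box_mi d J).
  rewrite mem_box; apply/forallP => i; apply: leq_trans (mi_deg_ge _ i) _.
  by rewrite -ltnS mi_deg_dec.
move=> /codomP[s ts]; apply/esym/mapP; exists s; rewrite ?mem_index_enum//.
by rewrite -ts mi_decK.
Qed.

Lemma degsum_unit (U : zmodType) (x : U) J :
  degsum J (fun t : mi => if t == mi0 d then x else 0) = x.
Proof.
have e0 : box_mi [ffun=> ord0 : 'I_J.+1] = mi0 d.
  by apply/ffunP => i; rewrite !ffunE.
have d0 : mi_deg (mi0 d) = 0%N by apply/eqP; rewrite mi_deg_eq0.
rewrite /degsum (bigD1 [ffun=> ord0 : 'I_J.+1]); last by rewrite e0 d0.
rewrite big1 => [|s /andP[_ s0]]; first by rewrite e0 eqxx; exact: addr0.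
by rewrite -e0 (inj_eq (@box_mi_inj _ _)) (negbTE s0).
Qed.

Lemma degsumD (U : zmodType) (f g : mi -> U) J :
  degsum J (fun t => f t + g t) = degsum J f + degsum J g.
Proof. exact: big_split. Qed.

Lemma degsum_last (f : mi -> C) J t : (forall u, 0 <= f u) -> mi_deg t = J.+1 ->
  degsum J f + f t <= degsum J.+1 f.
Proof.
move=> f0 tJ; pose g u := if (mi_deg u <= J)%N then f u else 0.
have -> : degsum J f = \sum_(s : {ffun 'I_d -> 'I_J.+2}) g (box_mi s).
  rewrite /degsum big_mkcond/= -/(g _); apply: sum_box_support => u.
  rewrite /g; case: ifP => [uJ _ k|_]; last by rewrite eqxx.
  have := leq_trans (mi_deg_ge u k) uJ => h.
  by rewrite h leqW.
have : t \in codom (@box_mi d J.+1).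
  by rewrite mem_box; apply/forallP => i; rewrite -tJ mi_deg_ge.
move=> /codomP[s ts]; rewrite /degsum (bigD1 s)//=.
rewrite [leRHS](bigD1 s)/=; last by rewrite -ts tJ.
rewrite -ts /g tJ ltnn add0r addrC lerD2l [leRHS]big_mkcondl/=.
apply: ler_sum => s' _.
by case: ifP => [h|_]; [rewrite leqW|case: ifP].
Qed.

Hypothesis B_iso : B^t* *m B = 1%:M.

Lemma isometry_norm2 (x : 'I_M -> C) :
  \sum_a `|\sum_b B a b * x b| ^+ 2 = \sum_b `|x b| ^+ 2.
Proof.
pose v : 'cV[C]_M := \col_b x b.
have E (w : 'cV[C]_M) : (w^t* *m w) 0 0 = \sum_a `|w a 0| ^+ 2.
  by rewrite mxE; apply: eq_bigr => a _; rewrite trmxCE normCK mulrC.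
transitivity (((B *m v)^t* *m (B *m v)) 0 0).
  rewrite E; apply: eq_bigr => a _; rewrite mxE; congr (`|_| ^+ 2).
  by apply: eq_bigr => b _; rewrite mxE.
rewrite trmxC_mul mulmxA -(mulmxA (v^t*)) B_iso mulmx1 E.
by apply: eq_bigr => b _; rewrite mxE.
Qed.

Lemma resolvent_coef_norm2 t j : \sum_a `|resolvent_coef t a j| ^+ 2 =
  (if t == mi0 d then \sum_a `|V a j| ^+ 2 else 0) +
  \sum_b (if (0 < t (kap b))%N then
            `|resolvent_coef (mi_dec (kap b) t) b j| ^+ 2 else 0).
Proof.
under eq_bigr do rewrite resolvent_coefE.
case: eqP => [->|_].
  rewrite [X in _ + X]big1 ?addr0 => [|b _]; last by rewrite ffunE.
  by apply: eq_bigr => a _; rewrite mul1r big1 ?addr0// => b _; rewrite ffunE mulr0.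
under eq_bigr do rewrite mul0r add0r.
rewrite isometry_norm2 add0r; apply: eq_bigr => b _.
by case: ifP => // _; rewrite normr0 expr0n.
Qed.

(** The isometry [B] preserves the sum of squares over [b], and each component [b] is moved by one
    exponent shift, which carries the sum up to degree [J] into the one up to [J.+1]. *)
Lemma degsum_resolvent_norm2 J j :
  degsum J.+1 (fun t => \sum_a `|resolvent_coef t a j| ^+ 2) =
  \sum_a `|V a j| ^+ 2 + degsum J (fun t => \sum_a `|resolvent_coef t a j| ^+ 2).
Proof.
rewrite [in LHS](funext (fun t => resolvent_coef_norm2 t j)).
rewrite degsumD degsum_unit; congr (_ + _).
rewrite /degsum exchange_big/= [RHS]exchange_big/=; apply: eq_bigr => b _.
exact: (degsum_shift (fun t => `|resolvent_coef t b j| ^+ 2)).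
Qed.

(** Going from degree [J] to [J.+1] adds exactly the square norm of the column of [V], and the
    contribution of [t] is one of the nonnegative terms added. *)
Lemma resolvent_coef_bound t a j :
  `|resolvent_coef t a j| <= \sum_i `|V i j|.
Proof.
suff h : \sum_a `|resolvent_coef t a j| ^+ 2 <= \sum_i `|V i j| ^+ 2.
  have s0 : 0 <= \sum_i `|V i j| by exact: sumr_ge0.
  rewrite -ler_sqr ?nnegrE//; apply: (@le_trans _ _ (\sum_i `|V i j| ^+ 2)).
    apply: le_trans h; rewrite (bigD1 a)//= lerDl; apply: sumr_ge0 => i _.
    exact: exprn_ge0.
  rewrite [leRHS]expr2 mulr_suml; apply: ler_sum => i _; rewrite expr2 ler_wpM2l//.
  by rewrite (bigD1 i)//= lerDl sumr_ge0.
case tJ : (mi_deg t) => [|J].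
  have /eqP := tJ; rewrite mi_deg_eq0 => /eqP ->; rewrite resolvent_coef_norm2 eqxx.
  by rewrite [X in _ + X]big1 ?addr0// => b _; rewrite ffunE.
pose f u := \sum_a `|resolvent_coef u a j| ^+ 2.
have f0 u : 0 <= f u by apply: sumr_ge0 => i _; exact: exprn_ge0.
have := degsum_last f0 tJ; rewrite degsum_resolvent_norm2 addrC.
by rewrite lerD2r.
Qed.

End ResolventCoefficients.

(** * Resolvent series at commuting strict contractions *)

Section OperatorSeries.
Local Open Scope classical_set_scope.
Local Open Scope ring_scope.
Context {R : realType} {d : nat}.
Local Notation C := R[i].
Local Notation mi := {ffun 'I_d -> nat}.

Lemma geometric_small (c l e : R) : 0 <= l -> l < 1 -> 0 < e ->
  exists J : nat, c * l ^+ J < e.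
Proof.
move=> l0 l1 e0; have c0 : 0 < `|c| + 1 by rewrite ltr_wpDl.
have l1' : `|l| < 1 by rewrite ger0_norm.
have /cvgrPdist_lt/(_ _ (divr_gt0 e0 c0))/filter_ex[J] := cvg_expr l1'.
rewrite sub0r normrN ger0_norm ?exprn_ge0// ltr_pdivlMr// => lJ; exists J.
apply: le_lt_trans lJ; rewrite mulrC ler_wpM2l ?exprn_ge0//.
by apply: (le_trans (ler_norm _)); rewrite lerDl.
Qed.

Lemma eq0_of_geometric (V : normedModType C) (y : V) (c l : R) : 0 <= l -> l < 1 ->
  (forall J : nat, `|y| <= (c * l ^+ J)%:C%C) -> y = 0.
Proof.
move=> l0 l1 yJ; apply/eqP; rewrite -normr_le0; apply/ler_addgt0Pr => e e0.
rewrite add0r; have er : e = (Re e)%:C%C by rewrite RRe_real// gtr0_real.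
have [|J cJ] := geometric_small c l0 l1 (e := Re e); first by rewrite -(ltcR 0) -er.
by apply: (le_trans (yJ J)); rewrite er lecR ltW.
Qed.

Lemma abs_summable (V : completeNormedModType C) (f : mi -> V) (K r : R) :
    0 <= K -> 0 <= r -> r < 1 ->
    (forall t, `|f t| <= (K * r ^+ mi_deg t)%:C%C) ->
  exists L : V, summability.partial_sum f @ summability.totally --> L.
Proof.
move=> K0 r0 r1 fK.
(* Splits [r] as [l * l], one factor for the decay of the tail and one for summability. *)
pose l := Num.sqrt r.
have l0 : 0 <= l := sqrtr_ge0 r.
have l1 : l < 1 by rewrite -sqrtr1 ltr_sqrt.
have ll : l * l = r by rewrite -expr2 sqr_sqrtr.
have fK' t : `|f t| <= (K * (l * l) ^+ mi_deg t)%:C%C by rewrite ll.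
apply/cvg_ex; set G := nbhs _.
have FF : ProperFilter G by exact: fmap_proper_filter.
apply: (@cauchy_cvg V G FF); apply: (@cauchy_exP C V G _) => e e0.
have er : e = (Re e)%:C%C by rewrite RRe_real// gtr0_real.
have [|J cJ] := geometric_small (K * (1 - l)^-1 ^+ d) l0 l1 (e := Re e).
  by rewrite -(ltcR 0) -er.
exists (degsum J f).
apply: (@filterS _ (@summability.totally mi) _ _ _ _ (totally_deg J)) => A JA.
rewrite -ball_normE /ball_/= distrC.
apply: (le_lt_trans (partial_sum_tail K0 l0 (ltW l1) l0 l1 fK' JA)).
rewrite er ltcR; apply: le_lt_trans cJ; rewrite mulrAC ler_wpM2l//.
  by rewrite mulr_ge0// exprn_ge0// invr_ge0 subr_ge0 ltW.
by rewrite exprS ler_piMl ?exprn_ge0// ltW.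
Qed.

Lemma iter_comm (H : Type) (S T : H -> H) a b x : (forall y, S (T y) = T (S y)) ->
  iter a S (iter b T x) = iter b T (iter a S x).
Proof.
move=> ST; elim: a => //= a ->; elim: b => //= b IH.
by rewrite ST IH.
Qed.

Section Operators.
Context {H : completeNormedModType C} (T : 'I_d -> {linear H -> H}).
Hypothesis Tcomm : commuting_tuple T.

(** [op_power] composes in a fixed order; commutation brings the extra [T k] to the outside. *)
Lemma op_power_inc k (s : mi) x : op_power T (mi_inc k s) x = T k (op_power T s x).
Proof.
have E (l : seq 'I_d) : foldr (fun j => iter (mi_inc k s j) (T j)) x l =
    iter (count_mem k l) (T k) (foldr (fun j => iter (s j) (T j)) x l).
  elim: l => //= j l ->; rewrite ffunE; case: (eqVneq j k) => [->|_].
    by rewrite -!iterD; congr (iter _ _ _); lia.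
  by rewrite addn0 add0n; apply: iter_comm => y; exact: Tcomm.
by rewrite /op_power E count_uniq_mem ?enum_uniq// mem_enum.
Qed.

(** The maximum starts from 0 because a single ratio may be negative when [H] is trivial. *)
Lemma common_ratio : (forall k, strict_contraction (T k)) ->
  exists r : R, [/\ 0 <= r, r < 1 & forall k x, `|T k x| <= r%:C%C * `|x|].
Proof.
move=> /(_ _)/cid2 h; pose r k := s2val (h k).
exists (\big[Num.max/0]_k r k); split.
- exact: bigmax_ge_id.
- by apply: bigmax_lt => // k _; exact: (s2valP (h k)).
move=> k x; apply: (le_trans (s2valP' (h k) x)); rewrite ler_wpM2r// lecR.
exact: le_bigmax.
Qed.

Section Ratio.
Variable r : R.
Hypothesis r0 : 0 <= r.
Hypothesis r1 : r < 1.
Hypothesis Tr : forall k x, `|T k x| <= r%:C%C * `|x|.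

Lemma op_power_norm (t : mi) x : `|op_power T t x| <= (r ^+ mi_deg t)%:C%C * `|x|.
Proof.
rewrite /mi_deg -(big_enum _ _ xpredT)/= /op_power.
elim: (enum 'I_d) => [|k l IH] /=; first by rewrite big_nil mul1r.
rewrite big_cons exprD rmorphM -mulrA.
elim: (t k) => [|m IHm] /=; first by rewrite mul1r.
rewrite exprS rmorphM -mulrA; apply: (le_trans (Tr _ _)).
by rewrite ler_wpM2l// lecR.
Qed.

Context {M n : nat} (kap : 'I_M -> 'I_d) (B : 'M[C]_M) (V : 'M[C]_(M, n)).
Hypothesis B_iso : B^t* *m B = 1%:M.

Definition resolvent_term (h : 'I_n -> H) (a : 'I_M) (t : mi) : H :=
  \sum_j resolvent_coef kap B V t a j *: op_power T t (h j).

Lemma resolvent_termE h a t : resolvent_term h a t =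
  (if t == mi0 d then \sum_j V a j *: h j else 0) +
  \sum_b (if (0 < t (kap b))%N then
    B a b *: T (kap b) (resolvent_term h b (mi_dec (kap b) t)) else 0).
Proof.
rewrite /resolvent_term; under eq_bigr do rewrite resolvent_coefE scalerDl.
rewrite big_split/=; congr (_ + _).
  case: eqP => [->|_]; last by rewrite big1// => j _; rewrite mul0r scale0r.
  apply: eq_bigr => j _; rewrite mul1r; congr (_ *: _).
  rewrite /op_power; elim: (enum 'I_d) => //= k l ->.
  by rewrite ffunE.
under eq_bigr do rewrite scaler_suml; rewrite exchange_big/=.
apply: eq_bigr => b _; case: ifP => tb; last first.
  by rewrite big1// => j _; rewrite mulr0 scale0r.
rewrite linear_sum scaler_sumr; apply: eq_bigr => j _.
by rewrite linearZ/= scalerA -op_power_inc mi_decK.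
Qed.

Lemma degsum_resolvent h a J : degsum J.+1 (resolvent_term h a) =
  \sum_j V a j *: h j + \sum_b B a b *: T (kap b) (degsum J (resolvent_term h b)).
Proof.
rewrite (funext (resolvent_termE h a)) degsumD degsum_unit; congr (_ + _).
rewrite /degsum exchange_big/=; apply: eq_bigr => b _.
rewrite linear_sum scaler_sumr.
exact: (degsum_shift (fun t => B a b *: T (kap b) (resolvent_term h b t))).
Qed.

(** The truncations satisfy the fixed-point equation with a mismatch of one degree; both tails are
    of order [l ^ J], so the limit satisfies it exactly. *)
Theorem resolvent_series (h : 'I_n -> H) : exists X : 'I_M -> H,
  (forall a, summability.partial_sum (resolvent_term h a)
     @ summability.totally --> X a) /\
  (forall a, X a = \sum_j V a j *: h j + \sum_b B a b *: T (kap b) (X b)).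
Proof.
pose K : R := Re (\sum_j (\sum_i `|V i j|) * `|h j|).
have KE : K%:C%C = \sum_j (\sum_i `|V i j|) * `|h j|.
  rewrite RRe_real// ger0_real//; apply: sumr_ge0 => j _; apply: mulr_ge0 => //.
  exact: sumr_ge0.
have K0 : 0 <= K.
  rewrite -lecR rmorph0 KE; apply: sumr_ge0 => j _; apply: mulr_ge0 => //.
  exact: sumr_ge0.
have fK a t : `|resolvent_term h a t| <= (K * r ^+ mi_deg t)%:C%C.
  rewrite rmorphM/= KE mulr_suml; apply: (le_trans (ler_norm_sum _ _ _)).
  apply: ler_sum => j _; rewrite normrZ -mulrA; apply: ler_pM => //.
    exact: resolvent_coef_bound.
  by rewrite mulrC; exact: op_power_norm.
have /(_ _)/cid-/all_sig[X XL] := fun a => abs_summable K0 r0 r1 (fK a).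
exists X; split=> // a.
pose l := Num.sqrt r.
have l0 : 0 <= l := sqrtr_ge0 r.
have l1 : l < 1 by rewrite -sqrtr1 ltr_sqrt.
have ll : l * l = r by rewrite -expr2 sqr_sqrtr.
have fK' b t : `|resolvent_term h b t| <= (K * (l * l) ^+ mi_deg t)%:C%C by rewrite ll.
have tail b J := limit_tail K0 l0 (ltW l1) l0 l1 (fK' b) J (XL b).
pose c := K * (1 - l)^-1 ^+ d.
have c0 : 0 <= c by rewrite mulr_ge0// exprn_ge0// invr_ge0 subr_ge0 ltW.
have tail' b J : `|X b - degsum J (resolvent_term h b)| <= (c * l ^+ J)%:C%C.
  apply: (le_trans (tail b J)); rewrite lecR mulrAC ler_wpM2l//.
  by rewrite exprS ler_piMl ?exprn_ge0// ltW.
apply/eqP; rewrite -subr_eq0; apply/eqP.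
pose Bs : R := Re (\sum_b `|B a b|).
have BsE : Bs%:C%C = \sum_b `|B a b|.
  by rewrite RRe_real// ger0_real//; exact: sumr_ge0.
apply: (@eq0_of_geometric _ _ (c + Bs * c) l l0 l1) => J.
have -> : X a - (\sum_j V a j *: h j + \sum_b B a b *: T (kap b) (X b)) =
    (X a - degsum J.+1 (resolvent_term h a)) +
    \sum_b B a b *: T (kap b) (degsum J (resolvent_term h b) - X b).
  rewrite degsum_resolvent.
  under [X in _ = _ + X]eq_bigr do rewrite linearB scalerBr.
  rewrite sumrB !opprD -!addrA; congr (_ + (_ + _)).
  by rewrite addrA addNr add0r.
apply: (le_trans (ler_normD _ _)); rewrite mulrDl rmorphD/=; apply: lerD.
  apply: (le_trans (tail' a J.+1)); rewrite lecR ler_wpM2l//.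
  by rewrite exprS ler_piMl ?exprn_ge0// ltW.
rewrite -mulrA rmorphM/= BsE mulr_suml; apply: (le_trans (ler_norm_sum _ _ _)).
apply: ler_sum => b _; rewrite normrZ ler_wpM2l//; apply: (le_trans (Tr _ _)).
rewrite distrC; apply: (@le_trans _ _ (1 * `|X b - degsum J (resolvent_term h b)|)).
  by rewrite ler_wpM2r// -(rmorph1 (real_complex R)) lecR ltW.
by rewrite mul1r.
Qed.

End Ratio.
End Operators.
End OperatorSeries.

(** The scalars stand for the inner products of [X] and [U] in [realization_accretive], with
    [V h = X - U], and [b] for that of [beta h] with [h]. *)
Lemma skew_expansion (C : numClosedFieldType) (b xx xu ux uu : C) :
    xu^* = ux -> ux^* = xu -> xx^* = xx -> uu^* = uu -> b + b^* = 0 ->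
  b - (xx - xu - (ux - uu)) + 2 * (xx - xu) +
    (b - (xx - xu - (ux - uu)) + 2 * (xx - xu))^* = 2 * (xx - uu).
Proof.
move=> h1 h2 h3 h4 bb.
rewrite !(rmorphD, rmorphB, rmorphN, rmorphM, rmorph1)/= h1 h2 h3 h4.
by rewrite -[RHS]addr0 -bb; ring.
Qed.

(** * Matrices acting on tuples in a Hilbert space *)

Section HilbertTuples.
Context {R : realType} {H : completeNormedModType R[i]}.
Local Notation C := R[i].
Variable ip : {dot H for Num.conj}.

Lemma ipC x y : (ip x y)^* = ip y x.
Proof. by rewrite [RHS]hermC/= expr0 mul1r. Qed.

Lemma ipDl x y z : ip (x + y) z = ip x z + ip y z.
Proof. exact: linearDl. Qed.

Lemma ipZl (a : C) x z : ip (a *: x) z = a * ip x z.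
Proof. exact: linearZl_LR. Qed.

Lemma ipZr (a : C) x z : ip x (a *: z) = a^* * ip x z.
Proof. by rewrite -[LHS]ipC ipZl rmorphM/= ipC. Qed.

Lemma ipBl x y z : ip (x - y) z = ip x z - ip y z.
Proof. by rewrite -scaleN1r ipDl ipZl mulN1r. Qed.

Lemma ipBr x y z : ip x (y - z) = ip x y - ip x z.
Proof. by rewrite -[LHS]ipC ipBl rmorphB/= !ipC. Qed.

Lemma ip_suml (I : finType) (f : I -> H) z : ip (\sum_i f i) z = \sum_i ip (f i) z.
Proof.
elim: (index_enum I) => [|i r IH]; last by rewrite !big_cons ipDl IH.
by rewrite !big_nil -(scale0r (0 : H)) ipZl mul0r.
Qed.

Lemma ip_sumr (I : finType) (f : I -> H) z : ip z (\sum_i f i) = \sum_i ip z (f i).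
Proof. by rewrite -[LHS]ipC ip_suml rmorph_sum/=; apply: eq_bigr => i _; rewrite ipC. Qed.

Definition ip_tuple (I : finType) (x y : I -> H) : C := \sum_i ip (x i) (y i).

Definition mx_act (m n : nat) (A : 'M[C]_(m, n)) (x : 'I_n -> H) (a : 'I_m) : H :=
  \sum_b A a b *: x b.

Lemma ip_tupleC (I : finType) (x y : I -> H) : (ip_tuple x y)^* = ip_tuple y x.
Proof. by rewrite rmorph_sum/=; apply: eq_bigr => i _; rewrite ipC. Qed.

Lemma ip_tuple_adj (m n : nat) (A : 'M[C]_(m, n)) x y :
  ip_tuple (mx_act A x) y = ip_tuple x (mx_act (A^t*) y).
Proof.
rewrite /ip_tuple; under eq_bigr do rewrite ip_suml.
rewrite exchange_big/=; apply: eq_bigr => b _; rewrite ip_sumr.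
by apply: eq_bigr => a _; rewrite ipZl ipZr trmxCE conjCK.
Qed.

Lemma mx_act_mul (m n p : nat) (A : 'M[C]_(m, n)) (B : 'M[C]_(n, p)) x a :
  mx_act (A *m B) x a = mx_act A (mx_act B x) a.
Proof.
rewrite /mx_act; under eq_bigr do rewrite mxE scaler_suml.
rewrite exchange_big/=; apply: eq_bigr => b _; rewrite scaler_sumr.
by apply: eq_bigr => j _; rewrite scalerA.
Qed.

Lemma mx_act1 (n : nat) (x : 'I_n -> H) a : mx_act 1%:M x a = x a.
Proof.
rewrite /mx_act (bigD1 a)//= mxE eqxx scale1r big1 ?addr0// => b /negbTE ba.
by rewrite mxE eq_sym ba scale0r.
Qed.

Lemma ip_tuple_isometry (m n : nat) (A : 'M[C]_(m, n)) x : A^t* *m A = 1%:M ->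
  ip_tuple (mx_act A x) (mx_act A x) = ip_tuple x x.
Proof.
move=> AA; rewrite ip_tuple_adj; apply: eq_bigr => i _.
by rewrite -mx_act_mul AA mx_act1.
Qed.

Lemma ip_tuple_skew (n : nat) (A : 'M[C]_n) x : A + (A^t*) = 0 ->
  ip_tuple (mx_act A x) x + (ip_tuple (mx_act A x) x)^* = 0.
Proof.
move=> AA; rewrite ip_tupleC ip_tuple_adj -big_split/= big1// => i _.
rewrite addrC -ipC -[X in _ + X]ipC -rmorphD -ipDl -big_split/=.
rewrite big1 => [|b _]; first by rewrite -(scale0r (0 : H)) ipZl mul0r rmorph0.
have /matrixP/(_ i b) := AA; rewrite !mxE => AAib.
by rewrite -scalerDl AAib scale0r.
Qed.

Lemma realization_accretive (M n : nat) (B : 'M[C]_M) (V : 'M[C]_(M, n))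
    (beta : 'M[C]_n) (h A : 'I_n -> H) (X Y : 'I_M -> H) :
    hilbert_product ip -> B^t* *m B = 1%:M -> beta + (beta^t*) = 0 ->
    (forall a, X a = mx_act V h a + mx_act B Y a) ->
    (forall b, `|Y b| <= `|X b|) ->
    (forall i, A i = mx_act beta h i - mx_act (V^t*) (mx_act V h) i +
       2 *: mx_act (V^t*) X i) ->
  0 <= \sum_i ip (A i) (h i) + \sum_i ip (h i) (A i).
Proof.
move=> hilb BB skew XE YX AE.
set v := mx_act V h; set U := mx_act B Y.
(* Eliminating [V h] leaves only products of [X] and [U]; the cross terms cancel after adding the
   conjugate, and [U] has the norm of [Y]. *)
have vE a : v a = X a - U a by rewrite XE addrK.
have Vadj y : ip_tuple (mx_act (V^t*) y) h = ip_tuple y v.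
  by rewrite ip_tuple_adj trmxCK.
pose s := ip_tuple A h; have -> : \sum_i ip (h i) (A i) = s^* by rewrite ip_tupleC.
rewrite -/(ip_tuple A h) -/s.
have sE : s = ip_tuple (mx_act beta h) h - ip_tuple v v + 2 * ip_tuple X v.
  rewrite -!Vadj /s /ip_tuple -sumrN -big_split mulr_sumr -big_split/=.
  apply: eq_bigr => i _; by rewrite AE ipDl ipBl ipZl.
have Xv : ip_tuple X v = ip_tuple X X - ip_tuple X U.
  rewrite /ip_tuple -sumrN -big_split; apply: eq_bigr => a _ /=.
  by rewrite vE ipBr.
have vv : ip_tuple v v = ip_tuple X v - ip_tuple U v.
  rewrite /ip_tuple -sumrN -big_split; apply: eq_bigr => a _ /=.
  by rewrite {1}vE ipBl.
have Uv : ip_tuple U v = ip_tuple U X - ip_tuple U U.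
  rewrite /ip_tuple -sumrN -big_split; apply: eq_bigr => a _ /=.
  by rewrite vE ipBr.
have -> : s + s^* = 2 * (ip_tuple X X - ip_tuple U U).
  have := ip_tuple_skew h skew; move: sE; rewrite vv Uv Xv.
  move: (ip_tuple (mx_act beta h) h) => b -> bb.
  by apply: skew_expansion bb; rewrite ip_tupleC.
rewrite mulr_ge0 ?ler0n// subr_ge0 ip_tuple_isometry//.
by apply: ler_sum => b _; rewrite -!hilb lerXn2r ?nnegrE.
Qed.

End HilbertTuples.

Section PartialSums.
Local Open Scope classical_set_scope.
Local Open Scope ring_scope.
Context {R : realType} {d : nat}.
Local Notation C := R[i].
Local Notation mi := {ffun 'I_d -> nat}.

Lemma cvg_sum_fin (T : Type) (F : set_system T) (FF : Filter F)
    (V : normedModType C) (I : finType) (f : I -> T -> V) (l : I -> V) :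
  (forall i, f i @ F --> l i) -> (fun x => \sum_i f i x) @ F --> \sum_i l i.
Proof.
move=> fl; elim: (index_enum I) => [|i r IH].
  by under eq_fun do rewrite big_nil; rewrite big_nil; exact: cvg_cst.
by under eq_fun do rewrite big_cons; rewrite big_cons; exact: (cvgD (fl i) IH).
Qed.

Lemma partial_sum_combination (V : normedModType C) (I : finType) (y : V)
    (g : I -> mi -> V) (la : I -> C) (X : I -> V) :
    (forall a, summability.partial_sum (g a) @ summability.totally --> X a) ->
  summability.partial_sum (fun t : mi => (if t == mi0 d then y else 0) +
    \sum_a la a *: g a t) @ summability.totally --> y + \sum_a la a *: X a.
Proof.
move=> gX; set f := fun t : mi => _.
have h : (fun A => y + \sum_a la a *: summability.partial_sum (g a) A)
    @ @summability.totally mi --> y + \sum_a la a *: X a.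
  apply: cvgD; first exact: cvg_cst.
  by apply: cvg_sum_fin => a; exact: cvgZr.
apply: cvg_trans h; apply: near_eq_cvg.
apply: filterS (totally_deg 0%N) => A A0.
have m0 : mi0 d \in A by apply: A0; rewrite leqn0 mi_deg_eq0.
rewrite partial_sumE big_split/=; congr (_ + _).
  rewrite -big_mkcond/= (big_rem _ m0)/= eqxx big1_seq ?addr0// => t /andP[/eqP-> ].
  by rewrite mem_rem_uniq ?fset_uniq// inE eqxx.
rewrite exchange_big/=; apply: eq_bigr => a _.
by rewrite partial_sumE scaler_sumr.
Qed.

End PartialSums.

Section Realization.
Local Open Scope classical_set_scope.
Local Open Scope ring_scope.
Context {R : realType} {d n : nat}.
Local Notation C := R[i].
Local Notation mi := {ffun 'I_d -> nat}.
Variables (m : 'I_d -> nat) (W : 'M[C]_(\sum_k m k)) (beta : 'M[C]_n)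
  (V : 'M[C]_(\sum_k m k, n)).
Hypothesis W_unitary : W \is unitarymx.
Hypothesis beta_skew : beta + (beta^t*) = 0.

Local Notation M := (\sum_k m k)%N.
Local Notation kap := (fun b : 'I_M => tagnat.sig1 b).

(** From [W + P = 2 W - (W - P)]: the realization equals [beta - V^* V + 2 V^* (1 - W^* P)^-1 V],
    and [resolvent_coef] expands the last two factors. *)
Definition realization_coef (t : mi) : 'M[C]_n :=
  (t == mi0 d)%:R *: (beta - (V^t*) *m V) +
  2 *: ((V^t*) *m resolvent_coef kap (W^t*) V t).

Let B_iso : (W^t*)^t* *m (W^t*) = 1%:M.
Proof. by rewrite trmxCK; exact/unitarymxP. Qed.

Lemma realization_term (H : completeNormedModType C) (T : 'I_d -> {linear H -> H})
    (h : 'I_n -> H) i (t : mi) :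
  \sum_j realization_coef t i j *: op_power T t (h j) =
  (if t == mi0 d then mx_act (beta - (V^t*) *m V) h i else 0) +
  \sum_a (2 * (V^t*) i a) *: resolvent_term T kap (W^t*) V h a t.
Proof.
have E j : realization_coef t i j = (t == mi0 d)%:R * (beta - (V^t*) *m V) i j +
    \sum_a (2 * (V^t*) i a) * resolvent_coef kap (W^t*) V t a j.
  rewrite /realization_coef mxE; congr (_ + _); first by rewrite mxE.
  by rewrite mxE mxE mulr_sumr; apply: eq_bigr => a _; rewrite mulrA.
rewrite (eq_bigr _ (fun j _ => congr1 (fun x => x *: _) (E j))).
under eq_bigr do rewrite scalerDl.
rewrite big_split/=; congr (_ + _).
  case: eqP => [->|_]; last by rewrite big1// => j _; rewrite mul0r scale0r.
  apply: eq_bigr => j _; rewrite mul1r; congr (_ *: _).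
  rewrite /op_power; elim: (enum 'I_d) => //= k l ->.
  by rewrite ffunE.
under eq_bigr do rewrite scaler_suml.
rewrite exchange_big/=; apply: eq_bigr => a _; rewrite scaler_sumr.
by apply: eq_bigr => j _; rewrite scalerA.
Qed.

Lemma realization_op_accretive (H : completeNormedModType C)
    (ip : {dot H for Num.conj}) (T : 'I_d -> {linear H -> H}) :
    hilbert_product ip -> commuting_tuple T ->
    (forall k, strict_contraction (T k)) ->
  op_accretive ip (op_eval realization_coef T).
Proof.
move=> hilb Tcomm /common_ratio[r [r0 r1 Tr]] h.
have [X [XL XE]] := resolvent_series Tcomm r0 r1 Tr kap V B_iso h.
apply: (@realization_accretive R H ip M n (W^t*) V beta h _ X
  (fun b => T (kap b) (X b)) hilb B_iso beta_skew XE).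
  move=> b; apply: (le_trans (Tr _ _)).
  by rewrite ler_piMl// -(rmorph1 (real_complex R)) lecR ltW.
move=> i; rewrite /op_eval (funext (realization_term T h i)) /summability.sum.
have := @partial_sum_combination R d H _ (mx_act (beta - (V^t*) *m V) h i) _
  (fun a => 2 * (V^t*) i a) _ XL.
move=> /(cvg_lim (@norm_hausdorff _ _)) ->.
rewrite /mx_act; congr (_ + _).
  rewrite -/(mx_act (V^t*) _ i) -(mx_act_mul (V^t*) V) -sumrB.
  by apply: eq_bigr => j _; rewrite -scalerBl !mxE.
by rewrite scaler_sumr; apply: eq_bigr => a _; rewrite scalerA.
Qed.

End Realization.

(** * The realization function *)

Section ResolventIdentities.
Context {C : numClosedFieldType} {M n : nat}.
Variables (W P : 'M[C]_M) (beta : 'M[C]_n) (V : 'M[C]_(M, n)).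
Hypothesis W_unitary : W \is unitarymx.
Hypothesis WP_unit : W - P \in unitmx.

Lemma resolvent_fixpoint p (X Y : 'M[C]_(M, p)) :
  X = Y + W^t* *m P *m X <-> X = invmx (W - P) *m W *m Y.
Proof.
have WW : W *m W^t* = 1%:M by exact/unitarymxP.
have WW' : W^t* *m W = 1%:M by exact: (mulmx1C WW).
split=> [XE|XE].
  have h : (W - P) *m X = W *m Y.
    by rewrite mulmxBl {1}XE mulmxDr !mulmxA WW mul1mx addrK.
  by rewrite -mulmxA -h mulmxA mulVmx// mul1mx.
have h : (W - P) *m X = W *m Y by rewrite XE !mulmxA mulmxV// mul1mx.
have /(congr1 (mulmx (W^t*))) := h; rewrite !mulmxA WW' mul1mx => <-.
by rewrite mulmxBr mulmxBl WW' mul1mx subrK.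
Qed.

Lemma realization_formula :
  beta + V^t* *m invmx (W - P) *m (W + P) *m V =
  beta - V^t* *m V + 2 *: (V^t* *m (invmx (W - P) *m W *m V)).
Proof.
have -> : W + P = 2 *: W - (W - P).
  by rewrite scaler_nat mulr2n opprB addrA addrAC addrK.
rewrite mulmxBr mulmxBl -(mulmxA (V^t*) (invmx _) (W - P)) mulVmx// mulmx1.
by rewrite -addrA; congr (_ + _); rewrite addrC -scalemxAr -scalemxAl !mulmxA.
Qed.

(** Substituting [V = X - U] with [U = W^* P X] cancels the cross terms, and [U] has the same Gram
    matrix as [P X]. *)
Lemma realization_defect (X : 'M[C]_(M, n)) : beta + beta^t* = 0 ->
    X = invmx (W - P) *m W *m V ->
  (beta - V^t* *m V + 2 *: (V^t* *m X)) + (beta - V^t* *m V + 2 *: (V^t* *m X))^t* =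
  2 *: (X^t* *m X - (P *m X)^t* *m (P *m X)).
Proof.
move=> skew /resolvent_fixpoint; set U := _ *m X => XE.
have VE : V = X - U by rewrite {1}XE addrK.
have UU : U^t* *m U = (P *m X)^t* *m (P *m X).
  rewrite /U -mulmxA trmxC_mul trmxCK -mulmxA (mulmxA W).
  by rewrite (unitarymxP W_unitary) mul1mx.
clearbody U; rewrite -UU trmxCD trmxCB trmxCZ !trmxC_mul trmxCK conjC_nat VE trmxCB.
rewrite !mulmxBl !mulmxBr.
have {skew} := congr1 (fun A : 'M[C]_n => - A) skew; rewrite oppr0 => skew.
rewrite -[LHS]addr0 -skew.
move: (X^t* *m X) (X^t* *m U) (U^t* *m X) (U^t* *m U) (beta^t*) => a b c e b'.
by apply/matrixP => i j; rewrite !mxE; ring.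
Qed.

End ResolventIdentities.

(** * Differentiability of rational functions *)

Section Differentiability.
Local Open Scope classical_set_scope.
Local Open Scope ring_scope.
Context {K : numFieldType}.

Lemma differentiable_sum_seq (V W : normedModType K) (I : Type) (r : seq I)
    (f : I -> V -> W) (z : V) : (forall i, differentiable (f i) z) ->
  differentiable (fun z => \sum_(i <- r) f i z) z.
Proof.
move=> fd; elim: r => [|i r IH].
  by under eq_fun do rewrite big_nil; exact: differentiable_cst.
by under eq_fun do rewrite big_cons; exact: differentiableD.
Qed.

Lemma differentiable_prod_seq (V : normedModType K) (I : Type) (r : seq I)
    (f : I -> V -> K) (z : V) : (forall i, differentiable (f i) z) ->
  differentiable (fun z => \prod_(i <- r) f i z) z.
Proof.
move=> fd; elim: r => [|i r IH].
  by under eq_fun do rewrite big_nil; exact: differentiable_cst.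
by under eq_fun do rewrite big_cons; exact: differentiableM.
Qed.

Lemma differentiable_pow (V : normedModType K) (f : V -> K) z m :
  differentiable f z -> differentiable (fun z => f z ^+ m) z.
Proof.
move=> fd; elim: m => [|m IHm]; first exact: differentiable_cst.
by under eq_fun do rewrite exprS; exact: differentiableM.
Qed.

Lemma near_eq_differentiable (V W : normedModType K) (f g : V -> W) (x : V) :
    (\forall y \near x, f y = g y) -> differentiable f x -> differentiable g x.
Proof.
move=> fg /diff_locallyP[dfc fo].
have go : g \o shift x = cst (g x) + 'd f x +o_ 0 id.
  apply/eqaddoP => e e0; have /eqaddoP/(_ e e0) := fo.
  have fg0 : \forall h \near 0, f (h + x) = g (h + x).
    by move: fg; rewrite (near_shift 0) subr0.
  move=> fo'; near=> h.
  rewrite -(nbhs_singleton fg).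
  have -> : (g \o shift x - (cst (f x) + 'd f x)) h =
      (f \o shift x - (cst (f x) + 'd f x)) h.
    by rewrite /=; congr (_ - _); apply/esym; near: h.
  by near: h.
by apply/diff_locallyP; rewrite (diff_unique dfc go).
Unshelve. all: by end_near. Qed.

Lemma meval_differentiable d (p : mpoly.mpoly d K) (z : 'rV[K]_d) :
  differentiable (fun z : 'rV[K]_d => mpoly.meval (z 0) p) z.
Proof.
under eq_fun do rewrite mpoly.mevalE.
apply: differentiable_sum_seq => u; apply: differentiableM.
  exact: differentiable_cst.
apply: differentiable_prod_seq => k; apply: differentiable_pow.
exact: differentiable_coord.
Qed.

Lemma differentiable_mx (V : normedModType K) m n (F : V -> 'M[K]_(m, n)) z :
  (forall i j, differentiable (fun z => F z i j) z) -> differentiable F z.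
Proof.
move=> Fd; rewrite (_ : F = fun z => \sum_i \sum_j F z i j *: delta_mx i j).
  apply: differentiable_sum_seq => i; apply: differentiable_sum_seq => j.
  exact: differentiableZl.
by apply/funext => y; rewrite -matrix_sum_delta.
Qed.

Lemma rational_differentiable d (p q : mpoly.mpoly d K) (z : 'rV[K]_d) :
    mpoly.meval (z 0) q != 0 ->
  differentiable (fun z : 'rV[K]_d => mpoly.meval (z 0) p / mpoly.meval (z 0) q) z.
Proof.
move=> q0; apply: differentiableM; first exact: meval_differentiable.
by apply: differentiableV => //; exact: meval_differentiable.
Qed.

Lemma cvg_mx (T : Type) (G : set_system T) (FG : Filter G) m n
    (f : T -> 'M[K]_(m, n)) (L : 'M[K]_(m, n)) :
  (forall i j, (fun x => f x i j) @ G --> L i j) -> f @ G --> L.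
Proof.
move=> fL; apply/cvg_ballP => e e0.
have h i : \forall x \near G, forall j, ball (L i j) e (f x i j).
  by apply: filter_forall => j; have /cvg_ballP/(_ _ e0) := fL i j.
have hh : \forall x \near G, forall i j, ball (L i j) e (f x i j).
  exact: filter_forall.
by apply: (@filterS T G FG _ _ _ hh) => x Lx; split.
Qed.

End Differentiability.

Section Holomorphic.
Context {R : realType} {d : nat}.
Local Notation C := R[i].

Lemma polydisc_open (z : 'rV[C]_d) : polydisc z -> \forall y \near z, polydisc y.
Proof.
move=> zD.
have h k : \forall y \near z, `|(y : 'rV[C]_d) 0 k| < 1.
  have e0 : 0 < 1 - `|z 0 k| by rewrite subr_gt0.
  have /cvgrPdist_lt/(_ _ e0) := @coord_continuous C 1 d 0 k z.
  apply: filterS => y yz; rewrite -[y 0 k](subrK (z 0 k)).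
  apply: (le_lt_trans (ler_normD _ _)).
  by rewrite -(subrK `|z 0 k| 1) ltrD2r distrC.
exact: (@filter_forall _ _ (fun k (y : 'rV[C]_d) => `|y 0 k| < 1) (nbhs z) _ h).
Qed.

Lemma rational_holomorphic m n (F : 'rV[C]_d -> 'M[C]_(m, n)) :
    (forall i j, exists p q : mpoly.mpoly d C, forall z, polydisc z ->
      mpoly.meval (z 0) q != 0 /\
      F z i j = mpoly.meval (z 0) p / mpoly.meval (z 0) q) ->
  holomorphic_on_polydisc F.
Proof.
move=> Fr z zD; apply: (@differentiable_mx C) => i j.
have [p [q pq]] := Fr i j.
have q0 : mpoly.meval (z 0) q != 0 by have [] := pq z zD.
have := @rational_differentiable C d p q z q0.
apply: near_eq_differentiable; apply: filterS (polydisc_open zD) => y yD.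
by have [_ ->] := pq y yD.
Qed.

End Holomorphic.

Lemma quad_gram_sub (C : numClosedFieldType) M n (X Y : 'M[C]_(M, n)) (v : 'cV[C]_n) :
  (v^t* *m ((X^t*) *m X - (Y^t*) *m Y) *m v) 0 0 =
  ((X *m v)^t* *m (X *m v)) 0 0 - ((Y *m v)^t* *m (Y *m v)) 0 0.
Proof.
have -> : v^t* *m ((X^t*) *m X - (Y^t*) *m Y) *m v =
    (X *m v)^t* *m (X *m v) - (Y *m v)^t* *m (Y *m v).
  by rewrite mulmxBr mulmxBl !trmxC_mul !mulmxA.
by rewrite mxE; congr (_ + _); rewrite mxE.
Qed.

Section RealizationFunction.
Local Open Scope classical_set_scope.
Local Open Scope ring_scope.
Context {R : realType} {d n : nat}.
Local Notation C := R[i].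
Local Notation mi := {ffun 'I_d -> nat}.
Variables (m : 'I_d -> nat) (W : 'M[C]_(\sum_k m k)) (beta : 'M[C]_n)
  (V : 'M[C]_(\sum_k m k, n)).
Hypothesis W_unitary : W \is unitarymx.
Hypothesis beta_skew : beta + (beta^t*) = 0.

Local Notation M := (\sum_k m k)%N.
Local Notation P := (@diag_blocks R d m).

Definition realization (z : 'rV[C]_d) : 'M[C]_n :=
  beta + (V^t*) *m invmx (W - P z) *m (W + P z) *m V.

(** Cramer's rule with polynomial entries. One denominator serves all entries, and the formula holds
    wherever the determinant is nonzero, boundary points included. *)
Lemma mpoly_pencil : exists q : mpoly.mpoly d C, forall z : 'rV[C]_d,
  mpoly.meval (z 0) q = \det (W - P z) /\
  forall i j, exists p : mpoly.mpoly d C, forall z : 'rV[C]_d,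
    \det (W - P z) != 0 ->
    realization z i j = mpoly.meval (z 0) p / mpoly.meval (z 0) q.
Proof.
pose cm k l (A : 'M[C]_(k, l)) := map_mx (@mpoly.mpolyC d C) A.
pose Pm : 'M[mpoly.mpoly d C]_M :=
  diag_mx (\row_i mpoly.mpolyX C (mpoly.mnm1 (tagnat.sig1 i))).
pose A := cm _ _ W - Pm.
pose ev (z : 'rV[C]_d) : {rmorphism mpoly.mpoly d C -> C} := mpoly.meval (z 0).
have evc z k l (X : 'M[C]_(k, l)) : map_mx (ev z) (cm _ _ X) = X.
  by apply/matrixP => i j; rewrite mxE mxE; exact: mpoly.mevalC.
have evP z : map_mx (ev z) Pm = P z.
  rewrite diag_blocksE map_diag_mx; congr diag_mx; apply/rowP => i.
  by rewrite mxE mxE [RHS]mxE; exact: mpoly.mevalXU.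
have evA z : map_mx (ev z) A = W - P z by rewrite map_mxB evc evP.
have evd z : ev z (\det A) = \det (W - P z) by rewrite -det_map_mx evA.
exists (\det A) => z0; split=> [|i j]; first exact: evd.
exists (mpoly.mpolyC d (beta i j) * \det A +
  (cm _ _ (V^t*) *m \adj A *m (cm _ _ W + Pm) *m cm _ _ V) i j) => z dz.
rewrite -[mpoly.meval (z 0) (\det A)]/(ev z (\det A)) evd.
rewrite -[mpoly.meval (z 0) _]/(ev z _) rmorphD rmorphM evd.
have -> : ev z (mpoly.mpolyC d (beta i j)) = beta i j by exact: mpoly.mevalC.
have -> (X : 'M[mpoly.mpoly d C]_n) : ev z (X i j) = map_mx (ev z) X i j by rewrite mxE.
rewrite !map_mxM map_mxD map_mx_adj !evc evP evA.
rewrite mulrDl mulfK// /realization mxE; congr (_ + _).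
have u : W - P z \in unitmx by rewrite unitmxE unitfE.
rewrite /invmx u -scalemxAr -!scalemxAl mxE mulrC; congr (_ * _).
Qed.

Lemma pencil_det_neq0 z : polydisc z -> \det (W - P z) != 0.
Proof. by move=> zD; rewrite -unitfE -unitmxE unitary_sub_diag_unit. Qed.

Lemma realization_rational : rational_on_polydisc realization.
Proof.
have [q qP] := mpoly_pencil => i j; have [p pP] := (qP 0).2 i j.
exists p, q => z zD; have [qz _] := qP z.
by rewrite pP ?pencil_det_neq0// qz pencil_det_neq0.
Qed.

Let state (z : 'rV[C]_d) := invmx (W - P z) *m W *m V.

Lemma realization_herm z : W - P z \in unitmx ->
  realization z + (realization z)^t* =
  2 *: ((state z)^t* *m state z - (P z *m state z)^t* *m (P z *m state z)).
Proof.
move=> u; rewrite /realization realization_formula//.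
exact: (@realization_defect C M n W (P z) beta V W_unitary u (state z) beta_skew erefl).
Qed.

Lemma diag_blocks_mulE z p (y : 'M[C]_(M, p)) a j :
  (P z *m y) a j = z 0 (tagnat.sig1 a) * y a j.
Proof. by rewrite diag_blocksE mul_diag_mx !mxE. Qed.

Lemma realization_psd z : polydisc z -> psdmx (realization z + (realization z)^t*).
Proof.
move=> zD v; rewrite realization_herm; last exact: unitary_sub_diag_unit.
have E (y : 'cV[C]_M) : (y^t* *m y) 0 0 = \sum_a `|y a 0| ^+ 2.
  by rewrite mxE; apply: eq_bigr => a _; rewrite trmxCE normCK mulrC.
set X := state z.
have -> : (v^t* *m (2 *: (X^t* *m X - (P z *m X)^t* *m (P z *m X))) *m v) 0 0 =
    2 * (\sum_a `|(X *m v) a 0| ^+ 2 - \sum_a `|(P z *m (X *m v)) a 0| ^+ 2).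
  rewrite -!E -scalemxAr -scalemxAl mxE; congr (_ * _).
  by rewrite (mulmxA (P z) X v); exact: (@quad_gram_sub C M n X (P z *m X) v).
rewrite mulr_ge0 ?ler0n// subr_ge0; apply: ler_sum => a _.
rewrite diag_blocks_mulE normrM exprMn ler_piMl ?exprn_ge0//.
by rewrite exprn_ile1// ltW.
Qed.

Lemma realization_torus (t : 'rV[C]_d) : (forall k, `|t 0 k| = 1) ->
  W - P t \in unitmx -> realization t + (realization t)^t* = 0.
Proof.
move=> t1 u; rewrite realization_herm// (_ : _ *m (P t *m _) = (state t)^t* *m state t).
  by rewrite subrr scaler0.
apply/matrixP => i j; rewrite !mxE; apply: eq_bigr => a _.
rewrite !trmxCE !diag_blocks_mulE rmorphM/= mulrACA.
by rewrite (mulrC (t _ _)^*) -normCK t1 expr1n mul1r.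
Qed.

Lemma realization_boundary (F : 'rV[C]_d -> 'M[C]_n) (t : 'rV[C]_d) :
    (forall z, polydisc z -> F z = realization z) -> \det (W - P t) != 0 ->
  nontangential_limit F t (realization t).
Proof.
move=> FE dt a _; apply: (@cvg_mx C _ _ _) => i j.
have [q qP] := mpoly_pencil; have [p pP] := (qP 0).2 i j.
have qt : mpoly.meval (t 0) q != 0 by rewrite (qP t).1.
have := differentiable_continuous (@rational_differentiable C d p q t qt).
rewrite (pP t dt) => pq.
have h : (fun z : 'rV[C]_d => mpoly.meval (z 0) p / mpoly.meval (z 0) q)
    @ within (nontangential_region t a) (nbhs t) --> mpoly.meval (t 0) p / mpoly.meval (t 0) q.
  move=> U /pq qU.
  by apply: (@filterS _ (nbhs t) _ _ _ _ qU) => z fz _.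
apply: cvg_trans h; apply: near_eq_cvg.
apply: filterS (withinT _ _) => z [zD _].
by rewrite (FE z zD) (pP z (pencil_det_neq0 zD)).
Qed.

Lemma realization_taylor (F : 'rV[C]_d -> 'M[C]_n) :
    (forall z, polydisc z -> F z = realization z) ->
  taylor_coefficients F (realization_coef W beta V).
Proof.
move=> FE z zD; rewrite FE//.
(* The scalars [z_k] are commuting strict contractions on a one-dimensional space, so the operator
   series already gives the Taylor expansion. *)
pose T k : {linear ell2 R 1 -> ell2 R 1} := ell2_op ((z 0 k)%:M : 'M[C]_1).
have TE k (x : ell2 R 1) : T k x = z 0 k *: x by rewrite /T /= /ell2_op mul_mx_scalar.
have Tcomm : commuting_tuple T.
  by move=> j k x; rewrite !TE !scalerA mulrC.
have Tcon k : strict_contraction (T k).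
  exists (Re `|z 0 k|) => [|x]; last by rewrite TE normrZ RRe_real// ger0_real.
  by rewrite -ltcR RRe_real ?ger0_real// rmorph1 zD.
have powE (t : mi) (x : ell2 R 1) : op_power T t x = zmon z t *: x.
  rewrite /op_power /zmon -(big_enum _ _ xpredT)/=.
  elim: (enum 'I_d) => [|k l IH] /=; first by rewrite big_nil scale1r.
  rewrite big_cons IH; elim: (t k) => [|e IHe] /=; first by rewrite mul1r.
  by rewrite IHe TE scalerA mulrA -exprS.
have [r [r0 r1 Tr]] := common_ratio Tcon.
have B_iso : (W^t*)^t* *m (W^t*) = 1%:M by rewrite trmxCK; exact/unitarymxP.
pose one : ell2 R 1 := const_mx 1.
pose h (j i : 'I_n) : ell2 R 1 := (i == j)%:R *: one.
have hX j := resolvent_series Tcomm r0 r1 Tr (fun b : 'I_M => tagnat.sig1 b) V B_iso (h j).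
have {hX} /(_ _)/cid-/all_sig[X XP] := hX.
pose x : 'M[C]_(M, n) := \matrix_(a, j) (X j a : 'rV[C]_1) 0 0.
have oneE : (one : 'rV[C]_1) 0 0 = 1 by rewrite mxE.
have hE k j (A : 'M[C]_(k, n)) i : (\sum_i' A i i' *: h j i' : ell2 R 1) = A i j *: one.
  rewrite (bigD1 j)//= /h eqxx scale1r big1 ?addr0// => i' /negbTE ->.
  by rewrite scale0r scaler0.
have ell2D (u v : ell2 R 1) : ((u + v : ell2 R 1) : 'rV[C]_1) 0 0 =
    (u : 'rV[C]_1) 0 0 + (v : 'rV[C]_1) 0 0 by rewrite mxE.
have ell2Z (c : C) (v : ell2 R 1) : ((c *: v : ell2 R 1) : 'rV[C]_1) 0 0 =
    c * (v : 'rV[C]_1) 0 0 by rewrite mxE.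
have ell2S (I : finType) (f : I -> ell2 R 1) : ((\sum_a f a : ell2 R 1) : 'rV[C]_1) 0 0 =
    \sum_a (f a : 'rV[C]_1) 0 0 by rewrite summxE.
have xE : x = V + (W^t*) *m P z *m x.
  apply/matrixP => a j; rewrite [LHS]mxE [RHS]mxE (XP j).2 ell2D hE ell2Z oneE mulr1.
  congr (_ + _); rewrite ell2S -mulmxA mxE; apply: eq_bigr => b _.
  by rewrite diag_blocks_mulE TE ell2Z ell2Z; congr (_ * (_ * _)); rewrite [RHS]mxE.
have u : W - P z \in unitmx by exact: unitary_sub_diag_unit.
have xS : x = state z by apply/(resolvent_fixpoint W_unitary u).
rewrite /realization realization_formula// -/(state z) -xS.
apply: (@cvg_mx C _ _ _) => i j.
have termE t : \sum_i' realization_coef W beta V t i i' *: op_power T t (h j i') =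
    (zmon z t * realization_coef W beta V t i j) *: one.
  under eq_bigr do rewrite powE scalerA mulrC -scalerA.
  by rewrite -scaler_sumr hE scalerA.
have := @partial_sum_combination R d (ell2 R 1) _
  (mx_act (beta - (V^t*) *m V) (h j) i) _ (fun a => 2 * (V^t*) i a) _ (XP j).1.
rewrite -(funext (realization_term W beta V T (h j) i)) (funext termE).
set S := summability.partial_sum _; set L := _ + _ => SL.
have LE : (beta - V^t* *m V + 2 *: (V^t* *m x)) i j = (L : 'rV[C]_1) 0 0.
  rewrite mxE /L ell2D /mx_act hE ell2Z oneE mulr1; congr (_ + _).
  rewrite mxE mxE mulr_sumr ell2S; apply: eq_bigr => a _.
  by rewrite ell2Z [x a j]mxE mulrA.
rewrite LE; apply/cvgrPdist_lt => e e0.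
have /cvgrPdist_lt/(_ e e0) := SL; apply: filterS => A SA.
have SE : (S A : 'rV[C]_1) 0 0 = (summability.partial_sum (fun t : mi =>
    (\prod_k z 0 k ^+ t k) *: realization_coef W beta V t) A) i j.
  rewrite /S !partial_sumE !summxE; apply: eq_bigr => t _.
  by rewrite ell2Z oneE mulr1 [RHS]mxE.
rewrite -SE; apply: le_lt_trans SA.
apply: le_trans (ell2_coord_le (L - S A) 0).
suff -> : ((L - S A : ell2 R 1) : 'rV[C]_1) 0 0 =
    (L : 'rV[C]_1) 0 0 - (S A : 'rV[C]_1) 0 0 by [].
by rewrite ell2D; congr (_ + _); rewrite [LHS]mxE.
Qed.

End RealizationFunction.

(** * Zeros on the torus *)

(** Lagrange interpolation recovers a polynomial of low degree; at the origin it shows that a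
    polynomial small at enough nodes is small there too. *)
Lemma lagrange_at0 (K : fieldType) (I : finType) (x : I -> K) (J : {set I})
    (p : {poly K}) : injective x -> (size p <= #|J|)%N ->
  p.[0] = \sum_(j in J) p.[x j] * \prod_(i in J :\ j) (- x i / (x j - x i)).
Proof.
move=> xinj pJ.
pose l j : {poly K} := (\prod_(i in J :\ j) (x j - x i))^-1 *:
  \prod_(i in J :\ j) ('X - (x i)%:P).
have lE j y : (l j).[y] = \prod_(i in J :\ j) ((y - x i) / (x j - x i)).
  rewrite hornerZ horner_prod mulrC -prodfV -big_split/=.
  by apply: eq_bigr => i _; rewrite hornerXsubC.
have lsize j : j \in J -> (size (l j) <= #|J|)%N.
  move=> jJ; apply: (leq_trans (size_scale_leq _ _)).
  by rewrite -big_enum/= size_prod_XsubC -cardE (cardsD1 j J) jJ.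
pose r := p - \sum_(j in J) p.[x j] *: l j.
suff r0 : r = 0.
  have /eqP := r0; rewrite subr_eq0 => /eqP {1}->; rewrite horner_sum.
  apply: eq_bigr => j _; rewrite hornerZ lE; congr (_ * _).
  by apply: eq_bigr => i _; rewrite sub0r.
have rsize : (size r <= #|J|)%N.
  apply: (leq_trans (size_polyD _ _)); rewrite geq_max pJ size_polyN.
  apply: (leq_trans (size_sum _ _ _)); apply/bigmax_leqP => j jJ.
  by apply: (leq_trans (size_scale_leq _ _)); exact: lsize.
apply: (@roots_geq_poly_eq0 _ r [seq x j | j <- enum J]).
- apply/allP => y /mapP[k]; rewrite mem_enum => kJ ->.
  rewrite /root hornerD hornerN horner_sum (bigD1 k)//= hornerZ lE.
  rewrite [X in p.[_] * X]big1 ?mulr1; last first.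
    move=> i; rewrite !inE => /andP[ik _]; rewrite divff// subr_eq0.
    by apply: contra ik => /eqP/xinj ->.
  rewrite big1 ?addr0 ?subrr// => j /andP[jJ jk].
  rewrite hornerZ lE (bigD1 k)/=; last by rewrite !inE kJ eq_sym jk.
  by rewrite subrr mul0r mul0r mulr0.
- by rewrite map_inj_uniq ?enum_uniq.
- by rewrite size_map -cardE.
Qed.

Section TorusZeros.
Context {R : realType} {d : nat}.
Local Notation C := R[i].
Variables (q : {ffun 'I_d -> nat} -> C) (D : nat).
Hypothesis q_deg : forall u, (D < mi_deg u)%N -> q u = 0.
Hypothesis q0 : box_eval D q 0 != 0.
Local Notation Q := (box_eval D q).

Lemma box_eval_rotation (t : 'rV[C]_d) : exists2 p : {poly C},
  (size p <= D.+1)%N & forall l, p.[l] = Q (l *: t).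
Proof.
exists (\sum_(s : {ffun 'I_d -> 'I_D.+2})
   (q (box_mi s) * zmon t (box_mi s)) *: 'X^(mi_deg (box_mi s))).
  apply: (leq_trans (size_sum _ _ _)); apply/bigmax_leqP => s _.
  have [sD|Ds] := leqP (mi_deg (box_mi s)) D.
    by apply: (leq_trans (size_scale_leq _ _)); rewrite size_polyXn.
  by rewrite q_deg// mul0r scale0r size_poly0.
move=> l; rewrite horner_sum; apply: eq_bigr => s _.
by rewrite hornerZ hornerXn zmonZ -mulrA (mulrC (zmon _ _)).
Qed.

(** On the complex line through [t], [Q] is a polynomial of degree at most [D] with value [Q 0] at
    the origin. More than [D] small values would force [Q 0] to be small; [eta] depends on the nodes
    but not on [t]. *)
Lemma few_small_rotations (L : nat) : (0 < L)%N ->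
  exists2 eta : C, 0 < eta & forall t : 'rV[C]_d,
    (#|[set j : 'I_L | (`|Q (unity_root L j *: t)| <= eta)%R]| <= D)%N.
Proof.
move=> L0; pose x (j : 'I_L) : C := unity_root L j.
have xinj : injective x.
  by move=> i j /(unity_root_inj (ltn_ord i) (ltn_ord j)) /ord_inj.
(* Bounds every inverse difference of nodes; being at least 1, its powers may all be raised to the
   exponent [L]. *)
pose ka : C := 1 + \sum_j \sum_i `|(x j - x i)^-1|.
have s0 : 0 <= \sum_j \sum_i `|(x j - x i)^-1|.
  by apply: sumr_ge0 => j _; apply: sumr_ge0 => i _; exact: normr_ge0.
have ka1 : 1 <= ka by rewrite lerDl.
have kaij i j : `|(x j - x i)^-1| <= ka.
  rewrite /ka (bigD1 j)//= (bigD1 i)//= addrCA -!addrA lerDl.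
  apply: addr_ge0; first by apply: sumr_ge0.
  apply: addr_ge0; first exact: ler01.
  by apply: sumr_ge0 => k _; apply: sumr_ge0.
have L0' : 0 < L%:R :> C by rewrite ltr0n.
have ka0 : 0 < ka by apply: lt_le_trans ka1.
have den0 : 0 < 2 * L%:R * ka ^+ L by rewrite !mulr_gt0// ?ltr0n// exprn_gt0.
(* Chosen so that the interpolation bound comes out as [|Q 0| / 2]. *)
exists (`|Q 0| / (2 * L%:R * ka ^+ L)); first by rewrite divr_gt0// normr_gt0.
move=> t; set eta := _ / _; set J := [set j | _]; rewrite leqNgt; apply/negP => DJ.
have [p psize pE] := box_eval_rotation t.
have := lagrange_at0 xinj (leq_trans psize DJ).
rewrite pE scale0r => Q0E.
have : `|Q 0| <= L%:R * (eta * ka ^+ L).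
  rewrite Q0E; apply: (le_trans (ler_norm_sum _ _ _)).
  apply: (@le_trans _ _ (\sum_(j in J) eta * ka ^+ L)); last first.
    rewrite sumr_const -[leLHS]mulr_natl ler_wpM2r ?mulr_ge0 ?exprn_ge0//.
    - by rewrite invr_ge0 ltW.
    - exact: ltW.
    - by rewrite ler_nat -[leqRHS]card_ord max_card.
  apply: ler_sum => j jJ; rewrite normrM; apply: ler_pM => //.
    by rewrite pE; move: jJ; rewrite inE.
  rewrite normr_prod; apply: (@le_trans _ _ (\prod_(i in J :\ j) ka)).
    apply: ler_prod => i _; rewrite normr_ge0 normrM normrN normr_cis mul1r.
    exact: kaij.
  rewrite prodr_const; apply: ler_weXn2l => //.
  by rewrite -[leqRHS]card_ord max_card.
have -> : L%:R * (eta * ka ^+ L) = `|Q 0| / 2.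
  rewrite /eta; move: (lt0r_neq0 (exprn_gt0 L ka0)) (lt0r_neq0 L0').
  by move: (ka ^+ L) (L%:R) => y z y0 z0; field; rewrite y0 z0.
rewrite ler_pdivlMr ?ltr0n// mulr_natr mulr2n gerDl.
by rewrite normr_le0 (negbTE q0).
Qed.

Lemma zmon_lipschitz (s t : 'rV[C]_d) (u : {ffun 'I_d -> nat}) (e : C) :
    (forall k, `|s 0 k| = 1) -> (forall k, `|t 0 k| = 1) ->
    (forall k, `|s 0 k - t 0 k| <= e) ->
  `|zmon s u - zmon t u| <= (mi_deg u)%:R * e.
Proof.
move=> s1 t1 ste.
have powB (a b : C) m : `|a| = 1 -> `|b| = 1 -> `|a - b| <= e ->
    `|a ^+ m - b ^+ m| <= m%:R * e.
  move=> a1 b1 ab; elim: m => [|m IH]; first by rewrite subrr normr0 mul0r.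
  have -> : a ^+ m.+1 - b ^+ m.+1 = (a - b) * a ^+ m + b * (a ^+ m - b ^+ m).
    by rewrite !exprS; ring.
  apply: (le_trans (ler_normD _ _)); rewrite !normrM normrX a1 expr1n mulr1 b1 mul1r.
  by rewrite -add1n natrD mulrDl mul1r; apply: lerD.
rewrite /zmon /mi_deg; elim: (index_enum _) => [|k r IH].
  by rewrite !big_nil subrr normr0 mul0r.
rewrite !big_cons natrD mulrDl.
set a := s 0 k ^+ _; set b := t 0 k ^+ _; set x := \prod_(_ <- r) _ in IH *.
set y := \prod_(_ <- r) _ in IH *.
have -> : a * x - b * y = (a - b) * x + b * (x - y) by ring.
apply: (le_trans (ler_normD _ _)); rewrite !normrM; apply: lerD.
  rewrite (_ : `|x| = 1) ?mulr1; first exact: powB.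
  by rewrite /x normr_prod big1// => i _; rewrite normrX s1 expr1n.
by rewrite /b normrX t1 expr1n mul1r.
Qed.

Lemma box_eval_uniform (eta : C) : 0 < eta ->
  exists2 e : R, 0 < e & forall s t : 'rV[C]_d,
    (forall k, `|s 0 k| = 1) -> (forall k, `|t 0 k| = 1) ->
    (forall k, `|s 0 k - t 0 k| <= e%:C%C) -> `|Q s - Q t| <= eta.
Proof.
move=> eta0.
pose K : C := \sum_(s : {ffun 'I_d -> 'I_D.+2}) `|q (box_mi s)| * (mi_deg (box_mi s))%:R.
have K0 : 0 <= K by apply: sumr_ge0 => s _; rewrite mulr_ge0.
have K1 : 0 < K + 1 by rewrite ltr_wpDl.
pose e := eta / (K + 1); have e0 : 0 < e by rewrite divr_gt0.
have eE : e = (Re e)%:C%C by rewrite RRe_real// gtr0_real.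
exists (Re e) => [|s t s1 t1 ste]; first by rewrite -(ltcR 0) -eE.
rewrite -sumrB; apply: (le_trans (ler_norm_sum _ _ _)).
apply: (@le_trans _ _ (K * e)).
  rewrite mulr_suml; apply: ler_sum => u _; rewrite -mulrBr normrM -mulrA ler_wpM2l//.
  by apply: zmon_lipschitz => // k; rewrite eE.
rewrite /e mulrCA ler_piMr ?(ltW eta0)// ler_pdivrMr// mul1r lerDl.
exact: ler01.
Qed.

Lemma cis_near1 (e : R) : 0 < e ->
  exists2 r : R, 0 < r & forall y, 0 <= y -> y <= r -> `|1 - cis y| <= e%:C%C.
Proof.
move=> e0; have e2 : 0 < e / 2 by rewrite divr_gt0.
have /cvgrPdist_lt/(_ _ e2)/nbhs_ballP[r1 /= r10 h1] := @continuous_cos R 0.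
have /cvgrPdist_lt/(_ _ e2)/nbhs_ballP[r2 /= r20 h2] := @continuous_sin R 0.
have m0 : 0 < Num.min r1 r2 by rewrite lt_min r10.
exists (Num.min r1 r2 / 2) => [|y y0 yr]; first by rewrite divr_gt0.
have yr' : y < Num.min r1 r2.
  apply: (le_lt_trans yr); rewrite ltr_pdivrMr// mulr_natr mulr2n.
  by rewrite ltrDl.
move: yr'; rewrite lt_min => /andP[yr1 yr2].
have by0 r : y < r -> ball (0 : R) r y by rewrite /ball/= sub0r normrN ger0_norm.
have := h1 y (by0 _ yr1); have := h2 y (by0 _ yr2); rewrite cos0 sin0 => hs hc.
apply: (le_trans (normc_leD _)); rewrite lecR /cis.
apply: (@le_trans _ _ (`|1 - cos y| + `|0 - sin y|)); first by [].
by rewrite (splitr e); apply: lerD; exact: ltW.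
Qed.

Section Cells.
Variables (L N' : nat).
Hypothesis L0 : (0 < L)%N.
Hypothesis N0' : (0 < N')%N.
Local Notation N := (L * N')%N.
Local Notation cell := {ffun 'I_d -> 'I_N}.

Let N0 : (0 < N)%N. Proof. by rewrite muln_gt0 L0. Qed.

(** With [N = L * N'], moving by [j * N'] cells multiplies every coordinate by the same [L]-th root
    of unity. *)
Definition rotate_cell (j : 'I_L) (e : cell) : cell :=
  [ffun k => Ordinal (ltn_pmod (e k + j * N') N0)].

Lemma rotate_cell_inj j : injective (rotate_cell j).
Proof.
move=> e e' /ffunP ee'; apply/ffunP => k; apply: val_inj.
have /(congr1 val) := ee' k; rewrite !ffunE /= => /eqP.
by rewrite eqn_modDr !modn_small// => /eqP.
Qed.

Lemma torus_grid_rotate j e :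
  torus_grid (rotate_cell j e) = unity_root L j *: torus_grid e :> 'rV[C]_d.
Proof.
apply/rowP => k; rewrite !mxE ffunE /=.
have modE a : unity_root N (a %% N) = unity_root N a :> C.
  rewrite [in RHS](divn_eq a N) unity_rootD [X in _ = X * _](_ : _ = 1) ?mul1r//.
  by rewrite unity_rootE exprM -unity_rootE unity_rootX.
rewrite modE unity_rootD mulrC; congr (_ * _); congr cis.
have N'0 : N'%:R != 0 :> R by rewrite pnatr_eq0 -lt0n.
have LR0 : L%:R != 0 :> R by rewrite pnatr_eq0 -lt0n.
by rewrite !natrM; field; rewrite LR0 N'0.
Qed.

(* Double counting over the [L] rotations by multiples of [N'] cells. *)
Lemma bad_cells_count (eta : C) :
    (forall t : 'rV[C]_d,
      (#|[set j : 'I_L | (`|Q (unity_root L j *: t)| <= eta)%R]| <= D)%N) ->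
  (#|[set e : cell | (`|Q (torus_grid e)| <= eta)%R]| * L <= N ^ d * D)%N.
Proof.
move=> few; set bad := [set e | _].
have cardsum (T : finType) (A : {set T}) : (\sum_x (x \in A) = #|A|)%N.
  by rewrite -sum1_card [RHS]big_mkcond/=; apply: eq_bigr => x _; case: (x \in A).
have -> : (#|bad| * L = \sum_(j < L) \sum_(e : cell) (rotate_cell j e \in bad))%N.
  have h (j : 'I_L) : (\sum_(e : cell) (rotate_cell j e \in bad) = #|bad|)%N.
    rewrite -cardsum; apply/esym; exact: (reindex_inj (@rotate_cell_inj j)).
  by rewrite (eq_bigr _ (fun j _ => h j)) sum_nat_const card_ord mulnC.
rewrite exchange_big/=; apply: (@leq_trans (\sum_(e : cell) D)%N); last first.
  by rewrite sum_nat_const card_ffun !card_ord.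
apply: leq_sum => e _; apply: leq_trans (few (torus_grid e)).
rewrite -cardsum; apply: leq_sum => j _.
by rewrite !inE torus_grid_rotate.
Qed.

Lemma cell_of_point (x : 'rV[R]_d) : (forall k, 0 <= x 0 k < 2 * pi) ->
  exists e : cell, forall k, 2 * pi * (e k)%:R / N%:R <= x 0 k <= 2 * pi * (e k).+1%:R / N%:R.
Proof.
move=> xin.
have NR0 : 0 < N%:R :> R by rewrite ltr0n.
have p2 : 0 < 2 * pi :> R by rewrite mulr_gt0 ?pi_gt0.
pose y k : R := x 0 k * N%:R / (2 * pi).
have y0 k : 0 <= y k.
  by rewrite divr_ge0 ?(ltW p2)// mulr_ge0 ?ler0n//; have /andP[] := xin k.
have yt k := truncn_itv (y0 k).
have yN k : (Num.truncn (y k) < N)%N.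
  have /andP[h _] := yt k; rewrite -(ltr_nat R); apply: (le_lt_trans h).
  by rewrite ltr_pdivrMr// mulrC ltr_pM2l//; have /andP[] := xin k.
exists [ffun k => Ordinal (yN k)] => k; rewrite ffunE /=.
have /andP[h1 h2] := yt k.
have xE : x 0 k = 2 * pi * y k / N%:R.
  rewrite /y; move: (lt0r_neq0 NR0) (lt0r_neq0 p2).
  by move: (2 * pi) (N%:R : R) => u v v0 u0; field; rewrite u0 v0.
by rewrite xE !ler_pM2r ?invr_gt0// !ler_pM2l// h1 (ltW h2).
Qed.

End Cells.

Theorem torus_zeros_null : (0 < d)%N ->
  lebesgue_null [set x : 'rV[R]_d |
    (forall k, 0 <= x 0 k < 2 * pi) /\ Q (torus_point x) = 0]%classic.
Proof.
move=> hd eps eps0.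
have p2 : 0 < 2 * pi :> R by rewrite mulr_gt0 ?pi_gt0.
(* Bad cells are at most a fraction [D / L] of the torus of volume [(2 pi)^d]; this [L] brings their
   total volume below [eps]. *)
pose L := (Num.truncn ((2 * pi) ^+ d * D%:R / eps)).+1.
have LP : (2 * pi) ^+ d * D%:R / eps < L%:R.
  have /truncn_itv/andP[] // : 0 <= (2 * pi) ^+ d * D%:R / eps.
  by rewrite divr_ge0 ?(ltW eps0)// mulr_ge0 ?ler0n// exprn_ge0// ltW.
have L0 : (0 < L)%N by [].
have [eta eta0 few] := few_small_rotations L0.
have [de de0 unif] := box_eval_uniform eta0.
have [r r0 cis1] := cis_near1 de0.
(* Makes the side of a cell at most [r], so [Q] varies by at most [eta] between a grid point and its
   cell: a cell with a zero is bad. *)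
pose N' := (Num.truncn (2 * pi / r)).+1.
have N'P : 2 * pi / r < N'%:R.
  have /truncn_itv/andP[] // : 0 <= 2 * pi / r by rewrite divr_ge0 ?ltW.
have N0' : (0 < N')%N by [].
pose N := (L * N')%N.
have N0 : (0 < N)%N by rewrite muln_gt0.
have NR0 : 0 < N%:R :> R by rewrite ltr0n.
have Nr : 2 * pi / N%:R <= r.
  rewrite ler_pdivrMr//; move: N'P; rewrite ltr_pdivrMr// => /ltW N'P.
  by apply: (le_trans N'P); rewrite mulrC ler_wpM2l ?(ltW r0)// ler_nat leq_pmull.
pose bad := [set e : {ffun 'I_d -> 'I_N} | (`|Q (torus_grid e)| <= eta)%R].
have badL : (#|bad| * L <= N ^ d * D)%N by exact: bad_cells_count.
pose s := enum bad; have sbad : size s = #|bad| by rewrite -cardE.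
pose e0 : {ffun 'I_d -> 'I_N} := [ffun=> Ordinal N0].
pose cl l := nth e0 s l.
(* Beyond the list of bad cells both corners are the origin; these degenerate boxes have volume 0
   since [d] is positive. *)
pose a (l : nat) : 'rV[R]_d :=
  \row_k (if (l < size s)%N then 2 * pi * (cl l k)%:R / N%:R else 0).
pose b (l : nat) : 'rV[R]_d :=
  \row_k (if (l < size s)%N then 2 * pi * (cl l k).+1%:R / N%:R else 0).
pose v : R := (2 * pi / N%:R) ^+ d.
have v0 : 0 <= v by rewrite exprn_ge0// divr_ge0 ?ler0n// ltW.
have vol l : \prod_k (b l 0 k - a l 0 k) = if (l < size s)%N then v else 0.
  case: ltnP => ls; last first.
    by rewrite (bigD1 (Ordinal hd))//= !mxE ltnNge ls subrr mul0r.
  transitivity (\prod_(k < d) (2 * pi / N%:R) : R); last by rewrite prodr_const card_ord.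
  apply: eq_bigr => k _.
  rewrite !mxE ls -mulrBl -mulrBr -natrB ?leqnSn// subSnn mulr1.
  by [].
exists a, b; split.
- move=> l k; rewrite !mxE; case: ifP => // _.
  by rewrite ler_pM2r ?invr_gt0// ler_pM2l// ler_nat.
- move=> x [xin Qx].
  have [e ex] := cell_of_point L0 N0' xin.
  have ebad : e \in bad.
    rewrite inE -[Q _]subr0 -Qx; apply: unif.
    + by move=> k; rewrite mxE normr_cis.
    + by move=> k; rewrite mxE normr_cis.
    move=> k; rewrite !mxE; have /andP[h1 h2] := ex k.
    rewrite -/(cis (x 0 k)) -(subrK (2 * pi * (e k)%:R / N%:R) (x 0 k)) cisD mulrC.
    rewrite -{1}[unity_root _ _]mulr1 -/(unity_root N (e k)) -mulrBr normrM normr_cis mul1r.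
    apply: cis1; first by rewrite subr_ge0.
    apply: le_trans Nr; rewrite lerBlDl; apply: (le_trans h2).
    by rewrite -[(e k).+1%:R]natr1 mulrDr mulr1 mulrDl.
  exists (index e s) => // k; rewrite !mxE.
  have es : (index e s < size s)%N by rewrite index_mem mem_enum.
  by rewrite es /cl nth_index ?mem_enum.
have Sn n : \sum_(0 <= l < n) (if (l < size s)%N then v else 0) <= #|bad|%:R * v.
  have -> : \sum_(0 <= l < n) (if (l < size s)%N then v else 0) = (minn n (size s))%:R * v.
    elim: n => [|n IH]; first by rewrite big_geq// min0n mul0r.
    rewrite big_nat_recr//= IH; case: ltnP => h.
      by rewrite (minn_idPl h) -natr1 mulrDl mul1r.
    by rewrite addr0 (minn_idPr (leqW h)).
  by rewrite ler_wpM2r// ler_nat -sbad geq_minr.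
have bv : #|bad|%:R * v <= eps.
  have h : #|bad|%:R * L%:R <= N%:R ^+ d * D%:R :> R.
    by rewrite -natrX -!natrM ler_nat.
  have Nd : 0 < N%:R ^+ d :> R by rewrite exprn_gt0.
  have LR : 0 < L%:R :> R by rewrite ltr0n.
  rewrite -(ler_pM2r LR) mulrAC /v expr_div_n mulrA ler_pdivrMr//.
  apply: (@le_trans _ _ (N%:R ^+ d * D%:R * (2 * pi) ^+ d)).
    by rewrite ler_wpM2r// exprn_ge0// ltW.
  rewrite -mulrA mulrC ler_wpM2r ?(ltW Nd)// mulrC.
  by move: LP; rewrite ltr_pdivrMr// => /ltW; rewrite (mulrC eps).
apply: lime_le.
  by apply: is_cvg_nneseries => l _ _; rewrite lee_fin vol; case: ifP.
apply: nearW => n; rewrite sumEFin lee_fin; apply: le_trans bv.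
by under eq_bigr do rewrite vol; exact: Sn.
Qed.

End TorusZeros.

(** * The equivalences *)

Lemma CIHA_of_realization (R : realType) (d n : nat) (F : 'rV[R[i]]_d -> 'M[R[i]]_n)
    (m : 'I_d -> nat) (W : 'M[R[i]]_(\sum_k m k)) (beta : 'M[R[i]]_n)
    (V : 'M[R[i]]_(\sum_k m k, n)) : (0 < d)%N ->
    W \is unitarymx -> beta + (beta^t*) = 0 ->
    (forall z, polydisc z -> F z = realization W beta V z) ->
  CIHA_rat F.
Proof.
move=> hd W_unitary skew FE.
have Frat : rational_on_polydisc F.
  move=> i j; have [p [q pq]] := realization_rational beta V W_unitary i j.
  by exists p, q => z zD; rewrite FE//; exact: pq.
have Fhol := rational_holomorphic Frat.
have [q qP] := mpoly_pencil W beta V.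
have [D qD] := mpcoef_bound q.
have qE (z : 'rV[R[i]]_d) : box_eval D (mpcoef q) z = \det (W - diag_blocks m z).
  rewrite -(qP z).1; apply/esym.
  by apply: meval_box => u Du; apply: qD; exact: ltnW.
have q0 : box_eval D (mpcoef q) 0 != 0.
  by rewrite qE; apply: pencil_det_neq0 => //; exact: polydisc0.
split=> //; first split=> //.
- by move=> z zD; rewrite FE//; exact: realization_psd.
(* Boundary values can fail only where the determinant vanishes, so a covering of its zeros serves
   as covering here. *)
- move=> e e0; have [a [b [ab zab sab]]] := torus_zeros_null qD q0 hd e0.
  exists a, b; split=> // x [xin xbad]; apply: zab; split=> //.
  rewrite qE; apply/eqP; apply: contrapT => /negP dt; apply: xbad.
  exists (realization W beta V (torus_point x)).
    exact: realization_boundary.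
  apply: realization_torus; [exact: W_unitary|exact: skew|by move=> k; rewrite mxE normr_cis|].
  by rewrite unitmxE unitfE.
- split=> //; exists (realization_coef W beta V).
    exact: realization_taylor.
  move=> H ip T; exact: realization_op_accretive.
Qed.

Unset Implicit Arguments.

Theorem theorem5p1 (R : realType) (d n : nat) (hd : (0 < d)%N) (hn : (0 < n)%N)
    (F : 'rV[R[i]]_d -> 'M[R[i]]_n) :
  (CIHA_rat F <->
   exists (N : 'I_d -> nat) (xi : forall k, 'rV[R[i]]_d -> 'M[R[i]]_(N k, n)),
     [/\ forall k, (0 < N k)%N,
         forall k, rational_on_polydisc (xi k) &
         forall w z : 'rV[R[i]]_d, polydisc w -> polydisc z ->
           (F w)^t* + F z =
             \sum_k (1 - (w 0 k)^* * z 0 k) *: ((xi k w)^t* *m xi k z)])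
  /\
  (CIHA_rat F <->
   exists (m : 'I_d -> nat) (W : 'M[R[i]]_(\sum_k m k)) (beta : 'M[R[i]]_n)
     (V : 'M[R[i]]_(\sum_k m k, n)),
     [/\ W \is unitarymx,
         beta + beta^t* = 0 &
         forall z : 'rV[R[i]]_d, polydisc z ->
           F z = beta + V^t* *m invmx (W - diag_blocks m z)
                          *m (W + diag_blocks m z) *m V]).
Proof.
have h31 : (exists (m : 'I_d -> nat) (W : 'M[R[i]]_(\sum_k m k)) (beta : 'M[R[i]]_n)
     (V : 'M[R[i]]_(\sum_k m k, n)),
     [/\ W \is unitarymx, beta + beta^t* = 0 &
         forall z : 'rV[R[i]]_d, polydisc z ->
           F z = beta + V^t* *m invmx (W - diag_blocks m z)
                          *m (W + diag_blocks m z) *m V]) -> CIHA_rat F.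
  by move=> [m [W [beta [V [WU skew FE]]]]]; exact: CIHA_of_realization hd WU skew FE.
split; split=> [FC|].
- exact: kernel_of_CIHA.
(* The kernel identity leads back to the class by way of the unitary realization. *)
- move=> [N [xi [_ _ ker]]]; apply: h31; exists N.
  exact: realization_of_kernel ker.
- have [N [xi [_ _ ker]]] := kernel_of_CIHA hd hn FC.
  by exists N; exact: realization_of_kernel ker.
- exact: h31.
Qed.
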